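(* Consider the closed-loop tracking error system \[ \dot R_e = R_e\,\omega_e^{\times},\qquad J\dot\omega_e = C_K x_K + D_\theta e_R + D_\omega \omega_e,\qquad \dot x_K = A_K x_K + B_\theta e_R + B_\omega \omega_e \] on $\mathrm{SO}(3)\times\mathbb{R}^3\times\mathbb{R}^n$, and the function $V$ defined in the context. Suppose the Lyapunov coefficients satisfy \[ \mathcal{P}=\begin{bmatrix}p_{11}I&P_{21}^\top J&P_{31}^\top\\ JP_{21}&P_{22}J&JP_{32}^\top\\ P_{31}&P_{32}J&P_{33}\end{bmatrix}>0 \] and that there exist $\tau_1,\tau_2>0$ with $\mathcal{M}_1<0$, where $\mathcal{M}_1$ is defined in the context. Then: (1) the zero equilibrium of the errors $(e_R,\omega_e,x_K)$ is stable; (2) $(e_R,\omega_e,x_K)\to0$ as $t\to\infty$; hence $R_e(t)\to\{I\}\cup\{\exp(\pi\alpha^\times):\alpha\in\mathbb{S}^2\}$ and $(\omega_e,x_K)\to0$; (3) the undesired equilibria $(R_e,\omega_e,x_K)=(\exp(\pi\alpha^\times),0,0)$, $\alpha\in\mathbb{S}^2$, are unstable; (4) the desired equilibrium $(R_e,\omega_e,x_K)=(I,0,0)$ is almost globally asymptotically stable.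
   Context: $J\in\mathbb{R}^{3\times3}$ is symmetric positive definite. For $v\in\mathbb{R}^3$, $v^\times$ is the skew-symmetric matrix with $v^\times y=v\times y$, and $(\cdot)^\vee$ is its inverse. Every $R\in\mathrm{SO}(3)$ can be written $R=\exp(\theta\alpha^\times)=I+\sin\theta\,\alpha^\times+(1-\cos\theta)\alpha^\times\alpha^\times$ with $\alpha\in\mathbb{S}^2$, $\theta\in\mathbb{R}$. $\Psi(R_e)=\tfrac12\mathrm{tr}(I-R_e)$, $e_R=\tfrac12(R_e-R_e^\top)^\vee$. The controller matrices $A_K\in\mathbb{R}^{n\times n}$, $B_\theta,B_\omega\in\mathbb{R}^{n\times3}$, $C_K\in\mathbb{R}^{3\times n}$, $D_\theta,D_\omega\in\mathbb{R}^{3\times3}$ are given and form a minimal realization. $V(R_e,\omega_e,x_K)=2p_{11}\Psi(R_e)+\omega_e^\top P_{22}J\omega_e+2e_R^\top P_{21}^\top J\omega_e+x_K^\top P_{33}x_K+2x_K^\top P_{31}e_R+2x_K^\top P_{32}J\omega_e$, with $p_{11}\in\mathbb{R}$, $P_{21},P_{22}\in\mathbb{R}^{3\times3}$, $P_{31},P_{32}\in\mathbb{R}^{n\times3}$, $P_{33}\in\mathbb{R}^{n\times n}$, $P_{22},P_{33}$ symmetric and $P_{22}J=JP_{22}$. Define $M_{11}=P_{21}^\top D_\theta+D_\theta^\top P_{21}+P_{31}^\top B_\theta+B_\theta^\top P_{31}$, $M_{22}=P_{22}D_\omega+D_\omega^\top P_{22}+JP_{32}^\top B_\omega+B_\omega^\top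 P_{32}J$, $M_{21}=p_{11}I+P_{22}D_\theta+D_\omega^\top P_{21}+JP_{32}^\top B_\theta+B_\omega^\top P_{31}$, $M_{33}=P_{32}C_K+C_K^\top P_{32}^\top+P_{33}A_K+A_K^\top P_{33}$, $M_{31}=P_{32}D_\theta+C_K^\top P_{21}+A_K^\top P_{31}+P_{33}B_\theta$, $M_{32}=P_{32}D_\omega+C_K^\top P_{22}+A_K^\top P_{32}J+P_{33}B_\omega$, and $\mathcal{M}_1=\begin{bmatrix}M_{11}&M_{21}^\top&M_{31}^\top\\ M_{21}&\tilde M_{22}&M_{32}^\top\\ M_{31}&M_{32}&\tilde M_{33}\end{bmatrix}$ with $\tilde M_{22}=M_{22}+(\tau_1+\tau_2)I+\frac1{\tau_2}JP_{21}P_{21}^\top J$, $\tilde M_{33}=M_{33}+\frac1{\tau_1}P_{31}P_{31}^\top$. For symmetric matrices, $>0$ ($<0$) means positive (negative) definite. Almost global asymptotic stability means the equilibrium is stable and attracts all solutions except those starting in a set of Lebesgue (Riemannian) measure zero. *)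

(* Defs.v *)
From HB Require Import structures.
From mathcomp Require Import all_boot all_order all_algebra.
From mathcomp Require Import all_classical all_reals all_analysis.
Set Implicit Arguments. Unset Strict Implicit. Unset Printing Implicit Defensive.
Import Order.TTheory GRing.Theory Num.Theory.
Import numFieldNormedType.Exports.
Local Open Scope ring_scope.

Section Defs.
Variable R : realType.

Definition mnorm m k (A : 'M[R]_(m, k)) : R :=
  Num.sqrt (\sum_(i < m) \sum_(j < k) A i j ^+ 2).

(* hat map v^x, so that (skew v) *m y = v \times y *)
Definition vc (v : 'cV[R]_3) (k : nat) : R := v (inord k) 0.
Definition skew (v : 'cV[R]_3) : 'M[R]_3 :=
  \matrix_(i < 3, j < 3)
    match nat_of_ord i, nat_of_ord j with
    | 0, 1 => - vc v 2 | 0, 2 => vc v 1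
    | 1, 0 => vc v 2   | 1, 2 => - vc v 0
    | 2, 0 => - vc v 1 | 2, 1 => vc v 0
    | _, _ => 0 end.
(* vee map, inverse of skew on skew-symmetric matrices *)
Definition vee (M : 'M[R]_3) : 'cV[R]_3 :=
  \col_(i < 3) match nat_of_ord i with
    | 0 => M (inord 2) (inord 1)
    | 1 => M (inord 0) (inord 2)
    | _ => M (inord 1) (inord 0) end.

Definition SO3 : set 'M[R]_3 := [set Q | Q^T *m Q = 1 /\ \det Q = 1].
Definition S2 : set 'cV[R]_3 := [set a | \sum_(i < 3) a i 0 ^+ 2 = 1].

(* Rodrigues formula exp(theta a^x) *)
Definition expso3 (theta : R) (a : 'cV[R]_3) : 'M[R]_3 :=
  1 + sin theta *: skew a + (1 - cos theta) *: (skew a *m skew a).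

(* exp(v^x) for arbitrary v in R^3 (chart used for null sets on SO(3)) *)
Definition expv (v : 'cV[R]_3) : 'M[R]_3 :=
  if v == 0 then 1 else expso3 (mnorm v) ((mnorm v)^-1 *: v).

Definition Psi (Re : 'M[R]_3) : R := 2^-1 * \tr (1 - Re).
Definition eR (Re : 'M[R]_3) : 'cV[R]_3 := 2^-1 *: vee (Re - Re^T).

Definition posdef m (A : 'M[R]_m) : Prop :=
  A^T = A /\ forall x : 'cV[R]_m, x != 0 -> 0 < (x^T *m A *m x) 0 0.
Definition negdef m (A : 'M[R]_m) : Prop := posdef (- A).

Definition controllable n p (A : 'M[R]_n) (B : 'M[R]_(n, p)) : Prop :=
  \rank (\sum_(k < n) <<B^T *m (A^T) ^+ k>>)%MS = n.
Definition observable n q (A : 'M[R]_n) (C : 'M[R]_(q, n)) : Prop :=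
  \rank (\sum_(k < n) <<C *m A ^+ k>>)%MS = n.
Definition minimal_realization n p q (A : 'M[R]_n) (B : 'M[R]_(n, p))
  (C : 'M[R]_(q, n)) (D : 'M[R]_(q, p)) : Prop :=
  controllable A B /\ observable A C.

Definition Pmat n (J : 'M[R]_3) (p11 : R) (P21 P22 : 'M[R]_3)
  (P31 P32 : 'M[R]_(n, 3)) (P33 : 'M[R]_n) : 'M[R]_(3 + (3 + n)) :=
  block_mx (p11%:M) (row_mx (P21^T *m J) P31^T)
           (col_mx (J *m P21) P31)
           (block_mx (P22 *m J) (J *m P32^T) (P32 *m J) P33).

Definition M1mat n (J : 'M[R]_3) (AK : 'M[R]_n) (Bth Bom : 'M[R]_(n, 3))
  (CK : 'M[R]_(3, n)) (Dth Dom : 'M[R]_3)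
  (p11 : R) (P21 P22 : 'M[R]_3) (P31 P32 : 'M[R]_(n, 3)) (P33 : 'M[R]_n)
  (tau1 tau2 : R) : 'M[R]_(3 + (3 + n)) :=
  let M11 := P21^T *m Dth + Dth^T *m P21 + P31^T *m Bth + Bth^T *m P31 in
  let M22 := P22 *m Dom + Dom^T *m P22 + J *m P32^T *m Bom + Bom^T *m P32 *m J in
  let M21 := p11%:M + P22 *m Dth + Dom^T *m P21 + J *m P32^T *m Bth
             + Bom^T *m P31 in
  let M33 := P32 *m CK + CK^T *m P32^T + P33 *m AK + AK^T *m P33 in
  let M31 := P32 *m Dth + CK^T *m P21 + AK^T *m P31 + P33 *m Bth in
  let M32 := P32 *m Dom + CK^T *m P22 + AK^T *m P32 *m J + P33 *m Bom in
  let M22t := M22 + (tau1 + tau2)%:M + tau2^-1 *: (J *m P21 *m P21^T *m J) in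
  let M33t := M33 + tau1^-1 *: (P31 *m P31^T) in
  block_mx M11 (row_mx M21^T M31^T) (col_mx M21 M31)
           (block_mx M22t M32^T M32 M33t).

Definition is_solution n (J : 'M[R]_3) (AK : 'M[R]_n) (Bth Bom : 'M[R]_(n, 3))
  (CK : 'M[R]_(3, n)) (Dth Dom : 'M[R]_3)
  (Re : R -> 'M[R]_3) (w : R -> 'cV[R]_3) (x : R -> 'cV[R]_n) : Prop :=
  SO3 (Re 0) /\
  forall t : R, 0 <= t ->
    (forall i j, is_derive t (1 : R) (fun s => Re s i j) ((Re t *m skew (w t)) i j))
    /\ (exists dw : 'cV[R]_3,
          (forall i, is_derive t (1 : R) (fun s => w s i 0) (dw i 0)) /\
          J *m dw = CK *m x t + Dth *m eR (Re t) + Dom *m w t)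
    /\ (forall i, is_derive t (1 : R) (fun s => x s i 0)
                    ((AK *m x t + Bth *m eR (Re t) + Bom *m w t) i 0)).

Definition sdist n (Q1 : 'M[R]_3) (w1 : 'cV[R]_3) (x1 : 'cV[R]_n)
  (Q2 : 'M[R]_3) (w2 : 'cV[R]_3) (x2 : 'cV[R]_n) : R :=
  mnorm (Q1 - Q2) + mnorm (w1 - w2) + mnorm (x1 - x2).

Definition stable_eq n J (AK : 'M[R]_n) Bth Bom CK Dth Dom (Q : 'M[R]_3) : Prop :=
  forall eps : R, 0 < eps -> exists del : R, 0 < del /\
    forall Re w x, is_solution J AK Bth Bom CK Dth Dom Re w x ->
      sdist (Re 0) (w 0) (x 0) Q 0 0 < del ->
      forall t, 0 <= t -> sdist (Re t) (w t) (x t) Q 0 0 < eps.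

Definition to0 (f : R -> R) : Prop :=
  forall eps : R, 0 < eps -> exists T : R, forall t, T <= t -> `|f t| < eps.

Definition lebesgue_null m (S : set 'cV[R]_m) : Prop :=
  forall eps : R, 0 < eps -> exists a b : nat -> 'cV[R]_m,
    (forall k i, a k i 0 <= b k i 0) /\
    (forall z, S z -> exists k, forall i, a k i 0 <= z i 0 <= b k i 0) /\
    (forall N, \sum_(k < N) \prod_(i < m) (b k i 0 - a k i 0) <= eps).

(* Riemannian-measure-zero subsets of SO(3) x R^3 x R^n, via the chart
   (v, w, x) |-> (exp(v^x), w, x) from R^(3+3+n) *)
Definition state_null n (N : set ('M[R]_3 * 'cV[R]_3 * 'cV[R]_n)) : Prop :=
  lebesgue_null [set z : 'cV[R]_(3 + (3 + n)) |
    N (expv (usubmx z), usubmx (dsubmx z), dsubmx (dsubmx z))].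

Definition AGAS_identity n J (AK : 'M[R]_n) Bth Bom CK Dth Dom : Prop :=
  stable_eq J AK Bth Bom CK Dth Dom 1 /\
  exists N, state_null N /\
    forall Re w x, is_solution J AK Bth Bom CK Dth Dom Re w x ->
      ~ N (Re 0, w 0, x 0) ->
      to0 (fun t => sdist (Re t) (w t) (x t) 1 0 0).

End Defs.

(* Main.v *)
(* Write c = cos theta, h = (e_R, omega_e, x_K) and let P, M_1 be the matrices of the text.  Then
   V = h^T P h + p11 (1 - c)^2, and V' <= h^T M_1 h <= -k |h|^2 by Young's inequality, because
   e_R' = E(R_e) omega_e with |E(R_e)| <= 1.  Stability follows, h -> 0 is a Barbalat argument,
   and sin theta -> 0 means c -> 1 or c -> -1.  A rotation by an angle near pi has V < 4 p11,
   and V below 4 p11 forces c -> 1: this is instability of the undesired equilibria.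

   A solution not converging to the identity has V >= 4 p11 forever and is eventually trapped in
   a small neighbourhood of the pi-rotations.  For two trapped solutions let F be the second
   variation of V at the pi-rotations, evaluated at the difference of the h's, plus
   mu |R_1 - R_2|^2.  The estimate behind V' <= -k |h|^2 yields F' <= kappa F for small mu, and F is
   bounded below, so F >= 0.  This makes one coordinate of the trapped set a Lipschitz function of
   the others, so that the set is null; Gronwall's inequality backwards in time and the local
   Lipschitz invertibility of the chart away from sin |v| = 0 transport this to the initial
   states. *)

(* The pi-rotations are a whole surface of equilibria, so each linearisation has a kernel along it,
   and a stable manifold at one point does not describe the trapped set. Comparing two trapped
   solutions treats the whole surface at once. The comparison rests on two facts. First, the rate
   estimate is an inequality between arbitrary vectors whose only kinematic input is |e_R'| <=
   |omega_e|, so it also applies to the difference of two trajectories, with E(R_1)(omega_1 -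
   omega_2) in place of e_R'. Second, E(R)^T e_R = c e_R, and c changes from about 1 near the
   identity to about -1 near the pi-rotations, so passing from V to its second variation there costs
   only a small error. This error is proportional to |R_1 - R_2|^2, whereas e_R vanishes at every
   pi-rotation and does not see the axis: hence the term with mu. Instability concerns actual
   solutions starting near a pi-rotation, hence the section on global existence. *)
Require Import Defs.
From HB Require Import structures.
From mathcomp Require Import all_boot all_order all_algebra.
From mathcomp Require Import all_classical all_reals all_analysis.
From mathcomp Require Import ring lra.
Set Implicit Arguments. Unset Strict Implicit. Unset Printing Implicit Defensive.
Import Order.TTheory GRing.Theory Num.Theory.
Import numFieldNormedType.Exports.
Local Open Scope ring_scope.

(* [all_algebra] also exports a [skew]. *)
Local Notation skew := Defs.skew.

(** * Euclidean and Frobenius norms *)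

Section InnerProduct.
Variable R : realType.

Definition dot m (u v : 'cV[R]_m) : R := \sum_(i < m) u i 0 * v i 0.
Definition sq m k (A : 'M[R]_(m, k)) : R := \sum_(i < m) \sum_(j < k) A i j ^+ 2.

Lemma dotE m (u v : 'cV[R]_m) : (u^T *m v) 0 0 = dot u v.
Proof. by rewrite mxE; apply: eq_bigr => i _; rewrite mxE. Qed.

Lemma sq_dot m (u : 'cV[R]_m) : sq u = dot u u.
Proof. by apply: eq_bigr => i _; rewrite big_ord1 expr2. Qed.

Lemma dotC m (u v : 'cV[R]_m) : dot u v = dot v u.
Proof. by apply: eq_bigr => i _; rewrite mulrC. Qed.

Lemma dotDl m (u v w : 'cV[R]_m) : dot (u + v) w = dot u w + dot v w.
Proof. by rewrite -big_split; apply: eq_bigr => i _; rewrite !mxE mulrDl. Qed.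

Lemma dotZl m a (u v : 'cV[R]_m) : dot (a *: u) v = a * dot u v.
Proof. by rewrite mulr_sumr; apply: eq_bigr => i _; rewrite !mxE mulrA. Qed.

Lemma dotNl m (u v : 'cV[R]_m) : dot (- u) v = - dot u v.
Proof. by rewrite -scaleN1r dotZl mulN1r. Qed.

Lemma dotBl m (u v w : 'cV[R]_m) : dot (u - v) w = dot u w - dot v w.
Proof. by rewrite dotDl dotNl. Qed.

Lemma dotDr m (u v w : 'cV[R]_m) : dot u (v + w) = dot u v + dot u w.
Proof. by rewrite dotC dotDl !(dotC u). Qed.

Lemma dotZr m a (u v : 'cV[R]_m) : dot u (a *: v) = a * dot u v.
Proof. by rewrite dotC dotZl dotC. Qed.

Lemma dotNr m (u v : 'cV[R]_m) : dot u (- v) = - dot u v.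
Proof. by rewrite dotC dotNl dotC. Qed.

Lemma dotBr m (u v w : 'cV[R]_m) : dot u (v - w) = dot u v - dot u w.
Proof. by rewrite dotDr dotNr. Qed.

Lemma dot_mull m k (A : 'M[R]_(m, k)) u v : dot (A *m u) v = dot u (A^T *m v).
Proof. by rewrite -!dotE trmx_mul mulmxA. Qed.

Lemma dot_mulr m k (A : 'M[R]_(m, k)) u v : dot u (A *m v) = dot (A^T *m u) v.
Proof. by rewrite dot_mull trmxK. Qed.

Lemma dot_col_mx m k (a c : 'cV[R]_m) (b d : 'cV[R]_k) :
  dot (col_mx a b) (col_mx c d) = dot a c + dot b d.
Proof.
rewrite /dot big_split_ord /=; congr (_ + _); apply: eq_bigr => i _.
  by rewrite !col_mxEu.
by rewrite !col_mxEd.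
Qed.

Lemma sq_ge0 m k (A : 'M[R]_(m, k)) : 0 <= sq A.
Proof. by apply: sumr_ge0 => i _; apply: sumr_ge0 => j _; rewrite sqr_ge0. Qed.

Lemma sq_entry m k (A : 'M[R]_(m, k)) i j : A i j ^+ 2 <= sq A.
Proof.
rewrite /sq (bigD1 i) //= (bigD1 j) //= -addrA lerDl.
rewrite addr_ge0 ?sumr_ge0 // => *; rewrite ?sumr_ge0 // => *; exact: sqr_ge0.
Qed.

Lemma sq_eq0 m k (A : 'M[R]_(m, k)) : (sq A == 0) = (A == 0).
Proof.
apply/eqP/eqP => [A0|->]; last first.
  by rewrite /sq big1 // => i _; rewrite big1 // => j _; rewrite mxE expr0n.
apply/matrixP => i j; rewrite mxE; apply/eqP; rewrite -sqrf_eq0 eq_le sqr_ge0 andbT.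
by rewrite -A0 sq_entry.
Qed.

Lemma sq0 m k : sq (0 : 'M[R]_(m, k)) = 0.
Proof. by apply/eqP; rewrite sq_eq0. Qed.

Lemma sqZ m k a (A : 'M[R]_(m, k)) : sq (a *: A) = a ^+ 2 * sq A.
Proof.
rewrite mulr_sumr; apply: eq_bigr => i _; rewrite mulr_sumr; apply: eq_bigr => j _.
by rewrite mxE exprMn.
Qed.

Lemma sqN m k (A : 'M[R]_(m, k)) : sq (- A) = sq A.
Proof. by rewrite -scaleN1r sqZ sqrrN expr1n mul1r. Qed.

Lemma sqD_le m k (A B : 'M[R]_(m, k)) : sq (A + B) <= 2 * sq A + 2 * sq B.
Proof.
rewrite /sq !mulr_sumr -big_split ler_sum // => i _.
rewrite !mulr_sumr -big_split ler_sum // => j _; rewrite !mxE /=.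
have := sqr_ge0 (A i j - B i j); nra.
Qed.

Lemma sqT m k (A : 'M[R]_(m, k)) : sq A^T = sq A.
Proof.
by rewrite /sq exchange_big; apply: eq_bigr => i _; apply: eq_bigr => j _; rewrite mxE.
Qed.

Lemma dot_sqr_le m (u v : 'cV[R]_m) : dot u v ^+ 2 <= sq u * sq v.
Proof.
have [->|v0] := eqVneq v 0.
  by rewrite dotC /dot big1 ?expr0n ?mulr_ge0 ?sq_ge0 // => i _; rewrite mxE mul0r.
have v_gt0 : 0 < sq v by rewrite lt_neqAle eq_sym sq_eq0 v0 sq_ge0.
have := sq_ge0 (sq v *: u - dot u v *: v).
rewrite sq_dot dotBl !dotBr !dotZl !dotZr -!sq_dot (dotC v u) => H.
have {}H : 0 <= sq v * (sq u * sq v - dot u v ^+ 2) by move: H; lra.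
by rewrite -subr_ge0 -(pmulr_rge0 _ v_gt0).
Qed.

Lemma dot_young m (u v : 'cV[R]_m) (k : R) : 0 < k ->
  2 * dot u v <= k * sq u + k^-1 * sq v.
Proof.
move=> k0; have := sq_ge0 (k *: u - v).
rewrite sq_dot dotBl !dotBr !dotZl !dotZr -!sq_dot (dotC v u) => H.
rewrite -(ler_pM2l k0) mulrDr !mulrA mulfV ?gt_eqF //; lra.
Qed.

Lemma sq_mulmx m k l (A : 'M[R]_(m, k)) (B : 'M[R]_(k, l)) :
  sq (A *m B) <= sq A * sq B.
Proof.
rewrite -[sq B]sqT /sq mulr_suml ler_sum // => i _.
rewrite mulr_sumr ler_sum // => j _.
pose u : 'cV[R]_k := \col_p A i p; pose v : 'cV[R]_k := \col_p B p j.
have -> : (A *m B) i j = dot u v by rewrite mxE; apply: eq_bigr => p _; rewrite !mxE.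
have -> : \sum_(p < k) A i p ^+ 2 = sq u.
  by apply: eq_bigr => p _; rewrite big_ord1 mxE.
have -> : \sum_(p < k) B^T j p ^+ 2 = sq v.
  by apply: eq_bigr => p _; rewrite big_ord1 !mxE.
exact: dot_sqr_le.
Qed.

Lemma sq_col_mx m k l (A : 'M[R]_(m, l)) (B : 'M[R]_(k, l)) :
  sq (col_mx A B) = sq A + sq B.
Proof.
rewrite /sq big_split_ord /=; congr (_ + _); apply: eq_bigr => i _;
  by apply: eq_bigr => j _; rewrite ?col_mxEu ?col_mxEd.
Qed.

Lemma mnormE m k (A : 'M[R]_(m, k)) : mnorm A = Num.sqrt (sq A).
Proof. by []. Qed.

Lemma mnorm_ge0 m k (A : 'M[R]_(m, k)) : 0 <= mnorm A.
Proof. exact: sqrtr_ge0. Qed.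

Lemma mnorm_sqr m k (A : 'M[R]_(m, k)) : mnorm A ^+ 2 = sq A.
Proof. by rewrite mnormE sqr_sqrtr ?sq_ge0. Qed.

Lemma mnorm_lt m k (A : 'M[R]_(m, k)) e : 0 < e -> (mnorm A < e) = (sq A < e ^+ 2).
Proof.
by move=> e0; rewrite -mnorm_sqr ltr_pXn2r // ?nnegrE ?mnorm_ge0 // ltW.
Qed.

(** The quadratic form attains a positive minimum on the compact unit sphere, and homogeneity
    spreads the bound to all vectors. *)
Lemma posdef_coercive m (A : 'M[R]_m) : posdef A ->
  exists2 l : R, 0 < l & forall x, l * sq x <= dot x (A *m x).
Proof.
move=> [_ Apos].
(* In dimension 0 the sphere is empty, so no minimum exists and any constant serves. *)
case: m => [|m] in A Apos *.
  exists 1 => // x; have -> : x = 0 by apply/matrixP => -[].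
  by rewrite sq0 mulr0 /dot big_ord0.
pose f (x : 'rV[R]_m.+1) := dot x^T (A *m x^T).
have fE x : f x = \sum_i \sum_j x 0 i * A i j * x 0 j.
  apply: eq_bigr => i _; rewrite !mxE mulr_sumr; apply: eq_bigr => j _.
  by rewrite !mxE mulrA.
have sumc k (g : 'I_k -> 'rV[R]_m.+1 -> R) :
    (forall i, continuous (g i)) -> continuous (fun x => \sum_i g i x).
  by move=> gc; apply: continuous_big => [|i _]; [exact: add_continuous|exact: gc].
have contM (g h : 'rV[R]_m.+1 -> R) :
    continuous g -> continuous h -> continuous (fun x => g x * h x).
  by move=> gc hc x; apply: (@continuousM _ _ g h); [exact: gc|exact: hc].
have fc : continuous f.
  rewrite (funext fE); apply: (sumc) => i; apply: (sumc) => j.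
  apply: (contM); last exact: coord_continuous.
  by apply: (contM); [exact: coord_continuous|exact: cst_continuous].
have sc : continuous (fun x : 'rV[R]_m.+1 => sq x^T).
  have -> : (fun x : 'rV[R]_m.+1 => sq x^T) = fun x => \sum_j x 0 j * x 0 j.
    by apply/funext => x; rewrite sq_dot; apply: eq_bigr => j _; rewrite !mxE.
  by apply: (sumc) => j; apply: (contM); exact: coord_continuous.
pose S := [set x : 'rV[R]_m.+1 | sq x^T = 1]%classic.
have Sc : compact S.
  apply: (@subclosed_compact _ S
    [set v : 'rV[R]_m.+1 | forall i, `[(-1 : R), 1]%classic (v ord0 i)]%classic).
  - by apply: (preimage_closed _ (@closed_eq R 1)) => x _; exact: sc.
  - by apply: (@rV_compact R m.+1 (fun=> `[(-1 : R), 1]%classic)) => i; exact: segment_compact.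
  - move=> v Sv i /=; rewrite in_itv /= -ler_norml -(@expr_le1 _ 2) // real_normK ?num_real //.
    by rewrite -Sv; have := sq_entry v^T i 0; rewrite mxE.
have S0 : (S !=set0)%classic.
  exists (delta_mx 0 0); rewrite /S /= sq_dot /dot (bigD1 0) //= big1 => [|i i0].
    by rewrite !mxE !eqxx mulr1 addr0.
  by rewrite !mxE (negbTE i0) andbF mul0r.
have [v] := EVT_min_rV S0 Sc (continuous_subspaceT fc); rewrite inE => vS vmin.
exists (f v).
  rewrite /f -dotE mulmxA; apply: Apos; apply/eqP => v0.
  by move: vS; rewrite /S /= v0 sq0 => /esym/eqP; rewrite oner_eq0.
move=> x; have [->|x0] := eqVneq x 0.
  by rewrite sq0 mulr0 mulmx0 /dot big1 // => i _; rewrite mxE mul0r.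
have x_gt0 : 0 < sq x by rewrite lt_neqAle eq_sym sq_eq0 x0 sq_ge0.
have x_n0 := lt0r_neq0 x_gt0.
have := vmin ((Num.sqrt (sq x))^-1 *: x)^T; rewrite inE /S /f /= trmxK.
rewrite sqZ exprVn sqr_sqrtr ?sq_ge0 // mulVf // => /(_ erefl).
rewrite -scalemxAr dotZl dotZr mulrA -expr2 exprVn sqr_sqrtr ?sq_ge0 //.
by rewrite ler_pdivlMl // mulrC.
Qed.

End InnerProduct.

(** * The rotation group *)

Section ThreeDim.
Variable R : realType.
Implicit Types (Q M : 'M[R]_3) (a u v w : 'cV[R]_3).

Local Notation i0 := (inord 0 : 'I_3).
Local Notation i1 := (inord 1 : 'I_3).
Local Notation i2 := (inord 2 : 'I_3).

Lemma ord3P (P : 'I_3 -> Prop) : P i0 -> P i1 -> P i2 -> forall i, P i.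
Proof.
move=> P0 P1 P2 [[|[|[|m]]] im] //.
- by have -> : Ordinal im = i0 by apply: val_inj; rewrite /= inordK.
- by have -> : Ordinal im = i1 by apply: val_inj; rewrite /= inordK.
- by have -> : Ordinal im = i2 by apply: val_inj; rewrite /= inordK.
Qed.

Lemma sum3 (V : zmodType) (F : 'I_3 -> V) : \sum_i F i = F i0 + F i1 + F i2.
Proof.
rewrite !big_ord_recr big_ord0 /= add0r; congr (F _ + F _ + F _);
  by apply: val_inj; rewrite /= inordK.
Qed.

Lemma ord3E : ((i0 == i1 = false) * (i0 == i2 = false) * (i1 == i0 = false) *
  (i1 == i2 = false) * (i2 == i0 = false) * (i2 == i1 = false))%type.
Proof. by rewrite -!val_eqE /= !inordK. Qed.

Lemma skewE v : ((skew v i0 i0 = 0) * (skew v i0 i1 = - v i2 0) * (skew v i0 i2 = v i1 0) *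
  (skew v i1 i0 = v i2 0) * (skew v i1 i1 = 0) * (skew v i1 i2 = - v i0 0) *
  (skew v i2 i0 = - v i1 0) * (skew v i2 i1 = v i0 0) * (skew v i2 i2 = 0))%type.
Proof. by rewrite !mxE !inordK. Qed.

Lemma eRE Q : ((eR Q i0 0 = (2^-1 * (Q i2 i1 - Q i1 i2))%R) *
  (eR Q i1 0 = (2^-1 * (Q i0 i2 - Q i2 i0))%R) * (eR Q i2 0 = (2^-1 * (Q i1 i0 - Q i0 i1))%R))%type.
Proof. by rewrite !mxE !inordK. Qed.

Lemma mx3P m (A B : 'M[R]_(3, m)) :
  (forall j, A i0 j = B i0 j) -> (forall j, A i1 j = B i1 j) ->
  (forall j, A i2 j = B i2 j) -> A = B.
Proof. by move=> H0 H1 H2; apply/matrixP => i j; move: j; elim/ord3P: i. Qed.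

Lemma col3P u v : u i0 0 = v i0 0 -> u i1 0 = v i1 0 -> u i2 0 = v i2 0 -> u = v.
Proof. by move=> H0 H1 H2; apply: mx3P => j; rewrite (ord1 j). Qed.

Lemma det2E (M : 'M[R]_2) : \det M = M 0 0 * M 1 1 - M 0 1 * M 1 0.
Proof.
rewrite (expand_det_row _ 0) !big_ord_recl big_ord0 addr0 /cofactor !det_mx11 !mxE /=.
have -> : lift (0 : 'I_2) (0 : 'I_1) = 1 by apply: val_inj.
have -> : lift (1 : 'I_2) (0 : 'I_1) = 0 by apply: val_inj.
by rewrite expr0 expr1 mul1r mulN1r mulrN.
Qed.

Lemma det3E M : \det M =
  M i0 i0 * (M i1 i1 * M i2 i2 - M i1 i2 * M i2 i1)
  - M i0 i1 * (M i1 i0 * M i2 i2 - M i1 i2 * M i2 i0)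
  + M i0 i2 * (M i1 i0 * M i2 i1 - M i1 i1 * M i2 i0).
Proof.
have l01 : lift i0 (0 : 'I_2) = i1 by apply: val_inj; rewrite /= !inordK.
have l02 : lift i0 (1 : 'I_2) = i2 by apply: val_inj; rewrite /= !inordK.
have l10 : lift i1 (0 : 'I_2) = i0 by apply: val_inj; rewrite /= !inordK.
have l12 : lift i1 (1 : 'I_2) = i2 by apply: val_inj; rewrite /= !inordK.
have l20 : lift i2 (0 : 'I_2) = i0 by apply: val_inj; rewrite /= !inordK.
have l21 : lift i2 (1 : 'I_2) = i1 by apply: val_inj; rewrite /= !inordK.
rewrite (expand_det_row _ i0) sum3 /cofactor !det2E !mxE.
rewrite !(l01, l02, l10, l12, l20, l21) !inordK // /=; ring.
Qed.

Ltac mx3 := apply: mx3P; elim/ord3P.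
Ltac ent := do 3 rewrite ?mxE ?sum3 ?inordK //=; rewrite ?/vc; do 2 rewrite ?mxE ?sum3 ?inordK //=.

Lemma skewT v : (skew v)^T = - skew v.
Proof. by mx3; rewrite [LHS]mxE [RHS]mxE !skewE ?oppr0 ?opprK. Qed.

Lemma skewB u v : skew (u - v) = skew u - skew v.
Proof. by mx3; ent; rewrite ?mxE; ring. Qed.

Lemma skewZ k u : skew (k *: u) = k *: skew u.
Proof. by mx3; ent; rewrite ?mxE; ring. Qed.

Lemma sq_skew v : sq (skew v) = 2 * sq v.
Proof. by rewrite /sq !sum3 !big_ord1 !skewE; ring. Qed.

Lemma skew_sqr v : skew v *m skew v = v *m v^T - (sq v)%:M.
Proof.
rewrite sq_dot /dot; mx3; rewrite !mxE !sum3 !skewE !big_ord1 !mxE ?ord3E ?eqxx /=; ring.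
Qed.

Lemma dot_skew v w : dot (skew v *m w) w = 0.
Proof. rewrite /dot !sum3 !mxE !sum3 !skewE; ring. Qed.

Lemma dot_skewl v w : dot (skew v *m w) v = 0.
Proof. rewrite /dot !sum3 !mxE !sum3 !skewE; ring. Qed.

Lemma sq_skew_mul v w : sq (skew v *m w) = sq v * sq w - dot v w ^+ 2.
Proof. rewrite !sq_dot /dot !sum3 !mxE !sum3 !skewE; ring. Qed.

(** The invariance of the triple product under [M], up to its determinant. For a rotation that fixes
    [v] it says that the rotation commutes with [skew v]. *)
Lemma skew_congr M v : M^T *m skew (M *m v) *m M = \det M *: skew v.
Proof.
rewrite det3E.
by mx3; ent; ring.
Qed.

(** The first-order part of [skew_congr] at the identity, in the direction [M]. *)
Lemma skew_trace M v : M^T *m skew v + skew v *m M = skew (\tr M *: v - M *m v).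
Proof.
by rewrite /mxtrace; mx3; ent; rewrite ?mxE ?sum3; ring.
Qed.

Lemma eR_sub Q M : eR (Q - M) = eR Q - eR M.
Proof. by apply: col3P; ent; ring. Qed.

Lemma skew_eR Q : skew (eR Q) = 2^-1 *: (Q - Q^T).
Proof. by mx3; ent; field. Qed.

(** The matrix E(R_e) of e_R' = E(R_e) omega_e. *)
Definition Emx Q : 'M[R]_3 := 2^-1 *: ((\tr Q)%:M - Q^T).

Lemma eR_skew Q w : eR (Q *m skew w) = Emx Q *m w.
Proof.
by apply: col3P; rewrite /Emx /mxtrace; ent; rewrite ?ord3E ?eqxx ?mulr1n ?mulr0n /=; ring.
Qed.

End ThreeDim.

Ltac mx3 := apply: mx3P; elim/ord3P.

(** * Rodrigues form of rotations and the bounds derived from it *)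

Section SO3Facts.
Variable R : realType.
Implicit Types (Q M : 'M[R]_3) (a u v w : 'cV[R]_3).

Lemma dot_outer a u v : (a *m v^T) *m u = dot v u *: a.
Proof. by apply: col3P; rewrite !mxE !sum3 !mxE !big_ord1 !mxE /dot !sum3; ring. Qed.

Lemma sq_mxtrace m k (A : 'M[R]_(m, k)) : sq A = \tr (A^T *m A).
Proof.
rewrite /mxtrace /sq exchange_big; apply: eq_bigr => i _; rewrite mxE.
by apply: eq_bigr => j _; rewrite mxE expr2.
Qed.

(** Rodrigues' formula with the pair (cos, sin) as two free reals in place of an angle. Its entries
    are polynomials, so identities follow by [ring] modulo [sphereE] and [circleE]. *)
Definition rodr a (c s : R) : 'M[R]_3 :=
  c%:M + (1 - c) *: (a *m a^T) + s *: skew a.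

Lemma rodrE a c s i j : rodr a c s i j =
  c *+ (i == j) + (1 - c) * (a i 0 * a j 0) + s * skew a i j.
Proof. by rewrite /rodr !mxE big_ord1 !mxE. Qed.

Definition cosR Q : R := 2^-1 * (\tr Q - 1).

Lemma tr_cosR Q : \tr Q = 1 + 2 * cosR Q.
Proof. by rewrite /cosR; field. Qed.

Ltac rod := rewrite ?sum3 ?rodrE ?skewE ?ord3E ?eqxx ?mulr1n ?mulr0n /=.

Lemma mxBE m k (A B : 'M[R]_(m, k)) i j : (A - B) i j = A i j - B i j.
Proof. by rewrite mxE [X in _ + X]mxE. Qed.

Lemma sphereE a : sq a = 1 ->
  a (inord 0) 0 ^+ 2 = 1 - a (inord 1) 0 ^+ 2 - a (inord 2) 0 ^+ 2.
Proof. by rewrite sq_dot /dot !sum3 => <-; ring. Qed.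

Lemma circleE (c s : R) : c ^+ 2 + s ^+ 2 = 1 -> s ^+ 2 = 1 - c ^+ 2.
Proof. by move=> <-; ring. Qed.

Lemma eR_rodr a c s : eR (rodr a c s) = s *: a.
Proof. by apply: col3P; rewrite eRE [RHS]mxE; rod; field. Qed.

Lemma tr_rodr a c s : sq a = 1 -> \tr (rodr a c s) = 1 + 2 * c.
Proof.
by move=> /sphereE a1; rewrite /mxtrace; rod; ring: a1.
Qed.

Lemma rodr_cosR a c s : sq a = 1 -> cosR (rodr a c s) = c.
Proof. by move=> a1; rewrite /cosR tr_rodr //; field. Qed.

Lemma det_rodr a c s :
  \det (rodr a c s) = (c ^+ 2 + s ^+ 2 * sq a) * (c + (1 - c) * sq a).
Proof. by rewrite det3E sq_dot /dot; rod; ring. Qed.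

Lemma gram_rodr a c s : (rodr a c s)^T *m rodr a c s =
  (c ^+ 2 + s ^+ 2 * sq a)%:M
  + (2 * c * (1 - c) + (1 - c) ^+ 2 * sq a - s ^+ 2) *: (a *m a^T).
Proof.
rewrite sq_dot /dot sum3; mx3; rewrite mxE sum3 ![(rodr _ _ _)^T _ _]mxE;
  rewrite ![in RHS]mxE big_ord1 ![in RHS]mxE; rod; ring.
Qed.

Lemma SO3_rodr a c s : sq a = 1 -> c ^+ 2 + s ^+ 2 = 1 -> SO3 (rodr a c s).
Proof.
move=> a1 cs; split; last by rewrite det_rodr a1 !mulr1 cs; ring.
rewrite gram_rodr a1 !mulr1 cs.
have -> : 2 * c * (1 - c) + (1 - c) ^+ 2 - s ^+ 2 = 0 by ring: (circleE cs).
by rewrite scale0r addr0.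
Qed.

Lemma SO3_trmx Q : SO3 Q -> Q *m Q^T = 1.
Proof. by case=> QQ _; exact: mulmx1C. Qed.

(** Euler's theorem: Q - 1 = Q (1 - Q^T), and in odd dimension this forces det (Q - 1) to equal its
    opposite. *)
Lemma SO3_axis Q : SO3 Q -> exists a, [/\ sq a = 1, Q *m a = a & Q^T *m a = a].
Proof.
move=> SQ; have [QQ dQ] := SQ; have QQ' := SO3_trmx SQ.
have : \det (Q - 1) == 0.
  have e : \det (Q - 1) = - \det (Q - 1).
    rewrite -{1}QQ' -{1}[Q]mulmx1 -mulmxBr det_mulmx dQ mul1r.
    have -> : 1 - Q^T = (-1) *: (Q - 1)^T.
      by rewrite scaleN1r linearB /= trmx1 opprB.
    by rewrite detZ det_tr; ring.
  by apply/eqP; move: e; lra.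
case/det0P => v v0 /eqP; rewrite mulmxBr mulmx1 subr_eq0 => /eqP vQ.
have Qv : Q^T *m v^T = v^T by rewrite -trmx_mul vQ.
have Qv' : Q *m v^T = v^T by rewrite -{1}Qv mulmxA QQ' mul1mx.
have n0 : 0 < sq v by rewrite lt_neqAle eq_sym sq_eq0 v0 sq_ge0.
exists ((Num.sqrt (sq v))^-1 *: v^T); split.
- by rewrite sqZ sqT exprVn sqr_sqrtr ?sq_ge0 // mulVf // gt_eqF.
- by rewrite -scalemxAr Qv'.
- by rewrite -scalemxAr Qv.
Qed.

Lemma sq_rodr a c s : sq a = 1 -> sq (rodr a c s) = 1 + 2 * (c ^+ 2 + s ^+ 2).
Proof. by move=> /sphereE a1; rewrite /sq sum3; rod; ring: a1. Qed.

(** The symmetric and the antisymmetric part are found separately. The first comes from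
    [skew_trace], because [Q] commutes with [skew a]; the second is the skew matrix of [eR Q], which
    is parallel to the axis. The squared Frobenius norm 3 of [Q] then puts (c, s) on the unit
    circle. *)
Lemma rodrigues Q : SO3 Q ->
  exists a c s, [/\ sq a = 1, c ^+ 2 + s ^+ 2 = 1 & Q = rodr a c s].
Proof.
move=> SQ; have [QQ dQ] := SQ; have QQ' := SO3_trmx SQ.
have [a [a1 Qa Qta]] := SO3_axis SQ.
have comm : skew a *m Q = Q *m skew a.
  have := skew_congr Q a; rewrite dQ Qa scale1r => H.
  by rewrite -[in RHS]H !mulmxA QQ' mul1mx.
have sym : (Q + Q^T) *m skew a = (2 * cosR Q) *: skew a.
  rewrite mulmxDl -comm addrC skew_trace Qa tr_cosR -[X in _ - X]scale1r -scalerBl.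
  by rewrite skewZ addrAC subrr add0r.
(* The square of [skew a] is a a^T - 1 and [Q] fixes [a], so multiplying [sym] by [skew a] once more
   solves it for Q + Q^T. *)
have Y : Q + Q^T = 2 *: (cosR Q *: 1 + (1 - cosR Q) *: (a *m a^T)).
  have /(congr1 (mulmx^~ (skew a))) := sym.
  rewrite -mulmxA -scalemxAl skew_sqr a1 mulmxBr mulmx1 !mulmxDl !mulmxA Qa Qta.
  move=> /matrixP H; apply/matrixP => i j.
  by move: (H i j); rewrite !mxE !big_ord1 !mxE; case: (i == j) => /=; lra.
have e0 : skew (eR Q) *m a = 0.
  by rewrite skew_eR -scalemxAl mulmxBl Qa Qta subrr scaler0.
have ea : eR Q = dot (eR Q) a *: a.
  move: (eR Q) e0 => e e0; apply/eqP; rewrite -subr_eq0 -sq_eq0 sq_dot.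
  rewrite dotBl !dotBr !dotZl !dotZr -!sq_dot a1.
  have := sq_skew_mul e a; rewrite e0 sq0 a1 => H; apply/eqP.
  by move: H; rewrite (dotC a); lra.
have QE : Q = rodr a (cosR Q) (dot (eR Q) a).
  rewrite /rodr -skewZ -ea skew_eR.
  have -> : (cosR Q)%:M = cosR Q *: 1 :> 'M[R]_3 by rewrite scalemx1.
  have -> : cosR Q *: 1 + (1 - cosR Q) *: (a *m a^T) = 2^-1 *: (Q + Q^T).
    by rewrite Y scalerA mulVf ?scale1r.
  by apply/matrixP => i j; rewrite !mxE; field.
exists a, (cosR Q), (dot (eR Q) a); split=> //.
have : sq Q = 3 by rewrite sq_mxtrace QQ mxtrace1.
by rewrite {1}QE sq_rodr // => ?; lra.
Qed.

Lemma expso3_rodr t a : sq a = 1 -> expso3 t a = rodr a (cos t) (sin t).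
Proof.
move=> a1; rewrite /expso3 skew_sqr a1 /rodr.
by apply/matrixP => i j; rewrite !mxE !big_ord1 !mxE; case: (i == j) => /=; ring.
Qed.

Lemma sq_eR Q : SO3 Q -> sq (eR Q) = 1 - cosR Q ^+ 2.
Proof.
by case/rodrigues=> a [c [s [a1 cs ->]]]; rewrite eR_rodr sqZ a1 rodr_cosR //; lra.
Qed.

Lemma cosR_itv Q : SO3 Q -> -1 <= cosR Q <= 1.
Proof. by move=> /sq_eR; have := sq_ge0 (eR Q) => ? ?; nra. Qed.

Lemma sq_sub1 Q : SO3 Q -> sq (Q - 1) = 4 * (1 - cosR Q).
Proof.
case/rodrigues=> a [c [s [a1 cs ->]]]; rewrite rodr_cosR //.
have -> : rodr a c s - 1 = rodr a c s - rodr a 1 0.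
  by rewrite /rodr subrr !scale0r !addr0.
rewrite /sq sum3 !sum3 !mxBE; rod.
by ring: (sphereE a1) (circleE cs).
Qed.

Lemma sq_sub_rodr a c s : sq a = 1 -> c ^+ 2 + s ^+ 2 = 1 ->
  sq (rodr a c s - rodr a (-1) 0) = 4 * (1 + c).
Proof.
move=> a1 cs; rewrite /sq sum3 !sum3 !mxBE; rod.
by ring: (sphereE a1) (circleE cs).
Qed.

Lemma trmx_Emx Q : (Emx Q)^T = 2^-1 *: ((\tr Q)%:M - Q).
Proof. by apply/matrixP => i j; rewrite !mxE eq_sym. Qed.

(** Hence e_R . e_R' = c (e_R . omega_e): the factor is close to 1 near the identity and close to -1
    near the pi-rotations. *)
Lemma Emx_eR Q : SO3 Q -> (Emx Q)^T *m eR Q = cosR Q *: eR Q.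
Proof.
case/rodrigues=> a [c [s [a1 cs ->]]]; rewrite eR_rodr rodr_cosR //.
rewrite trmx_Emx tr_rodr //.
rewrite -scalemxAl mulmxBl mul_scalar_mx /rodr !mulmxDl mul_scalar_mx.
rewrite -!scalemxAl -!scalemxAr dot_outer -sq_dot a1 scale1r.
have -> : skew a *m a = 0.
  by apply/eqP; rewrite -sq_eq0 sq_skew_mul -sq_dot a1; apply/eqP; ring.
by rewrite !scaler0; apply/matrixP => i j; rewrite !mxE; field.
Qed.

Lemma sq_Emx Q w : SO3 Q -> sq (Emx Q *m w) <= sq w.
Proof.
case/rodrigues=> a [c [s [a1 cs ->]]].
have -> : Emx (rodr a c s) *m w =
    2^-1 *: ((1 + c) *: w - ((1 - c) * dot a w) *: a + s *: (skew a *m w)).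
  rewrite /Emx tr_rodr // -scalemxAl mulmxBl mul_scalar_mx; congr (_ *: _).
  rewrite /rodr !linearD /= !linearZ /= trmx_mul trmxK tr_scalar_mx skewT.
  rewrite !mulmxDl mul_scalar_mx -!scalemxAl dot_outer mulNmx.
  by apply/matrixP => i j; rewrite !mxE; ring.
have H := dot_sqr_le a w; rewrite a1 mul1r in H.
have := sq_skew_mul a w; rewrite a1 mul1r => S.
have S1 := dot_skew a w; have S2 := dot_skewl a w.
rewrite sqZ sq_dot !(dotDl, dotNl) !(dotDr, dotNr) !(dotZl, dotZr) -!sq_dot a1.
rewrite S S2 S1 !(dotC _ (skew _ *m _)) S2 S1 (dotC w a).
set p := dot a w in H S *; set W := sq w in H S *.
have c1 : -1 <= c <= 1 by nra.
(* This is twice the difference of the two sides. It is nonnegative because [p ^+ 2 <= W] and 1 + 2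
   c >= -1. *)
have K : 0 <= (1 - c) * (W + (1 + 2 * c) * p ^+ 2).
  by apply: mulr_ge0; [lra|nra].
rewrite -subr_ge0 [X in 0 <= X](_ : _ = 2^-1 * ((1 - c) * (W + (1 + 2 * c) * p ^+ 2))).
  by rewrite mulr_ge0.
by field: (circleE cs).
Qed.

End SO3Facts.

(** * Differential inequalities *)

Section Calculus.
Variable R : realType.

Definition mder m k (f : R -> 'M[R]_(m, k)) (t : R) (df : 'M[R]_(m, k)) : Prop :=
  forall i j, is_derive t (1 : R) (fun s => f s i j) (df i j).

Lemma is_derive_ext (f g : R -> R) (t df dg : R) :
  f =1 g -> df = dg -> is_derive t (1 : R) f df -> is_derive t (1 : R) g dg.
Proof. by move=> /funext <- <-. Qed.

Lemma derD (f g : R -> R) (t df dg : R) : is_derive t (1 : R) f df ->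
  is_derive t (1 : R) g dg -> is_derive t (1 : R) (fun s => f s + g s) (df + dg).
Proof. by move=> ? ?; exact: is_deriveD. Qed.

Lemma derB (f g : R -> R) (t df dg : R) : is_derive t (1 : R) f df ->
  is_derive t (1 : R) g dg -> is_derive t (1 : R) (fun s => f s - g s) (df - dg).
Proof. by move=> ? ?; exact: is_deriveB. Qed.

Lemma derM (f g : R -> R) (t df dg : R) : is_derive t (1 : R) f df ->
  is_derive t (1 : R) g dg ->
  is_derive t (1 : R) (fun s => f s * g s) (df * g t + f t * dg).
Proof.
move=> fd gd; apply: (is_derive_ext _ _ (is_deriveM fd gd)) => //.
by rewrite addrC /GRing.scale /= (mulrC df).
Qed.

Lemma derZ (f : R -> R) (t k df : R) : is_derive t (1 : R) f df ->
  is_derive t (1 : R) (fun s => k * f s) (k * df).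
Proof. by move=> ?; exact: is_deriveZ. Qed.

Lemma der_sum n (f : 'I_n -> R -> R) (t : R) (df : 'I_n -> R) :
  (forall i, is_derive t (1 : R) (f i) (df i)) ->
  is_derive t (1 : R) (fun s => \sum_i f i s) (\sum_i df i).
Proof.
move=> fd; apply: (is_derive_ext _ _ (is_derive_sum fd)) => // s.
by rewrite fct_sumE.
Qed.

Lemma der_continuous (f : R -> R) (t df : R) : is_derive t (1 : R) f df ->
  {for t, continuous f}.
Proof. by move=> fd; apply/differentiable_continuous/derivable1_diffP. Qed.

Lemma mderM m k l (A : R -> 'M[R]_(m, k)) (B : R -> 'M[R]_(k, l)) t dA dB :
  mder A t dA -> mder B t dB ->
  mder (fun s => A s *m B s) t (dA *m B t + A t *m dB).
Proof.
move=> Ad Bd i j.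
apply: (is_derive_ext _ _ (der_sum (fun p => derM (Ad i p) (Bd p j)))) => [s|].
  by rewrite mxE.
by rewrite !mxE big_split.
Qed.

Lemma mder_cst m k (A : 'M[R]_(m, k)) t : mder (fun=> A) t 0.
Proof. by move=> i j; rewrite mxE; exact: is_derive_cst. Qed.

Lemma mderMl m k l (A : 'M[R]_(m, k)) (B : R -> 'M[R]_(k, l)) t dB :
  mder B t dB -> mder (fun s => A *m B s) t (A *m dB).
Proof.
move=> Bd; have := mderM (mder_cst A t) Bd.
by rewrite mul0mx add0r.
Qed.

Lemma mderB m k (A B : R -> 'M[R]_(m, k)) t dA dB :
  mder A t dA -> mder B t dB -> mder (fun s => A s - B s) t (dA - dB).
Proof.
move=> Ad Bd i j.
by apply: (is_derive_ext _ _ (derB (Ad i j) (Bd i j))) => [s|]; rewrite mxBE.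
Qed.

Lemma mderT m k (A : R -> 'M[R]_(m, k)) t dA :
  mder A t dA -> mder (fun s => (A s)^T) t dA^T.
Proof.
by move=> Ad i j; apply: (is_derive_ext _ _ (Ad j i)) => [s|]; rewrite mxE.
Qed.

Lemma der_dot m (u v : R -> 'cV[R]_m) t du dv : mder u t du -> mder v t dv ->
  is_derive t (1 : R) (fun s => dot (u s) (v s)) (dot du (v t) + dot (u t) dv).
Proof.
move=> ud vd; rewrite /dot -big_split /=.
by apply: der_sum => i; apply: derM.
Qed.

Lemma der_sq m k (A : R -> 'M[R]_(m, k)) t dA : mder A t dA ->
  is_derive t (1 : R) (fun s => sq (A s)) (2 * \tr ((A t)^T *m dA)).
Proof.
move=> Ad; have H := der_sum (fun i => der_sum (fun j => derM (Ad i j) (Ad i j))).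
apply: (is_derive_ext _ _ H) => [s|] /=.
  by apply: eq_bigr => i _; apply: eq_bigr => j _; rewrite expr2.
rewrite /mxtrace exchange_big mulr_sumr; apply: eq_bigr => j _.
rewrite mxE mulr_sumr; apply: eq_bigr => i _; rewrite !mxE; ring.
Qed.

Lemma der_tr m (A : R -> 'M[R]_m) t dA : mder A t dA ->
  is_derive t (1 : R) (fun s => \tr (A s)) (\tr dA).
Proof. by move=> Ad; apply: der_sum => i. Qed.

Lemma der_mvt (g dg : R -> R) (a b : R) : a <= b ->
  (forall t, a <= t <= b -> is_derive t (1 : R) g (dg t)) ->
  exists2 c, a <= c <= b & g b - g a = dg c * (b - a).
Proof.
move=> ab gd; have [||c] := @MVT_segment R g dg a b ab.
- by move=> t; rewrite in_itv /= => /andP[? ?]; apply: gd; rewrite !ltW.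
- apply: continuous_in_subspaceT => t; rewrite inE /= in_itv /= => tab.
  exact: der_continuous (gd t tab).
- by rewrite in_itv /= => cab e; exists c.
Qed.

Lemma der_le0 (g dg : R -> R) (a b : R) : a <= b ->
  (forall t, a <= t <= b -> is_derive t (1 : R) g (dg t)) ->
  (forall t, a <= t <= b -> dg t <= 0) -> g b <= g a.
Proof.
move=> ab gd dg0; have [c /dg0 c0 e] := der_mvt ab gd.
by rewrite -subr_le0 e mulr_le0_ge0 // subr_ge0.
Qed.

Lemma der_eq0 (g dg : R -> R) (a b : R) : a <= b ->
  (forall t, a <= t <= b -> is_derive t (1 : R) g (dg t)) ->
  (forall t, a <= t <= b -> dg t = 0) -> g b = g a.
Proof.
move=> ab gd dg0; have [c /dg0 c0 e] := der_mvt ab gd.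
by apply/eqP; rewrite -subr_eq0 e c0 mul0r.
Qed.

Lemma der_expR (k t : R) :
  is_derive t (1 : R) (fun s => expR (k * s)) (k * expR (k * t)).
Proof.
have H : is_derive t (1 : R) (fun s : R => k * s) (k * 1) by apply: derZ.
apply: (is_derive_ext _ _ (@is_derive1_comp R expR _ t _ _ _ H)) => //.
by rewrite mulr1 mulrC.
Qed.

Lemma gronwall (g dg : R -> R) (k a b : R) : a <= b ->
  (forall t, a <= t <= b -> is_derive t (1 : R) g (dg t)) ->
  (forall t, a <= t <= b -> dg t <= k * g t) ->
  g b <= g a * expR (k * (b - a)).
Proof.
move=> ab gd dgk.
have := @der_le0 (fun s => expR (- k * s) * g s)
  (fun t => - k * expR (- k * t) * g t + expR (- k * t) * dg t) a b ab.
move=> /(_ _ _)/wrap[].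
- by move=> t /gd; apply: derM; exact: der_expR.
- move=> t /dgk H; have := expR_gt0 (- k * t); nra.
move=> H.
rewrite -(ler_pM2l (expR_gt0 (- k * b))).
apply: le_trans H _; rewrite [leRHS]mulrCA -expRD mulrC.
by rewrite (_ : - k * b + k * (b - a) = - k * a) //; ring.
Qed.

Lemma gronwall_lower (g dg : R -> R) (k a b : R) : a <= b ->
  (forall t, a <= t <= b -> is_derive t (1 : R) g (dg t)) ->
  (forall t, a <= t <= b -> - k * g t <= dg t) ->
  g a <= g b * expR (k * (b - a)).
Proof.
move=> ab gd dgk.
have := @gronwall (fun s => 0 - g s) (fun t => 0 - dg t) (- k) a b ab.
move=> /(_ _ _)/wrap[].
- by move=> t /gd; apply: derB; exact: is_derive_cst.
- by move=> t /dgk; lra.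
rewrite !sub0r mulNr lerN2 mulNr expRN -ler_pdivlMr ?invr_gt0 ?expR_gt0 //.
by rewrite invrK.
Qed.

End Calculus.

(** * The Lyapunov rate *)

Section Forms.
Variable R : realType.

Lemma dot_tr m k (A : 'M[R]_(m, k)) u v : dot u (A^T *m v) = dot v (A *m u).
Proof. by rewrite -dot_mull dotC. Qed.

Definition stack n (e w : 'cV[R]_3) (x : 'cV[R]_n) : 'cV[R]_(3 + (3 + n)) :=
  col_mx e (col_mx w x).

Lemma sq_stack n e w (x : 'cV[R]_n) : sq (stack e w x) = sq e + sq w + sq x.
Proof. by rewrite !sq_col_mx addrA. Qed.

Lemma stackB n e w (x : 'cV[R]_n) e' w' x' :
  stack e w x - stack e' w' x' = stack (e - e') (w - w') (x - x').
Proof. by rewrite /stack !opp_col_mx !add_col_mx. Qed.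

Lemma dot_stack n e w (x : 'cV[R]_n) e' w' x' :
  dot (stack e w x) (stack e' w' x') = dot e e' + dot w w' + dot x x'.
Proof. by rewrite !dot_col_mx addrA. Qed.

Lemma block3_stack n (A11 A12 A21 A22 : 'M[R]_3) (A13 A23 : 'M[R]_(3, n))
  (A31 A32 : 'M[R]_(n, 3)) (A33 : 'M[R]_n) e w (x : 'cV[R]_n) :
  block_mx A11 (row_mx A12 A13) (col_mx A21 A31) (block_mx A22 A23 A32 A33) *m stack e w x =
  stack (A11 *m e + A12 *m w + A13 *m x) (A21 *m e + A22 *m w + A23 *m x)
        (A31 *m e + A32 *m w + A33 *m x).
Proof.
by rewrite mul_block_col mul_row_col mul_col_mx mul_block_col add_col_mx !addrA.
Qed.

Variables (n : nat) (J : 'M[R]_3) (AK : 'M[R]_n) (Bth Bom : 'M[R]_(n, 3))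
  (CK : 'M[R]_(3, n)) (Dth Dom : 'M[R]_3)
  (p11 : R) (P21 P22 : 'M[R]_3) (P31 P32 : 'M[R]_(n, 3)) (P33 : 'M[R]_n).
Implicit Types (e w : 'cV[R]_3) (x : 'cV[R]_n).

Local Notation P := (Pmat J p11 P21 P22 P31 P32 P33).
Local Notation M1 := (M1mat J AK Bth Bom CK Dth Dom p11 P21 P22 P31 P32 P33).

(** The left side is V' once e . de = c (e . w) is substituted. Its p11 terms cancel the product e .
    de coming from [P] and leave p11 e . w, which belongs to M21. The other terms in [de] pair it
    with P21^T J w and P31^T x; Young's inequality with weights tau2 and tau1, and |de| <= |w|, turn
    them into the corrections of M22 and M33. Keeping [de] free makes the lemma applicable to
    differences of trajectories. *)
Lemma lyap_rate_le tau1 tau2 e w x de dw :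
  J^T = J -> P22^T = P22 -> P33^T = P33 -> 0 < tau1 -> 0 < tau2 -> sq de <= sq w ->
  J *m dw = CK *m x + Dth *m e + Dom *m w ->
  2 * dot (stack e w x) (P *m stack de dw (AK *m x + Bth *m e + Bom *m w))
    - 2 * p11 * dot e de + 2 * p11 * dot e w
  <= dot (stack e w x) (M1 tau1 tau2 *m stack e w x).
Proof.
move=> Js P22s P33s t1 t2 dew dwE.
have y1 := dot_young (P31^T *m x) de (_ : 0 < tau1^-1).
have y2 := dot_young (P21^T *m (J *m w)) de (_ : 0 < tau2^-1).
rewrite !invr_gt0 !invrK in y1 y2; have {}y1 := y1 t1; have {}y2 := y2 t2.
have sT1 : tau1 * sq de <= tau1 * sq w by rewrite ler_pM2l.
have sT2 : tau2 * sq de <= tau2 * sq w by rewrite ler_pM2l.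
rewrite /Pmat /M1mat !block3_stack !dot_stack.
rewrite mul_scalar_mx -!(mulmxA _ J dw) dwE.
set M21 := p11%:M + _ + _ + _ + _.
set M31 := P32 *m Dth + _ + _ + _.
set M32 := P32 *m Dom + _ + _ + _.
rewrite !mulmxDl !mulmxDr !dotDr.
rewrite !(dot_tr M21) !(dot_tr M31) !(dot_tr M32) /M21 /M31 /M32 !mulmxDl !dotDr !mul_scalar_mx.
rewrite -!scalemxAl !dotZr -!mulmxA -!sq_dot.
(* Every term is brought to the form [dot (Lyapunov coefficients) (controller matrices)]. *)
have mvl k m (A : 'M[R]_(m, k)) u v : dot u (A *m v) = dot (A^T *m u) v by exact: dot_mulr.
have mvr k m (A : 'M[R]_(m, k)) u v : dot u (A^T *m v) = dot v (A *m u) by exact: dot_tr.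
rewrite !(mvr _ _ Dth) !(mvr _ _ Dom) !(mvr _ _ Bth) !(mvr _ _ Bom) !(mvr _ _ AK) !(mvr _ _ CK).
rewrite !(mvl _ _ J w) Js.
have -> : dot x (P31 *m (P31^T *m x)) = sq (P31^T *m x) by rewrite mvl sq_dot.
have -> : dot (J *m w) (P21 *m (P21^T *m (J *m w))) = sq (P21^T *m (J *m w)).
  by rewrite mvl sq_dot.
rewrite !(mvl _ _ P31 x) !(mvl _ _ P32 x) !(mvl _ _ P33 x) !(mvl _ _ P22 w) P22s P33s.
rewrite !(mvl _ _ P21^T e) !(mvl _ _ P31^T e) !(mvl _ _ P32^T (J *m w)) !trmxK.
rewrite !(mvl _ _ P21 (J *m w)) (dotC w e).
lra.
Qed.

End Forms.

(** * Attitude kinematics and invariance of SO(3) *)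

Section Kinematics.
Variable R : realType.
Implicit Types (Q : 'M[R]_3) (v w : 'cV[R]_3).

Lemma der_eR (Re : R -> 'M[R]_3) t dR :
  mder Re t dR -> mder (fun s => eR (Re s)) t (eR dR).
Proof.
move=> Rd i j; rewrite (ord1 j); move: i.
apply: ord3P; apply: (is_derive_ext _ _ (derZ 2^-1 (derB (Rd _ _) (Rd _ _)))) => [s|];
  rewrite eRE; reflexivity.
Qed.

Lemma tr_mul_skew Q w : \tr (Q *m skew w) = - 2 * dot (eR Q) w.
Proof.
by rewrite /mxtrace /dot !sum3 !eRE !mxE !sum3 !skewE; field.
Qed.

Lemma der_cosR (Re : R -> 'M[R]_3) t w : mder Re t (Re t *m skew w) ->
  is_derive t (1 : R) (fun s => cosR (Re s)) (- dot (eR (Re t)) w).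
Proof.
move=> Rd; have c1 : is_derive t (1 : R) (fun=> 1 : R) 0 by exact: is_derive_cst.
apply: (is_derive_ext _ _ (derZ 2^-1 (derB (der_tr Rd) c1))) => //.
by rewrite tr_mul_skew; field.
Qed.

(** With G = R^T R - 1 and S = [skew w], G' is the commutator G S - S G, and tr (G G') = 0, so |G|^2
    is constant. The determinant is constant since its derivative is det R times tr S = 0. *)
Lemma SO3_preserved (Re : R -> 'M[R]_3) (w : R -> 'cV[R]_3) (T : R) : 0 <= T ->
  (forall t, 0 <= t <= T -> mder Re t (Re t *m skew (w t))) ->
  SO3 (Re 0) -> SO3 (Re T).
Proof.
move=> T0 Rd [R0 d0]; split.
  have E : sq ((Re T)^T *m Re T - 1) = sq ((Re 0)^T *m Re 0 - 1).
    apply: (der_eq0 T0 (fun t tT => der_sq (mderB (mderM (mderT (Rd t tT)) (Rd t tT))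
      (mder_cst 1 t)))) => t tT.
    set S := skew (w t); set A := Re t.
    rewrite trmx_mul skewT -/S subr0.
    have Gs : (A^T *m A - 1)^T = A^T *m A - 1 by rewrite linearB /= trmx_mul trmxK trmx1.
    rewrite Gs; set G := A^T *m A - 1.
    have -> : - S *m A^T *m A + A^T *m (A *m S) = G *m S - S *m G.
      rewrite /G mulmxBl mulmxBr mul1mx mulmx1 !mulmxA !mulNmx.
      by rewrite opprB addrA subrK addrC.
    by rewrite mulmxBr linearB /= !mulmxA (mxtrace_mulC (G *m S)) !mulmxA subrr mulr0.
  apply/eqP; rewrite -subr_eq0 -sq_eq0 E R0 subrr sq0; exact: eqxx.
have <- : \det (Re 0) = 1 by [].
pose m := fun (i j : nat) (t : R) => Re t (inord i) (inord j).
pose dm := fun (i j : nat) (t : R) => (Re t *m skew (w t)) (inord i) (inord j).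
have D i j t : 0 <= t <= T -> is_derive t (1 : R) (m i j) (dm i j t).
  by move=> tT; exact: (Rd t tT).
have := der_eq0 T0 (fun t tT =>
  derD (derB (derM (D 0 0 t tT) (derB (derM (D 1 1 t tT) (D 2 2 t tT))
                                          (derM (D 1 2 t tT) (D 2 1 t tT))))
             (derM (D 0 1 t tT) (derB (derM (D 1 0 t tT) (D 2 2 t tT))
                                          (derM (D 1 2 t tT) (D 2 0 t tT)))))
       (derM (D 0 2 t tT) (derB (derM (D 1 0 t tT) (D 2 1 t tT))
                                          (derM (D 1 1 t tT) (D 2 0 t tT)))))%N.
rewrite !det3E; apply => t tT.
rewrite /m /dm !mxE !sum3 !skewE; ring.
Qed.

End Kinematics.

(** * Vanishing of the dissipation *)

Section Barbalat.
Variable R : realType.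

Lemma posdef_unitmx m (A : 'M[R]_m) : posdef A -> A \in unitmx.
Proof.
move=> [As Ap]; rewrite unitmxE unitfE; apply/negP => /det0P[v v0 vA].
have := Ap v^T; rewrite trmxK vA mul0mx mxE ltxx => /(_ _)/wrap[] //.
by apply: contra v0 => /eqP/(congr1 trmx); rewrite trmxK trmx0 => ->.
Qed.

Lemma dot_mul_le m (A : 'M[R]_m) u : dot u (A *m u) <= (1 + sq A) * sq u.
Proof.
have H := dot_young u (A *m u) (@ltr01 R).
have := sq_mulmx A u; have := sq_ge0 u; have := sq_ge0 A; have := sq_ge0 (A *m u).
move: H; rewrite invr1 !mul1r; nra.
Qed.

Definition vanishes (f : R -> R) : Prop :=
  forall eps : R, 0 < eps -> exists2 T : R, 0 <= T & forall t : R, T <= t -> f t < eps.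

(** As [g] grows at most at rate [K], a value at least eps at time t forces g >= eps / 2 on the
    preceding interval of length d = eps / (2 K), and [V] loses at least k (eps / 2) d there.
    Looking backwards, an upper bound on [dg] suffices. Infinitely many such losses contradict V >=
    0. *)
Lemma barbalat (V g dV dg : R -> R) (k K : R) : 0 < k -> 0 < K ->
  (forall t : R, 0 <= t -> is_derive t (1 : R) V (dV t)) ->
  (forall t : R, 0 <= t -> is_derive t (1 : R) g (dg t)) ->
  (forall t : R, 0 <= t -> dV t <= - k * g t) -> (forall t : R, 0 <= t -> dg t <= K) ->
  (forall t, 0 <= V t) -> (forall t, 0 <= g t) -> vanishes g.
Proof.
move=> k0 K0 Vd gd Vk gK V0 g0 eps e0; apply: contrapT => H.
have Vmon a b : 0 <= a -> a <= b -> V b <= V a.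
  move=> a0 ab; apply: (der_le0 ab) => t /andP[at_ _]; first exact: Vd (le_trans a0 at_).
  by apply: le_trans (Vk t (le_trans a0 at_)) _; rewrite mulNr oppr_le0 mulr_ge0 // ltW.
have far T : 0 <= T -> exists2 t, T <= t & eps <= g t.
  move=> T0; apply: contrapT => HT; apply: H; exists T => // t Tt.
  by rewrite ltNge; apply/negP => et; apply: HT; exists t.
pose d := eps / (2 * K); have d0 : 0 < d by rewrite divr_gt0 ?mulr_gt0.
have drop t : d <= t -> eps <= g t -> V t <= V (t - d) - k * (eps / 2) * d.
  move=> dt et; have td0 : 0 <= t - d by rewrite subr_ge0.
  have tdt : t - d <= t by rewrite gerBl ltW.
  have gs s : t - d <= s <= t -> eps / 2 <= g s.
    case/andP=> ds st; have [c /andP[sc _] E] := der_mvt st (fun r rs =>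
      gd r (le_trans (le_trans td0 ds) (proj1 (andP rs)))).
    have c0 : 0 <= c by apply: le_trans sc; apply: le_trans ds.
    have : dg c * (t - s) <= K * d.
      apply: le_trans (_ : K * (t - s) <= _).
        by rewrite ler_wpM2r ?gK // subr_ge0.
      by rewrite ler_wpM2l ?(ltW K0) //; lra.
    have -> : K * d = eps / 2 by rewrite /d; field; lra.
    move: E et; lra.
  have [c ctd E] := der_mvt tdt (fun r rs => Vd r (le_trans td0 (proj1 (andP rs)))).
  have := Vk c (le_trans td0 (proj1 (andP ctd))); have := gs c ctd.
  rewrite (_ : t - (t - d) = d) in E; last by ring.
  move=> h1 h2; have : dV c * d <= - (k * (eps / 2)) * d.
    by rewrite ler_wpM2r ?(ltW d0) //; apply: le_trans h2 _; rewrite !mulNr lerN2 ler_pM2l.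
  by move: E; lra.
have step (m : nat) : exists2 t, 0 <= t & V t <= V 0 - m%:R * (k * (eps / 2) * d).
  elim: m => [|m [t t0 Vt]]; first by exists 0 => //; rewrite mul0r subr0.
  have [s ts es] := far (t + d) (addr_ge0 t0 (ltW d0)).
  exists s; first by apply: le_trans ts; rewrite addr_ge0 // ltW.
  apply: le_trans (drop s _ es) _; first by lra.
  have : V (s - d) <= V t by apply: Vmon => //; lra.
  by rewrite -[m.+1%:R]natr1; lra.
have eta0 : 0 < k * (eps / 2) * d by apply: mulr_gt0 => //; apply: mulr_gt0 => //; lra.
have [m Hm] : exists m : nat, V 0 < m%:R * (k * (eps / 2) * d).
  exists (Num.truncn (V 0 / (k * (eps / 2) * d))).+1.
  by rewrite -ltr_pdivrMr // truncnS_gt.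
have [t t0 Vt] := step m; have := V0 t; lra.
Qed.

End Barbalat.

(** * Global existence *)

Section Picard.
Variable R : realType.

(** Integrating from -1 makes 0 an interior point, so that the derivative at 0 is two-sided, as
    [is_solution] demands. *)
Definition prim (g : R -> R) (t : R) : R :=
  (\int[lebesgue_measure]_(s in `[(-1 : R), t]) g s
   - \int[lebesgue_measure]_(s in `[(-1 : R), 0]) g s)%R.

Lemma prim0 g : prim g 0 = 0.
Proof. by rewrite /prim subrr. Qed.

Lemma der_prim (g : R -> R) (t : R) : continuous g -> -1 < t ->
  is_derive t (1 : R) (prim g) (g t).
Proof.
move=> gc t1.
have tt : t < t + 1 by rewrite ltrDl.
have [|dF F1] := @continuous_FTC1_closed R g (-1) t (t + 1) tt _ t1 (gc t).
  apply: continuous_compact_integrable; first exact: segment_compact.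
  by apply: continuous_subspaceT.
have c0 : is_derive t (1 : R) (fun=> (\int[lebesgue_measure]_(s in `[(-1 : R), 0]) g s)%R) 0.
  exact: is_derive_cst.
have FD := derivableP dF; rewrite -derive1E F1 in FD.
by apply: (is_derive_ext _ _ (derB FD c0)) => //; rewrite subr0.
Qed.

Lemma nested_limit (a b : nat -> R) : (forall i j, (i <= j)%N -> a i <= a j) ->
  (forall i j, (i <= j)%N -> b j <= b i) -> (forall i, a i <= b i) ->
  exists l, forall i, a i <= l <= b i.
Proof.
move=> am bm ab; have lt_ab i j : a i <= b j.
  have [ij|/ltnW ji] := leqP i j; first exact: le_trans (am _ _ ij) (ab j).
  exact: le_trans (ab i) (bm _ _ ji).
exists (sup (range a)) => i; apply/andP; split.
  by apply: ub_le_sup; [exists (b 0%N) => _ [j _ <-]|exists i].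
by apply: ge_sup; [exists (a 0%N), 0%N|move=> _ [j _ <-]].
Qed.

Lemma le_half_pow (x z c : R) : (forall m, x <= z + c * 2^-1 ^+ m) -> x <= z.
Proof.
move=> H; rewrite leNgt; apply/negP => zx.
have d0 : 0 < x - z by rewrite subr_gt0.
have c0 : 0 < c by have := H 0%N; rewrite expr0 mulr1; lra.
pose m := (Num.truncn (c / (x - z))).+1.
have cm : c < m%:R * (x - z) by rewrite -ltr_pdivrMr // truncnS_gt.
have m2 : m%:R <= 2 ^+ m :> R by rewrite -natrX ler_nat ltnW // ltn_expl.
have p0 : 0 < 2 ^+ m :> R by rewrite exprn_gt0.
have : (x - z) * 2 ^+ m <= c.
  by rewrite -ler_pdivlMr //; have := H m; rewrite exprVn; lra.
have : m%:R * (x - z) <= 2 ^+ m * (x - z) by rewrite ler_wpM2r // ltW.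
lra.
Qed.

Implicit Types (s t : R).
Variables (I : finType) (f : (I -> R) -> I -> R) (M K : R) (y0 : I -> R).
Hypotheses (M_ge0 : 0 <= M) (K_ge0 : 0 <= K) (f_bound : forall u i, `|f u i| <= M)
  (f_lip : forall u v i, `|f u i - f v i| <= K * \sum_j `|u j - v j|).

(** The Picard operator. [Num.max 0 s] freezes the integrand at its value at 0 for negative times,
    where [y] is not controlled. *)
Let T (y : R -> I -> R) (t : R) (i : I) : R :=
  y0 i + prim (fun s => f (y (Num.max 0 s)) i) t.

Let lip (y : R -> I -> R) : Prop := forall (s t : R) (i : I), 0 <= s -> s <= t ->
  `|y t i - y s i| <= M * (t - s).

Let integrand_continuous y i : lip y -> continuous (fun s : R => f (y (Num.max 0 s)) i).
Proof.
move=> yl t; apply/cvgrPdist_le => /= e e0.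
pose C := K * (#|I|%:R * M) + 1; have C0 : 0 < C by rewrite ltr_wpDl // !mulr_ge0.
near=> s; apply: le_trans (f_lip _ _ _) _.
have mm : `|Num.max 0 t - Num.max 0 s| <= `|t - s|.
  have h1 := ler_norm (t - s); have h2 := ler_norm (s - t); rewrite distrC in h2.
  by rewrite ler_norml; have [t0|t0] := leP 0 t; have [s0|s0] := leP 0 s;
    apply/andP; split; lra.
have st : `|t - s| <= e / C by near: s; apply: cvgr_dist_le => //; rewrite divr_gt0.
have H j : `|y (Num.max 0 t) j - y (Num.max 0 s) j| <= M * `|t - s|.
  apply: le_trans (_ : M * `|Num.max 0 t - Num.max 0 s| <= _); last by rewrite ler_wpM2l.
  have lemax r : 0 <= Num.max 0 r :> R by rewrite le_max lexx.
  have [ts|/ltW ts] := leP (Num.max 0 s) (Num.max 0 t).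
    by rewrite [X in M * X]ger0_norm ?subr_ge0 ?yl.
  by rewrite distrC [X in M * X]distrC [X in M * X]ger0_norm ?subr_ge0 ?yl.
apply: (@le_trans _ _ (K * (#|I|%:R * M) * `|t - s|)).
  rewrite -mulrA ler_wpM2l // -mulrA mulr_natl -sumr_const; exact: ler_sum.
apply: le_trans (_ : C * (e / C) <= _); last by rewrite mulrC divfK // gt_eqF.
by apply: ler_pM => //; rewrite ?mulr_ge0 // lerDl.
Unshelve. all: by end_near. Qed.

Let T0 y i : T y 0 i = y0 i.
Proof. by rewrite /T prim0 addr0. Qed.

Let der_T y i (t : R) : lip y -> -1 < t ->
  is_derive t (1 : R) (fun s => T y s i) (f (y (Num.max 0 t)) i).
Proof.
move=> yl t1; have c0 : is_derive t (1 : R) (fun=> y0 i) 0 by exact: is_derive_cst.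
have H := der_prim (@integrand_continuous y i yl) t1.
by apply: (is_derive_ext _ _ (derD c0 H)) => //; rewrite add0r.
Qed.

Let gtN1 (t : R) : 0 <= t -> -1 < t.
Proof. by lra. Qed.

Let lip_T y : lip y -> lip (T y).
Proof.
move=> yl s t i s0 st.
have [|c _ ->] := @der_mvt R (fun r => T y r i) (fun r => f (y (Num.max 0 r)) i) s t st.
  by move=> r /andP[sr _]; apply: (@der_T _ i _ yl); apply: gtN1; exact: le_trans sr.
by rewrite normrM (@ger0_norm _ (t - s)) ?subr_ge0 // ler_wpM2r // subr_ge0.
Qed.

Let Lam : R := 2 * (K * #|I|%:R) + 1.

(** The exponential weight lets one contraction cover the whole half-line: integrating K |I| D expR
    (Lam s) divides by [Lam], which exceeds 2 K |I|. *)
Let contraction u v D : lip u -> lip v -> 0 <= D ->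
  (forall (t : R) i, 0 <= t -> `|u t i - v t i| <= D * expR (Lam * t)) ->
  forall (t : R) i, 0 <= t -> `|T u t i - T v t i| <= D / 2 * expR (Lam * t).
Proof.
move=> ul vl D0 uv t i t0.
have bound (s : R) : 0 <= s -> `|f (u s) i - f (v s) i| <= D / 2 * (Lam * expR (Lam * s)).
  move=> s0; apply: le_trans (f_lip _ _ _) _.
  apply: (@le_trans _ _ (K * (#|I|%:R * (D * expR (Lam * s))))).
    by rewrite ler_wpM2l // mulr_natl -sumr_const; apply: ler_sum => j _; exact: uv.
  have : 0 <= D * expR (Lam * s) by rewrite mulr_ge0 // expR_ge0.
  by rewrite /Lam; lra.
have Bd (s : R) : is_derive s (1 : R) (fun r => D / 2 * expR (Lam * r)) (D / 2 * (Lam * expR (Lam * s))).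
  by apply: derZ; exact: der_expR.
have D2 : 0 <= D / 2 by lra.
have half (a b : R -> I -> R) : lip a -> lip b ->
    (forall s : R, 0 <= s -> `|f (a s) i - f (b s) i| <= D / 2 * (Lam * expR (Lam * s))) ->
    T a t i - T b t i <= D / 2 * expR (Lam * t).
  move=> al bl ab.
  have := der_le0 t0 (fun s st => derB (derB (@der_T _ i _ al (gtN1 (proj1 (andP st))))
    (@der_T _ i _ bl (gtN1 (proj1 (andP st))))) (Bd s)).
  rewrite !T0 subrr mulr0 expR0 => /(_ _)/wrap[].
    move=> s /andP[s0 _]; rewrite (max_r s0).
    by have := ab s s0; rewrite ler_norml => /andP[_]; lra.
  by lra.
rewrite ler_norml; apply/andP; split; last by apply: (half u v ul vl) => s s0; exact: bound.
rewrite lerNl opprB; apply: (half v u vl ul) => s s0.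
by rewrite distrC; exact: bound.
Qed.

Theorem picard_lindelof : exists y : R -> I -> R, (forall i, y 0 i = y0 i) /\
  forall t : R, 0 <= t -> forall i, is_derive t (1 : R) (fun s => y s i) (f (y t) i).
Proof.
pose Y m := iter m T (fun=> y0).
have Yl m : lip (Y m).
  elim: m => [|m IH]; last exact: lip_T.
  by move=> s t i s0 st /=; rewrite subrr normr0 mulr_ge0 // subr_ge0.
have E0 (t : R) : 0 <= expR (Lam * t) by exact: expR_ge0.
have dY m (t : R) i : 0 <= t -> `|Y m.+1 t i - Y m t i| <= M * 2^-1 ^+ m * expR (Lam * t).
  elim: m t i => [|m IH] t i t0.
    have := lip_T (Yl 0%N) i (lexx 0) t0; rewrite /= T0 subr0 expr0 mulr1 => h.
    apply: le_trans h _; rewrite ler_wpM2l //.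
    apply: le_trans (expR_ge1Dx _); rewrite /Lam.
    have : 0 <= K * #|I|%:R * t by rewrite !mulr_ge0.
    lra.
  have := contraction (Yl m.+1) (Yl m) (_ : 0 <= M * 2^-1 ^+ m) IH i t0.
  rewrite mulr_ge0 ?exprn_ge0 ?invr_ge0 // => /(_ erefl) /=.
  by rewrite exprS (mulrC 2^-1) mulrA.
have lim (t : R) i : exists l, 0 <= t -> forall m, `|l - Y m t i| <= 2 * M * 2^-1 ^+ m * expR (Lam * t).
  have [t0|t0] := leP 0 t; last by exists 0 => t0'; lra.
  pose B m := 2 * M * 2^-1 ^+ m * expR (Lam * t).
  have BS m : B m = 2 * B m.+1 by rewrite /B exprS; field.
  have B0 m : 0 <= B m by rewrite !mulr_ge0 // exprn_ge0 // invr_ge0.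
  have hd m : - B m.+1 <= Y m.+1 t i - Y m t i <= B m.+1.
    rewrite -ler_norml; apply: le_trans (dY m t i t0) _.
    by rewrite /B exprS le_eqVlt; apply/orP; left; apply/eqP; field.
  (* The radius halves at each step and the new radius bounds the move of the centre, so the
     intervals are nested. *)
  have [||| l Hl] := @nested_limit (fun m => Y m t i - B m) (fun m => Y m t i + B m).
  - apply: (@homo_leq _ _ Order.le (fun=> lexx _) (fun a b c => @le_trans _ _ a b c)) => m.
    by have /andP[] := hd m; have := BS m; lra.
  - apply: (@homo_leq _ _ (fun a b => b <= a) (fun=> lexx _)).
      by move=> a b c ab ca; exact: le_trans ab.
    by move=> m; have /andP[] := hd m; have := BS m; lra.
  - by move=> m; have := B0 m; lra.
  exists l => _ m; rewrite ler_norml -/(B m); have /andP[] := Hl m; lra.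
pose y (t : R) i := projT1 (cid (lim t i)).
have yY (t : R) i m : 0 <= t -> `|y t i - Y m t i| <= 2 * M * 2^-1 ^+ m * expR (Lam * t).
  by move=> t0; rewrite /y; case: (cid _) => l /= /(_ t0 m).
have yl : lip y.
  move=> s t i s0 st; have t0 := le_trans s0 st.
  apply: (@le_half_pow _ _ (2 * M * (expR (Lam * t) + expR (Lam * s)))) => m.
  have := yY t i m t0; have := yY s i m s0; have := Yl m s t i s0 st.
  rewrite !ler_norml => /andP[h1 h2] /andP[h3 h4] /andP[h5 h6].
  by apply/andP; split; lra.
(* The limit [y] is 0 at negative times, so the solution is [T y]: it agrees with [y] for t >= 0 and
   has a two-sided derivative at 0. *)
exists (T y).
have Ty (t : R) : 0 <= t -> T y t = y t.
  move=> t0; apply/funext => i; apply/eqP; rewrite -subr_eq0 -normr_le0.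
  apply: (@le_half_pow _ _ (4 * M * expR (Lam * t))) => m; rewrite add0r.
  have := contraction yl (Yl m) (_ : 0 <= 2 * M * 2^-1 ^+ m) (fun s j hs => yY s j m hs) i t0.
  rewrite !mulr_ge0 ?exprn_ge0 ?invr_ge0 // => /(_ erefl) h1.
  have h2 := yY t i m.+1 t0.
  have h3 := ler_distD (Y m.+1 t i) (T y t i) (y t i).
  rewrite (distrC (Y _ _ _)) in h3.
  have h4 : 2 * M * 2^-1 ^+ m.+1 * expR (Lam * t) = M * 2^-1 ^+ m * expR (Lam * t).
    by rewrite exprS; field.
  rewrite h4 in h2; have : 0 <= M * 2^-1 ^+ m * expR (Lam * t).
    by rewrite !mulr_ge0 // exprn_ge0 // invr_ge0.
  by move: h1 h2 h3; rewrite /=; lra.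
split=> [i|t t0 i]; first exact: T0.
by rewrite Ty // -{2}(max_r t0); apply: (@der_T _ i _ yl); exact: gtN1.
Qed.

End Picard.

(** * Bounded Lipschitz functions of finitely many coordinates *)

Section BoundedLipschitz.
Variables (R : realType) (I : finType).
Implicit Types (u v : I -> R) (g h : (I -> R) -> R).

(** Boundedness is part of the notion so that products stay in the class; the clamped field is a
    polynomial in clamped coordinates. *)
Definition blip g : Prop := exists M K, [/\ 0 <= M, 0 <= K, forall u, `|g u| <= M
  & forall u v, `|g u - g v| <= K * \sum_j `|u j - v j|].

Lemma blip_cst (a : R) : blip (fun=> a).
Proof.
exists `|a|, 0; split=> // u v; rewrite subrr normr0 mul0r //.
Qed.

Lemma blipD g h : blip g -> blip h -> blip (fun u => g u + h u).
Proof.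
move=> [M [K [M0 K0 gM gK]]] [M' [K' [M0' K0' hM hK]]].
exists (M + M'), (K + K'); split; [exact: addr_ge0|exact: addr_ge0| |] => [u|u v].
  by apply: le_trans (ler_normD _ _) _; exact: lerD.
rewrite opprD addrACA mulrDl; apply: le_trans (ler_normD _ _) _; exact: lerD.
Qed.

Lemma blipM g h : blip g -> blip h -> blip (fun u => g u * h u).
Proof.
move=> [M [K [M0 K0 gM gK]]] [M' [K' [M0' K0' hM hK]]].
exists (M * M'), (M * K' + M' * K); split.
- exact: mulr_ge0.
- by rewrite addr_ge0 // mulr_ge0.
- by move=> u; rewrite normrM; exact: ler_pM.
- move=> u v; have -> : g u * h u - g v * h v = g u * (h u - h v) + h v * (g u - g v) by ring.
  apply: le_trans (ler_normD _ _) _; rewrite !normrM mulrDl -!mulrA; apply: lerD; exact: ler_pM.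
Qed.

Lemma blipN g : blip g -> blip (fun u => - g u).
Proof.
move=> gb; have -> : (fun u => - g u) = fun u => -1 * g u.
  by apply/funext => u; rewrite mulN1r.
by apply: blipM => //; exact: blip_cst.
Qed.

Lemma blip_sum m (g : 'I_m -> (I -> R) -> R) :
  (forall i, blip (g i)) -> blip (fun u => \sum_i g i u).
Proof.
elim: m g => [|m IH] g gb.
  rewrite (_ : (fun u => _) = fun=> 0); first exact: blip_cst.
  by apply/funext => u; rewrite big_ord0.
rewrite (_ : (fun u => _) = fun u => \sum_(i < m) g (widen_ord (leqnSn m) i) u + g ord_max u).
  by apply: blipD => //; exact: IH.
by apply/funext => u; rewrite big_ord_recr.
Qed.

Definition clamp (B a : R) : R := Num.max (- B) (Num.min B a).

Lemma clamp_id B a : `|a| <= B -> clamp B a = a.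
Proof.
by rewrite ler_norml /clamp => /andP[h1 h2]; rewrite (min_idPr h2) (max_idPr h1).
Qed.

Lemma blip_clamp B i : 0 <= B -> blip (fun u => clamp B (u i)).
Proof.
move=> B0; exists B, 1; split=> // [u|u v].
  rewrite ler_norml /clamp le_max lexx ge_max ge_min lexx !andbT /=.
  by lra.
rewrite mul1r; apply: (@le_trans _ _ `|u i - v i|).
  have h1 := ler_norm (u i - v i); have h2 := ler_norm (v i - u i); rewrite distrC in h2.
  rewrite ler_norml /clamp.
  have [a|a] := leP B (u i); have [b|b] := leP B (v i);
    [have [c|c] := leP (- B) B; have [d|d] := leP (- B) B
    |have [c|c] := leP (- B) B; have [d|d] := leP (- B) (v i)
    |have [c|c] := leP (- B) (u i); have [d|d] := leP (- B) B
    |have [c|c] := leP (- B) (u i); have [d|d] := leP (- B) (v i)];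
    apply/andP; split; lra.
by rewrite (bigD1 i) //= lerDl sumr_ge0.
Qed.

Definition mblip m k (A : (I -> R) -> 'M[R]_(m, k)) : Prop :=
  forall i j, blip (fun u => A u i j).

Lemma mblip_ext m k (A : (I -> R) -> 'M[R]_(m, k)) (F : 'I_m -> 'I_k -> (I -> R) -> R) :
  (forall u i j, A u i j = F i j u) -> (forall i j, blip (F i j)) -> mblip A.
Proof. by move=> AF Fb i j; rewrite (_ : (fun u => _) = F i j) //; apply/funext. Qed.

Lemma mblip_cst m k (A : 'M[R]_(m, k)) : mblip (fun=> A).
Proof. by move=> i j; exact: blip_cst. Qed.

Lemma mblipD m k (A B : (I -> R) -> 'M[R]_(m, k)) :
  mblip A -> mblip B -> mblip (fun u => A u + B u).
Proof.
move=> Ab Bb; apply: (@mblip_ext _ _ _ (fun i j u => A u i j + B u i j)) => [u i j|i j].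
  by rewrite mxE.
exact: blipD.
Qed.

Lemma mblipM m k l (A : (I -> R) -> 'M[R]_(m, k)) (B : (I -> R) -> 'M[R]_(k, l)) :
  mblip A -> mblip B -> mblip (fun u => A u *m B u).
Proof.
move=> Ab Bb; apply: (@mblip_ext _ _ _ (fun i j u => \sum_p A u i p * B u p j)) => [u i j|i j].
  by rewrite mxE.
by apply: blip_sum => p; exact: blipM.
Qed.

Lemma mblip_skew (A : (I -> R) -> 'cV[R]_3) : mblip A -> mblip (fun u => skew (A u)).
Proof.
move=> Ab; have Z := blip_cst 0.
have ext g h : g =1 h -> blip h -> blip g by move=> /funext ->.
apply: ord3P; apply: ord3P; (apply: ext; [move=> u; rewrite skewE; reflexivity|]);
  first [exact: Z | exact: Ab | by apply: blipN; exact: Ab].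
Qed.

Lemma mblip_eR (A : (I -> R) -> 'M[R]_3) : mblip A -> mblip (fun u => eR (A u)).
Proof.
move=> Ab i j; rewrite (ord1 j); move: i {j}.
have ext g h : g =1 h -> blip h -> blip g by move=> /funext ->.
apply: ord3P; (apply: ext; [move=> u; rewrite eRE; reflexivity|]);
  by apply: blipM; [exact: blip_cst|apply: blipD; [exact: Ab|apply: blipN; exact: Ab]].
Qed.

Lemma blip_uniform (f : (I -> R) -> I -> R) : (forall i, blip (fun u => f u i)) ->
  exists M K, [/\ 0 <= M, 0 <= K, forall u i, `|f u i| <= M
    & forall u v i, `|f u i - f v i| <= K * \sum_j `|u j - v j|].
Proof.
move=> fb; pose M i := projT1 (cid (fb i)).
have /all_sig[K HK] i : {K | [/\ 0 <= M i, 0 <= K, forall u, `|f u i| <= M i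
    & forall u v, `|f u i - f v i| <= K * \sum_j `|u j - v j|]}.
  by apply: cid; rewrite /M; case: (cid _).
have bnd (F : I -> R) i : (forall j, 0 <= F j) -> F i <= \sum_j F j.
  by move=> F0; rewrite (bigD1 i) //= lerDl sumr_ge0.
have M0 i : 0 <= M i by case: (HK i).
have K0 i : 0 <= K i by case: (HK i).
exists (\sum_i M i), (\sum_i K i); split; [exact: sumr_ge0|exact: sumr_ge0| |].
  by move=> u i; case: (HK i) => _ _ h _; apply: le_trans (h u) _; exact: bnd.
move=> u v i; case: (HK i) => _ _ _ h; apply: le_trans (h u v) _.
by rewrite ler_wpM2r ?bnd // sumr_ge0.
Qed.

End BoundedLipschitz.

(** * Differences of rotations *)

Section Differences.
Variable R : realType.
Implicit Types (Q M : 'M[R]_3) (a e v w : 'cV[R]_3).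

Lemma sq_tr_le Q : (\tr Q) ^+ 2 <= 3 * sq Q.
Proof.
have h i : Q i i ^+ 2 <= \sum_j Q i j ^+ 2.
  by rewrite (bigD1 i) //= lerDl sumr_ge0 // => j _; exact: sqr_ge0.
rewrite /mxtrace /sq (sum3 (fun i => Q i i)) (sum3 (fun i => \sum_j Q i j ^+ 2)).
move: (h (inord 0)) (h (inord 1)) (h (inord 2)).
move: (Q _ _) (Q _ _) (Q _ _) => x y z.
have := sqr_ge0 (x - y); have := sqr_ge0 (y - z); have := sqr_ge0 (x - z); lra.
Qed.

Lemma sq_eR_le Q : sq (eR Q) <= sq Q.
Proof.
have := sq_skew (eR Q); rewrite skew_eR sqZ.
have := sqD_le Q (- Q^T); rewrite sqN sqT.
have := sq_ge0 Q; lra.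
Qed.

Lemma EmxB Q M : Emx Q - Emx M = Emx (Q - M).
Proof.
rewrite /Emx -scalerBr; congr (_ *: _); rewrite linearB /= [in RHS]linearB /=.
by apply/matrixP => i j; rewrite !mxE; case: (i == j); rewrite ?mulr1n ?mulr0n; ring.
Qed.

Lemma sq_scalar_mx m (c : R) : sq (c%:M : 'M[R]_m) = m%:R * c ^+ 2.
Proof.
rewrite -[m in RHS]card_ord mulr_natl -sumr_const; apply: eq_bigr => i _.
rewrite (bigD1 i) //= mxE eqxx mulr1n big1 ?addr0 // => j ji.
by rewrite mxE eq_sym (negbTE ji) mulr0n expr0n.
Qed.

Lemma sq_Emx_le Q : sq (Emx Q) <= 5 * sq Q.
Proof.
rewrite /Emx sqZ; have := sqD_le (\tr Q)%:M (- Q^T).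
rewrite sqN sqT sq_scalar_mx; have := sq_tr_le Q; have := sq_ge0 Q; lra.
Qed.

Lemma cosR_diff Q M : (cosR Q - cosR M) ^+ 2 <= sq (Q - M).
Proof.
have -> : cosR Q - cosR M = 2^-1 * \tr (Q - M) by rewrite /cosR linearB /=; ring.
by rewrite exprMn; have := sq_tr_le (Q - M); have := sq_ge0 (Q - M); lra.
Qed.

Lemma trmx_mul_le m k (A B : 'M[R]_(m, k)) (c : R) : 0 < c ->
  2 * \tr (A^T *m B) <= c * sq A + c^-1 * sq B.
Proof.
move=> c0.
have -> : \tr (A^T *m B) = \sum_j dot (col j A) (col j B).
  apply: eq_bigr => j _; rewrite mxE; apply: eq_bigr => i _; by rewrite !mxE.
have sqc (X : 'M[R]_(m, k)) : sq X = \sum_j sq (col j X).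
  rewrite /sq exchange_big; apply: eq_bigr => j _; apply: eq_bigr => i _.
  by rewrite big_ord1 mxE.
rewrite !sqc !mulr_sumr -big_split; apply: ler_sum => j _; exact: dot_young.
Qed.

Lemma sq_SO3_mull k Q (A : 'M[R]_(3, k)) : SO3 Q -> sq (Q *m A) = sq A.
Proof.
case=> QQ _; rewrite !sq_mxtrace trmx_mul mulmxA -(mulmxA A^T) QQ mulmx1 //.
Qed.

Lemma tr_gram_skew Q v : \tr (Q^T *m (Q *m skew v)) = 0.
Proof.
have : \tr (Q^T *m (Q *m skew v)) = - \tr (Q^T *m (Q *m skew v)).
  rewrite -{1}mxtrace_tr !trmx_mul trmxK skewT mulNmx mulNmx linearN /=.
  by rewrite -mulmxA mxtrace_mulC mulmxA.
by lra.
Qed.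

(* The rotation rates differ by [Q *m skew (v - w)] and a part orthogonal to [Q - M]. *)
Lemma rotation_diff_rate Q M v w (c : R) : SO3 Q -> 0 < c ->
  `|2 * \tr ((Q - M)^T *m (Q *m skew v - M *m skew w))|
  <= c * sq (Q - M) + c^-1 * (2 * sq (v - w)).
Proof.
move=> SQ c0.
have -> : Q *m skew v - M *m skew w = Q *m skew (v - w) + (Q - M) *m skew w.
  by rewrite skewB mulmxBr mulmxBl addrA subrK.
rewrite mulmxDr linearD /= tr_gram_skew addr0.
have h := trmx_mul_le (Q - M) (Q *m skew (v - w)) c0.
have h' := trmx_mul_le (- (Q - M)) (Q *m skew (v - w)) c0.
rewrite sqN linearN /= mulNmx linearN /= in h'.
rewrite sq_SO3_mull // sq_skew in h h'.
by rewrite ler_norml; apply/andP; split; lra.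
Qed.

(** By [Emx_eR], near the pi-rotations the transposed Jacobian acts on differences of e_R almost as
    -1. Each of the three error terms contains a factor that is small there. The constant is 2 (2 +
    2) + 2 * 5. *)
Lemma Emx_add1_diff Q M (eps : R) : SO3 Q -> SO3 M -> eps <= 1 ->
  sq (eR Q) <= eps -> sq (eR M) <= eps -> 1 + cosR M <= eps ->
  sq ((Emx Q)^T *m (eR Q - eR M) + (eR Q - eR M)) <= 18 * eps * sq (Q - M).
Proof.
move=> SQ SM e1 eQ eM cM.
have -> : (Emx Q)^T *m (eR Q - eR M) + (eR Q - eR M) =
    (cosR Q - cosR M) *: eR Q + (1 + cosR M) *: (eR Q - eR M)
    + - ((Emx Q - Emx M)^T *m eR M).
  have -> : (Emx Q - Emx M)^T = (Emx Q)^T - (Emx M)^T by rewrite linearB.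
  rewrite mulmxBr mulmxBl !Emx_eR //.
  by apply/matrixP => i j; rewrite !mxE; ring.
apply: le_trans (sqD_le _ _) _; rewrite sqN.
have h1 := sqD_le ((cosR Q - cosR M) *: eR Q) ((1 + cosR M) *: (eR Q - eR M)).
have h2 := sq_mulmx (Emx Q - Emx M)^T (eR M).
rewrite sqT EmxB in h2.
rewrite (sqZ (cosR Q - cosR M)) (sqZ (1 + cosR M)) -eR_sub in h1.
have h3 := sq_Emx_le (Q - M); have h4 := sq_eR_le (Q - M); have h5 := cosR_diff Q M.
have /andP[c1 _] := cosR_itv SM.
have s0 := sq_ge0 (Q - M); have s1 := sq_ge0 (eR Q); have s2 := sq_ge0 (eR M).
have s3 := sq_ge0 (eR (Q - M)).
have k1 : (cosR Q - cosR M) ^+ 2 * sq (eR Q) <= sq (Q - M) * eps.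
  by apply: ler_pM => //; exact: sqr_ge0.
have k2 : (1 + cosR M) ^+ 2 <= eps by nra.
have k3 : (1 + cosR M) ^+ 2 * sq (eR (Q - M)) <= eps * sq (Q - M).
  by apply: ler_pM => //; exact: sqr_ge0.
have k4 : sq (Emx (Q - M)) * sq (eR M) <= 5 * sq (Q - M) * eps.
  by apply: ler_pM => //; exact: sq_ge0.
rewrite EmxB -eR_sub; lra.
Qed.

Definition others m (j : 'I_m.+1) (u : 'cV[R]_m.+1) : 'cV[R]_m := \col_l u (lift j l) 0.

Lemma sq_others m (j : 'I_m.+1) (u : 'cV[R]_m.+1) : sq u = u j 0 ^+ 2 + sq (others j u).
Proof.
rewrite {1}/sq (bigD1_ord j) //= big_ord1; congr (_ + _); apply: eq_bigr => l _.
by rewrite !big_ord1 mxE.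
Qed.

Lemma othersB m (j : 'I_m.+1) (u v : 'cV[R]_m.+1) : others j (u - v) = others j u - others j v.
Proof. by apply/matrixP => i l; rewrite !mxE. Qed.

(** The axis of a rotation is determined only up to sign. Making a coordinate of largest modulus
    nonnegative fixes the sign, and the three values of [j] give charts covering all axes. *)
Definition dominant (j : 'I_3) (u : 'cV[R]_3) : Prop := forall l, `|u l 0| <= u j 0.

Lemma dominant_exists u : exists j b, dominant j ((-1) ^+ nat_of_bool b *: u).
Proof.
have [j _ Hj] := @arg_maxP _ _ _ (inord 0 : 'I_3) xpredT (fun l => `|u l 0|) isT.
exists j, (u j 0 < 0) => l; rewrite !mxE normrM normrX normrN1 expr1n mul1r.
apply: le_trans (Hj l isT) _; have [h|h] := ltP (u j 0) 0.
  by rewrite ltr0_norm //= expr1 mulN1r.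
by rewrite ger0_norm //= expr0 mul1r.
Qed.

(* On a sphere a coordinate of largest modulus is a Lipschitz function of the others. *)
Lemma dominant_sq_diff (j : 'I_3) (u v : 'cV[R]_3) : sq u = sq v ->
  dominant j u -> dominant j v ->
  sq (u - v) <= 3 * sq (others j u - others j v).
Proof.
move=> uv du dv.
rewrite (sq_others j) othersB [(u - v) j 0]mxE [(- v) j 0]mxE.
rewrite !(sq_others j) in uv.
suff : (u j 0 - v j 0) ^+ 2 <= 2 * sq (others j u - others j v) by lra.
move: uv; rewrite !sq_dot /dot !big_ord_recl !big_ord0 !mxE !addr0.
set l0 := lift j _; set l1 := lift j (lift _ _).
have := du l0; have := du l1; have := dv l0; have := dv l1; have := du j; have := dv j.
move: (u l0 0) (u l1 0) (v l0 0) (v l1 0) (u j 0) (v j 0) => a b a' b' c c'.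
rewrite !ler_norml => /andP[h1 h2] /andP[h3 h4] /andP[h5 h6] /andP[h7 h8] /andP[h9 h10] /andP[h11 h12] E.
have [s0|s0] := eqVneq (c + c') 0.
  have -> : c - c' = 0 by lra.
  have := sqr_ge0 (a - a'); have := sqr_ge0 (b - b'); lra.
have {s0}s0 : 0 < c + c' by rewrite lt_neqAle eq_sym s0; lra.
have E2 : (c - c') * (c + c') = (a' - a) * (a' + a) + (b' - b) * (b' + b) by lra.
have bnd (x y : R) : `|y| <= c + c' -> x * y <= `|x| * (c + c').
  by move=> hy; apply: le_trans (ler_norm _) _; rewrite normrM ler_wpM2l.
have na : `|a' + a| <= c + c' by rewrite ler_norml; apply/andP; split; lra.
have nb : `|b' + b| <= c + c' by rewrite ler_norml; apply/andP; split; lra.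
have u1 : (c - c') <= `|a' - a| + `|b' - b|.
  rewrite -(ler_pM2r s0).
  by have := bnd (a' - a) _ na; have := bnd (b' - b) _ nb; lra.
have u2 : - (c - c') <= `|a' - a| + `|b' - b|.
  rewrite -(ler_pM2r s0) (distrC a') (distrC b').
  by have := bnd (a - a') _ na; have := bnd (b - b') _ nb; lra.
have -> : (a - a') * (a - a') = `|a' - a| ^+ 2 by rewrite real_normK ?num_real //; ring.
have -> : (b - b') * (b - b') = `|b' - b| ^+ 2 by rewrite real_normK ?num_real //; ring.
have := sqr_ge0 (`|a' - a| - `|b' - b|); nra.
Qed.

(** Near the pi-rotations s a and two coordinates of the axis control the rotation: the third
    coordinate follows by dominance, s is the product of s a with a, and c is a Lipschitz function
    of s because |c + c'| >= 1. *)
Lemma rodr_close : exists2 K : R, 0 < K &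
  forall (j : 'I_3) a a' (c s c' s' : R), sq a = 1 -> sq a' = 1 ->
    c ^+ 2 + s ^+ 2 = 1 -> c' ^+ 2 + s' ^+ 2 = 1 ->
    c <= - 2^-1 -> c' <= - 2^-1 -> dominant j a -> dominant j a' ->
  sq (rodr a c s - rodr a' c' s') <=
  K * (sq (others j a - others j a') + sq (s *: a - s' *: a')).
Proof.
(* The estimates below add up to the factors 68 for [e] and 128 * 3 = 384 for [S]. *)
exists 400; first by lra.
move=> j a a' c s c' s' a1 a1' cs cs' c2 c2' da da'.
have hS := dominant_sq_diff (etrans a1 (esym a1')) da da'.
set S := sq (others j a - _) in hS *; set e := sq (s *: a - s' *: a').
have se : (s - s') ^+ 2 <= 2 * e + 2 * sq (a - a').
  have -> : s - s' = dot (s *: a - s' *: a') a + s' * dot a' (a - a').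
    by rewrite dotBl dotBr !dotZl -!sq_dot a1 a1'; ring.
  have h1 := dot_sqr_le (s *: a - s' *: a') a; rewrite a1 mulr1 -/e in h1.
  have h2 := dot_sqr_le a' (a - a'); rewrite a1' mul1r in h2.
  have h3 : (s' * dot a' (a - a')) ^+ 2 <= sq (a - a').
    have := sqr_ge0 (dot a' (a - a')); rewrite exprMn; nra.
  by move: h1 h3; set X := dot _ a; set Y := s' * _; have := sqr_ge0 (X - Y); nra.
have ce : (c - c') ^+ 2 <= 4 * (s - s') ^+ 2.
  have E : (c - c') * (c + c') = - (s - s') * (s + s').
    by rewrite mulNr -!subr_sqr (circleE cs) (circleE cs'); ring.
  have h1 : (c - c') ^+ 2 <= ((c - c') * (c + c')) ^+ 2.
    by rewrite exprMn ler_peMr ?sqr_ge0 //; nra.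
  apply: le_trans h1 _; rewrite E exprMn sqrrN mulrC ler_wpM2r ?sqr_ge0 //.
  have := sqr_ge0 (s - s'); have := sqr_ge0 c; have := sqr_ge0 c'; nra.
have -> : rodr a c s - rodr a' c' s' = (c - c') *: (1 - a *m a^T)
   + (1 - c') *: (a *m a^T - a' *m a'^T) + skew (s *: a - s' *: a').
  rewrite /rodr skewB !skewZ -!(scalemx1 3 c) -!(scalemx1 3 c').
  by apply/matrixP => i l; rewrite !mxE; ring.
have p1 : sq (1 - a *m a^T) = 2.
  have -> : 1 - a *m a^T = rodr a 1 0 - rodr a 0 0.
    by rewrite /rodr !scale0r subrr scale0r subr0 scale1r !addr0 -(scalemx1 3 0) scale0r add0r.
  rewrite /sq sum3 !sum3 !mxBE ?rodrE ?skewE ?ord3E ?eqxx ?mulr1n ?mulr0n /=.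
  by ring: (sphereE a1).
have p2 : sq (a *m a^T - a' *m a'^T) <= 4 * sq (a - a').
  have -> : a *m a^T - a' *m a'^T = (a - a') *m a^T + a' *m (a - a')^T.
    by rewrite mulmxBl linearB /= mulmxBr addrA subrK.
  apply: le_trans (sqD_le _ _) _.
  have := sq_mulmx (a - a') a^T; have := sq_mulmx a' (a - a')^T.
  by rewrite !sqT a1 a1'; lra.
apply: le_trans (sqD_le _ _) _; rewrite sq_skew -/e.
have := sqD_le ((c - c') *: (1 - a *m a^T)) ((1 - c') *: (a *m a^T - a' *m a'^T)).
rewrite !sqZ p1 => h.
have c4 : (1 - c') ^+ 2 <= 4 by have := sqr_ge0 s'; nra.
have : (1 - c') ^+ 2 * sq (a *m a^T - a' *m a'^T) <= 4 * (4 * sq (a - a')).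
  by apply: ler_pM => //; [exact: sqr_ge0|exact: sq_ge0].
have := sq_ge0 (a - a'); have : 0 <= e by exact: sq_ge0.
lra.
Qed.

End Differences.

(** * The closed loop *)

Section ClosedLoop.
Variables (R : realType) (n : nat) (J : 'M[R]_3) (AK : 'M[R]_n)
  (Bth Bom : 'M[R]_(n, 3)) (CK : 'M[R]_(3, n)) (Dth Dom : 'M[R]_3).
Implicit Types (Re : R -> 'M[R]_3) (w : R -> 'cV[R]_3) (x : R -> 'cV[R]_n) (t : R).

Definition wdot (e w : 'cV[R]_3) (x : 'cV[R]_n) : 'cV[R]_3 := invmx J *m (CK *m x + Dth *m e + Dom *m w).
Definition xdot (e w : 'cV[R]_3) (x : 'cV[R]_n) : 'cV[R]_n := AK *m x + Bth *m e + Bom *m w.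

Definition solves_at (Re : R -> 'M[R]_3) (w : R -> 'cV[R]_3) (x : R -> 'cV[R]_n) (t : R) :=
  [/\ mder Re t (Re t *m skew (w t)), mder w t (wdot (eR (Re t)) (w t) (x t))
   & mder x t (xdot (eR (Re t)) (w t) (x t))].

Lemma mder_col_mx m k l (A : R -> 'M[R]_(m, l)) (B : R -> 'M[R]_(k, l)) t dA dB :
  mder A t dA -> mder B t dB -> mder (fun s => col_mx (A s) (B s)) t (col_mx dA dB).
Proof.
move=> Ad Bd i j; case: (splitP i) => i' e.
  have -> : i = lshift k i' by exact: val_inj.
  by apply: (is_derive_ext _ _ (Ad i' j)) => [s|]; rewrite col_mxEu.
have -> : i = rshift m i' by exact: val_inj.
by apply: (is_derive_ext _ _ (Bd i' j)) => [s|]; rewrite col_mxEd.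
Qed.

Lemma mder_stack (e w : R -> 'cV[R]_3) (x : R -> 'cV[R]_n) t de dw dx :
  mder e t de -> mder w t dw -> mder x t dx ->
  mder (fun s => stack (e s) (w s) (x s)) t (stack de dw dx).
Proof. by move=> ed wd xd; do 2 apply: mder_col_mx => //. Qed.

Lemma wdotB (e w e' w' : 'cV[R]_3) (x x' : 'cV[R]_n) :
  wdot e w x - wdot e' w' x' = wdot (e - e') (w - w') (x - x').
Proof.
rewrite /wdot -mulmxBr; congr (_ *m _); rewrite !mulmxBr.
by apply/matrixP => i j; rewrite !mxBE !mxE; ring.
Qed.

Lemma xdotB (e w e' w' : 'cV[R]_3) (x x' : 'cV[R]_n) :
  xdot e w x - xdot e' w' x' = xdot (e - e') (w - w') (x - x').
Proof.
by rewrite /xdot !mulmxBr; apply/matrixP => i j; rewrite !mxE; ring.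
Qed.

Lemma sq_combine3_le m k l p (A : 'M[R]_(p, m)) (B : 'M[R]_(p, k)) (C : 'M[R]_(p, l))
    (u : 'cV[R]_m) (v : 'cV[R]_k) (z : 'cV[R]_l) :
  sq (A *m u + B *m v + C *m z) <= 4 * (sq A + sq B + sq C) * (sq u + sq v + sq z).
Proof.
have h1 := sqD_le (A *m u + B *m v) (C *m z); have h2 := sqD_le (A *m u) (B *m v).
have := sq_mulmx A u; have := sq_mulmx B v; have := sq_mulmx C z.
have := sq_ge0 A; have := sq_ge0 B; have := sq_ge0 C.
have := sq_ge0 u; have := sq_ge0 v; have := sq_ge0 z.
nra.
Qed.

Definition rateK : R :=
  4 * (sq (invmx J *m CK) + sq (invmx J *m Dth) + sq (invmx J *m Dom))
  + 4 * (sq AK + sq Bth + sq Bom).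

Lemma rateK_ge0 : 0 <= rateK.
Proof. by rewrite addr_ge0 // mulr_ge0 // !addr_ge0 // sq_ge0. Qed.

Lemma sq_wdot_xdot (e w : 'cV[R]_3) (x : 'cV[R]_n) :
  sq (wdot e w x) + sq (xdot e w x) <= rateK * (sq e + sq w + sq x).
Proof.
rewrite /wdot !mulmxDr !mulmxA.
have h1 := sq_combine3_le (invmx J *m CK) (invmx J *m Dth) (invmx J *m Dom) x e w.
have h2 := sq_combine3_le AK Bth Bom x e w.
by rewrite /rateK /xdot; lra.
Qed.

Lemma solution_solves_at Re w x : J \in unitmx ->
  is_solution J AK Bth Bom CK Dth Dom Re w x ->
  SO3 (Re 0) /\ forall t, 0 <= t -> solves_at Re w x t.
Proof.
move=> Ju [R0 H]; split=> // t t0; have [Rd [[dw [wd dwE]] xd]] := H t t0.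
split=> // i j; rewrite (ord1 j) //.
by rewrite /wdot -dwE mulKmx.
Qed.

Lemma solves_SO3 Re w x T : 0 <= T -> (forall t, 0 <= t <= T -> solves_at Re w x t) ->
  SO3 (Re 0) -> SO3 (Re T).
Proof. by move=> T0 H; apply: (SO3_preserved T0 (w := w)) => t /H[]. Qed.

Definition state Re (w : R -> 'cV[R]_3) (x : R -> 'cV[R]_n) (t : R) :=
  stack (eR (Re t)) (w t) (x t).

Definition state_dot Re w x t := stack (Emx (Re t) *m w t)
  (wdot (eR (Re t)) (w t) (x t)) (xdot (eR (Re t)) (w t) (x t)).

Lemma der_state Re w x t : solves_at Re w x t ->
  mder (state Re w x) t (state_dot Re w x t).
Proof.
by case=> Rd wd xd; apply: mder_stack => //; rewrite -eR_skew; exact: der_eR.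
Qed.

Lemma sq_state_dot Re w x t : SO3 (Re t) ->
  sq (state_dot Re w x t) <= (1 + rateK) * sq (state Re w x t).
Proof.
move=> /(sq_Emx (w t)) h; rewrite !sq_stack.
have := sq_wdot_xdot (eR (Re t)) (w t) (x t).
have := sq_ge0 (eR (Re t)); have := sq_ge0 (x t); move: h; lra.
Qed.

Variables (P : 'M[R]_(3 + (3 + n))) (p11 lam k : R).
Hypotheses (Psym : P^T = P) (p11_gt0 : 0 < p11)
  (lam_gt0 : 0 < lam) (k_gt0 : 0 < k)
  (Pcoer : forall h, lam * sq h <= dot h (P *m h))
  (rate : forall (e w de : 'cV[R]_3) (x : 'cV[R]_n), sq de <= sq w ->
    2 * dot (stack e w x) (P *m stack de (wdot e w x) (xdot e w x))
      - 2 * p11 * dot e de + 2 * p11 * dot e w <= - k * sq (stack e w x)).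

(* This is the function [V] of the text, since 2 Psi - |e_R|^2 = (1 - cos theta)^2. *)
Definition lyap Re w x t : R :=
  dot (state Re w x t) (P *m state Re w x t) + p11 * (1 - cosR (Re t)) ^+ 2.

Definition lyap_dot Re w x t : R :=
  2 * dot (state Re w x t) (P *m state_dot Re w x t)
  + 2 * p11 * (1 - cosR (Re t)) * dot (eR (Re t)) (w t).

Lemma der_quad m (A : 'M[R]_m) (h : R -> 'cV[R]_m) t dh : A^T = A -> mder h t dh ->
  is_derive t (1 : R) (fun s => dot (h s) (A *m h s)) (2 * dot (h t) (A *m dh)).
Proof.
move=> As hd; apply: (is_derive_ext _ _ (der_dot hd (mderMl A hd))) => //.
by rewrite -{1}As dot_tr; ring.
Qed.

Lemma der_lyap Re w x t : solves_at Re w x t ->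
  is_derive t (1 : R) (lyap Re w x) (lyap_dot Re w x t).
Proof.
move=> S; have [Rd _ _] := S.
have c1 : is_derive t (1 : R) (fun=> 1 : R) 0 by exact: is_derive_cst.
have cd := derB c1 (der_cosR Rd).
apply: (is_derive_ext _ _ (derD (der_quad Psym (der_state S)) (derZ p11 (derM cd cd)))).
  by move=> s; rewrite /lyap expr2.
by rewrite /lyap_dot; ring.
Qed.

(** By [Emx_eR], the derivative of p11 (1 - c)^2 is exactly the p11 correction on the left of
    [rate]. *)
Lemma lyap_dot_le Re w x t : SO3 (Re t) ->
  lyap_dot Re w x t <= - k * sq (state Re w x t).
Proof.
move=> SR; have := rate (eR (Re t)) (x t) (sq_Emx (w t) SR).
have -> : dot (eR (Re t)) (Emx (Re t) *m w t) = cosR (Re t) * dot (eR (Re t)) (w t).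
  by rewrite dot_mulr Emx_eR // dotZl.
rewrite /lyap_dot /state /state_dot; lra.
Qed.

Lemma lyap_ge Re w x t :
  lam * sq (state Re w x t) + p11 * (1 - cosR (Re t)) ^+ 2 <= lyap Re w x t.
Proof. by rewrite lerD2r Pcoer. Qed.

Lemma lyap_le Re w x t :
  lyap Re w x t <= (1 + sq P) * sq (state Re w x t) + p11 * (1 - cosR (Re t)) ^+ 2.
Proof. by rewrite lerD2r dot_mul_le. Qed.

Lemma lyap_ge0 Re w x t : 0 <= lyap Re w x t.
Proof.
apply: le_trans (lyap_ge _ _ _ _); rewrite addr_ge0 // mulr_ge0 ?sq_ge0 ?sqr_ge0 //;
  exact: ltW.
Qed.

Lemma lyap_noninc Re w x a b : 0 <= a -> a <= b ->
  (forall t, 0 <= t <= b -> solves_at Re w x t) -> SO3 (Re 0) ->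
  lyap Re w x b <= lyap Re w x a.
Proof.
move=> a0 ab S R0; apply: (der_le0 ab) => t /andP[at_ tb].
  by apply: der_lyap; apply: S; rewrite tb (le_trans a0).
have t0 := le_trans a0 at_; have SR : SO3 (Re t).
  by apply: (solves_SO3 t0 _ R0) => s /andP[s0 st]; apply: S; rewrite s0 (le_trans st).
apply: le_trans (lyap_dot_le _ _ SR) _; rewrite mulNr oppr_le0 mulr_ge0 ?sq_ge0 //.
exact: ltW.
Qed.

Definition global_solution Re w x :=
  SO3 (Re 0) /\ forall t, 0 <= t -> solves_at Re w x t.

Lemma global_SO3 Re w x t : global_solution Re w x -> 0 <= t -> SO3 (Re t).
Proof. by move=> [R0 S] t0; apply: (solves_SO3 t0 _ R0) => s /andP[s0 _]; exact: S. Qed.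

Lemma global_lyap_noninc Re w x a b : global_solution Re w x -> 0 <= a -> a <= b ->
  lyap Re w x b <= lyap Re w x a.
Proof. by move=> [R0 S] a0 ab; apply: lyap_noninc => // t /andP[t0 _]; exact: S. Qed.

Lemma state_vanishes Re w x : global_solution Re w x ->
  vanishes (fun t => sq (state Re w x t)).
Proof.
move=> G; have [R0 S] := G.
(* This bounds the derivative of |h|^2: 2 h . h' <= |h|^2 + |h'|^2 <= (2 + [rateK]) |h|^2, and |h|^2
   <= V(0) / lam. *)
pose K := (2 + rateK) * (lyap Re w x 0 / lam) + 1.
have K0 : 0 < K.
  rewrite ltr_wpDl // mulr_ge0 ?divr_ge0 ?lyap_ge0 ?(ltW lam_gt0) //.
  by rewrite addr_ge0 // rateK_ge0.
apply: (@barbalat R (lyap Re w x) _ (lyap_dot Re w x)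
  (fun t => 2 * \tr ((state Re w x t)^T *m state_dot Re w x t)) k K) => //.
- by move=> t /S; exact: der_lyap.
- by move=> t /S/der_state; exact: der_sq.
- by move=> t t0; apply: lyap_dot_le; exact: (global_SO3 G).
- move=> t t0; have := global_lyap_noninc G (lexx 0) t0.
  have -> : \tr ((state Re w x t)^T *m state_dot Re w x t) =
      dot (state Re w x t) (state_dot Re w x t).
    by rewrite /mxtrace big_ord1 dotE.
  have := lyap_ge Re w x t; have := sq_state_dot w x (global_SO3 G t0).
  have := dot_young (state Re w x t) (state_dot Re w x t) (@ltr01 R).
  have : 0 <= p11 * (1 - cosR (Re t)) ^+ 2 by rewrite mulr_ge0 ?sqr_ge0 ?(ltW p11_gt0).
  rewrite invr1 !mul1r => h1 h2 h3 h4 h5.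
  have h6 : sq (state Re w x t) <= lyap Re w x 0 / lam.
    by rewrite ler_pdivlMr // mulrC; lra.
  have := ler_wpM2l (_ : 0 <= 2 + rateK) h6.
  rewrite addr_ge0 ?rateK_ge0 // => /(_ erefl); rewrite /K; lra.
- by move=> t; exact: lyap_ge0.
- by move=> t; exact: sq_ge0.
Qed.

Lemma sdist_lt_sq (Q Q' : 'M[R]_3) (v v' : 'cV[R]_3) (y y' : 'cV[R]_n) d :
  0 < d -> sdist Q v y Q' v' y' < d ->
  [/\ sq (Q - Q') < d ^+ 2, sq (v - v') < d ^+ 2 & sq (y - y') < d ^+ 2].
Proof.
move=> d0; rewrite /sdist => H.
have := mnorm_ge0 (Q - Q'); have := mnorm_ge0 (v - v'); have := mnorm_ge0 (y - y').
by move=> h1 h2 h3; rewrite -!mnorm_lt //; split; lra.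
Qed.

Lemma sq_lt_sdist (Q Q' : 'M[R]_3) (v v' : 'cV[R]_3) (y y' : 'cV[R]_n) d : 0 < d ->
  sq (Q - Q') < (d / 3) ^+ 2 -> sq (v - v') < (d / 3) ^+ 2 -> sq (y - y') < (d / 3) ^+ 2 ->
  sdist Q v y Q' v' y' < d.
Proof.
move=> d0; have d3 : 0 < d / 3 by lra.
by rewrite -!mnorm_lt // /sdist; lra.
Qed.

Lemma lyapunov_stable (eps : R) : 0 < eps -> exists2 del, 0 < del &
  forall Re w x, global_solution Re w x -> sdist (Re 0) (w 0) (x 0) 1 0 0 < del ->
  forall t, 0 <= t -> sdist (Re t) (w t) (x t) 1 0 0 < eps.
Proof.
have p0 := p11_gt0; have lam0 := lam_gt0.
move=> e0; pose r := (eps / 3) ^+ 2; have r0 : 0 < r by rewrite exprn_gt0 // divr_gt0.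
(* V < eta gives 1 - c < r / 4, where |R - 1|^2 = 4 (1 - c), and bounds |omega|^2 and |x|^2 by
   [r]. *)
pose eta := Num.min (p11 * (r / 4) ^+ 2) (lam * r).
have eta0 : 0 < eta.
  by rewrite lt_min !mulr_gt0 // exprn_gt0 // divr_gt0.
(* At distance less than d <= 1 each of |e_R|^2, |omega|^2, |x|^2 and (1 - c)^2 is at most d^2,
   whence V(0) < K d^2 <= K d. *)
pose K := 3 * (1 + sq P) + p11.
have K0 : 0 < K by have := sq_ge0 P; rewrite /K; lra.
exists (Num.min 1 (eta / K)); first by rewrite lt_min ltr01 divr_gt0.
move=> Re w x G; set d := Num.min 1 _ => Hd t t0.
have d1 : d <= 1 by rewrite ge_min lexx.
have dK : d * K <= eta by rewrite -ler_pdivlMr // ge_min lexx orbT.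
have d0 : 0 < d by rewrite lt_min ltr01 divr_gt0.
have [R0 _] := G; have [hR hw hx] := sdist_lt_sq d0 Hd.
have V0 : lyap Re w x 0 < eta.
  have := lyap_le Re w x 0; rewrite sq_stack (sq_eR R0).
  rewrite (sq_sub1 R0) in hR; rewrite !subr0 in hw hx.
  have /andP[c1 c2] := cosR_itv R0; set c := cosR (Re 0) in hR c1 c2 *.
  have sP := sq_ge0 P; have dd : d ^+ 2 <= d by rewrite expr2 ler_piMl // ltW.
  have a1 : 1 - c ^+ 2 + sq (w 0) + sq (x 0) < 3 * d ^+ 2 by nra.
  have a2 : (1 - c) ^+ 2 <= d ^+ 2 by nra.
  have a3 : (1 + sq P) * (1 - c ^+ 2 + sq (w 0) + sq (x 0)) < (1 + sq P) * (3 * d ^+ 2).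
    by rewrite ltr_pM2l //; lra.
  have a4 : p11 * (1 - c) ^+ 2 <= p11 * d ^+ 2 by rewrite ler_pM2l.
  have a5 : K * d ^+ 2 <= K * d by rewrite ler_pM2l.
  by move: dK a5; rewrite /K; lra.
have Vt : lyap Re w x t < eta by apply: le_lt_trans V0; exact: global_lyap_noninc.
have := lyap_ge Re w x t; rewrite sq_stack.
have SR := global_SO3 G t0; have /andP[c1 c2] := cosR_itv SR.
have e1 : eta <= p11 * (r / 4) ^+ 2 by rewrite ge_min lexx.
have e2 : eta <= lam * r by rewrite ge_min lexx orbT.
have s1 := sq_ge0 (eR (Re t)); have s2 := sq_ge0 (w t); have s3 := sq_ge0 (x t).
have q0 : 0 <= p11 * (1 - cosR (Re t)) ^+ 2 by rewrite mulr_ge0 ?sqr_ge0 ?(ltW p11_gt0).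
have l0 : 0 <= lam * (sq (eR (Re t)) + sq (w t) + sq (x t)).
  by rewrite mulr_ge0 ?(ltW lam_gt0) // !addr_ge0.
move=> H; apply: sq_lt_sdist => //; rewrite -/r ?subr0.
- rewrite sq_sub1 //.
  have : (1 - cosR (Re t)) ^+ 2 < (r / 4) ^+ 2 by rewrite -(ltr_pM2l p11_gt0); lra.
  by rewrite ltr_pXn2r // ?nnegrE; lra.
- have : lam * (sq (eR (Re t)) + sq (w t) + sq (x t)) < lam * r by lra.
  by rewrite ltr_pM2l //; lra.
- have : lam * (sq (eR (Re t)) + sq (w t) + sq (x t)) < lam * r by lra.
  by rewrite ltr_pM2l //; lra.
Qed.

(** From (1 - c)^2 <= 4 (1 - eta) follows 1 + c >= eta, so eta (1 - c) <= 1 - c^2 = |e_R|^2, which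
    vanishes. *)
Lemma converges_of_lyap_lt Re w x t0 : global_solution Re w x -> 0 <= t0 ->
  lyap Re w x t0 < 4 * p11 ->
  vanishes (fun t => sdist (Re t) (w t) (x t) 1 0 0).
Proof.
have p0 := p11_gt0; have lam0 := lam_gt0.
move=> G t00 V0 eps e0; pose r := (eps / 3) ^+ 2.
have r0 : 0 < r by rewrite exprn_gt0 // divr_gt0.
pose eta := 1 - lyap Re w x t0 / (4 * p11).
have eta0 : 0 < eta by rewrite subr_gt0 ltr_pdivrMr ?mulr_gt0 // mul1r.
have [|T T0 HT] := state_vanishes G (_ : 0 < Num.min r (eta * r / 4)).
  by rewrite lt_min r0 divr_gt0 ?mulr_gt0.
exists (Num.max T t0); first by rewrite le_max T0.
move=> t; rewrite ge_max => /andP[Tt tt].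
have t_ge0 := le_trans T0 Tt.
have SR := global_SO3 G t_ge0; have /andP[c1 c2] := cosR_itv SR.
have /= := HT t Tt; rewrite lt_min sq_stack => /andP[h1 h2].
have s1 := sq_ge0 (eR (Re t)); have s2 := sq_ge0 (w t); have s3 := sq_ge0 (x t).
apply: sq_lt_sdist => //; rewrite -/r ?subr0; try lra.
rewrite sq_sub1 //.
have Vt := global_lyap_noninc G t00 tt; have := lyap_ge Re w x t.
have : 0 <= lam * sq (state Re w x t) by rewrite mulr_ge0 ?sq_ge0 ?(ltW lam_gt0).
have e4 : lyap Re w x t0 = 4 * p11 * (1 - eta) by rewrite /eta; field; lra.
rewrite e4 in Vt => l0 l1.
have {l0 l1 Vt} : p11 * (1 - cosR (Re t)) ^+ 2 <= p11 * (4 * (1 - eta)) by lra.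
rewrite ler_pM2l // => cc.
have ce : eta <= 1 + cosR (Re t) by nra.
have : eta * (1 - cosR (Re t)) <= sq (eR (Re t)) by rewrite (sq_eR SR); nra.
move=> h3; have : eta * (4 * (1 - cosR (Re t))) < eta * r by lra.
by rewrite ltr_pM2l.
Qed.

(** When h is small, V >= 4 p11 forces (1 - c)^2 to be nearly 4, its value at c = -1. *)
Lemma near_pi_of_lyap_ge Re w x (eps : R) : global_solution Re w x ->
  (forall t, 0 <= t -> 4 * p11 <= lyap Re w x t) -> 0 < eps ->
  exists2 T, 0 <= T & forall t, T <= t ->
    sq (state Re w x t) <= eps /\ 1 + cosR (Re t) <= eps.
Proof.
have p0 := p11_gt0; have lam0 := lam_gt0.
move=> G HV e0; pose K := 1 + sq P; have K0 : 0 < K by have := sq_ge0 P; rewrite /K; lra.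
have [|T T0 HT] := state_vanishes G (_ : 0 < Num.min eps (p11 * eps / K)).
  by rewrite lt_min e0 divr_gt0 ?mulr_gt0.
exists T => // t Tt; have t_ge0 := le_trans T0 Tt.
have /= := HT t Tt; rewrite lt_min ltr_pdivlMr // => /andP[h1 h2]; split; first exact: ltW.
have SR := global_SO3 G t_ge0; have /andP[c1 c2] := cosR_itv SR.
have := le_trans (HV t t_ge0) (lyap_le Re w x t); rewrite -/K => H.
have : p11 * 4 <= p11 * (eps + (1 - cosR (Re t)) ^+ 2) by lra.
rewrite ler_pM2l //; nra.
Qed.

Lemma attitude_limit Re w x (eps : R) : global_solution Re w x -> 0 < eps ->
  exists2 T, 0 <= T & forall t, T <= t ->
    exists Q, (Q = 1 \/ exists a, S2 a /\ Q = expso3 pi a) /\ mnorm (Re t - Q) < eps.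
Proof.
move=> G e0; have [|T T0 HT] := state_vanishes G (_ : 0 < eps ^+ 2 / 4).
  by rewrite divr_gt0 ?exprn_gt0.
exists T => // t Tt; have t_ge0 := le_trans T0 Tt.
have SR := global_SO3 G t_ge0; have /= := HT t Tt; rewrite sq_stack (sq_eR SR).
have s2 := sq_ge0 (w t); have s3 := sq_ge0 (x t).
have /andP[c1 c2] := cosR_itv SR => h.
(* The sign of c decides which of 1 - c and 1 + c is at most 1 - c^2 = |e_R|^2. In the second case
   the witness is the pi-rotation about the same axis. *)
have [c0|c0] := leP 0 (cosR (Re t)).
  exists 1; split; [by left|rewrite mnorm_lt // sq_sub1 //; nra].
have [a [c [s [a1 cs RE]]]] := rodrigues SR.
exists (expso3 pi a); split.
  right; exists a; split=> //.
  by rewrite /S2 /= -[RHS]a1 sq_dot; apply: eq_bigr => i _; rewrite expr2.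
rewrite mnorm_lt // expso3_rodr // cospi sinpi RE sq_sub_rodr //.
by move: h c0 c1; rewrite RE rodr_cosR //; nra.
Qed.

Definition coord : Type := ('I_3 * 'I_3 + ('I_3 + 'I_n))%type.
Definition att (u : coord -> R) : 'M[R]_3 := \matrix_(i, j) u (inl (i, j)).
Definition vel (u : coord -> R) : 'cV[R]_3 := \col_i u (inr (inl i)).
Definition aux (u : coord -> R) : 'cV[R]_n := \col_i u (inr (inr i)).

Definition field (u : coord -> R) (c : coord) : R :=
  match c with
  | inl p => (att u *m skew (vel u)) p.1 p.2
  | inr (inl i) => wdot (eR (att u)) (vel u) (aux u) i 0
  | inr (inr i) => xdot (eR (att u)) (vel u) (aux u) i 0
  end.

Lemma blip_field B (c : coord) : 0 <= B ->
  blip (fun u : coord -> R => field (fun i => clamp B (u i)) c).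
Proof.
move=> B0; have cb i := blip_clamp i B0.
have Qb : mblip (fun u : coord -> R => att (fun i => clamp B (u i))).
  by apply: (@mblip_ext _ _ _ _ _ (fun i j u => clamp B (u (inl (i, j))))) =>
    [u i j|i j //]; rewrite mxE.
have vb : mblip (fun u : coord -> R => vel (fun i => clamp B (u i))).
  by apply: (@mblip_ext _ _ _ _ _ (fun i j u => clamp B (u (inr (inl i))))) =>
    [u i j|i j //]; rewrite mxE.
have xb : mblip (fun u : coord -> R => aux (fun i => clamp B (u i))).
  by apply: (@mblip_ext _ _ _ _ _ (fun i j u => clamp B (u (inr (inr i))))) =>
    [u i j|i j //]; rewrite mxE.
have eb := mblip_eR Qb.
have lin m (X : 'M[R]_(m, n)) (Y Z : 'M[R]_(m, 3)) :
    mblip (fun u : coord -> R => let cu i := clamp B (u i) in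
      X *m aux cu + Y *m eR (att cu) + Z *m vel cu).
  by apply: mblipD; [apply: mblipD|]; apply: mblipM => //; exact: mblip_cst.
case: c => [p|[i|i]].
- exact: (mblipM Qb (mblip_skew vb) p.1 p.2).
- have H := mblipM (mblip_cst _ (invmx J)) (lin _ CK Dth Dom).
  exact: (H i 0).
- exact: (lin _ AK Bth Bom i 0).
Qed.

Lemma SO3_entry_le1 (Q : 'M[R]_3) i j : SO3 Q -> `|Q i j| <= 1.
Proof.
case=> QQ _; rewrite -(@expr_le1 _ 2) // real_normK ?num_real //.
have <- : \sum_l Q l j ^+ 2 = 1.
  have := congr1 (fun M : 'M[R]_3 => M j j) QQ; rewrite !mxE eqxx mulr1n => <-.
  by apply: eq_bigr => l _; rewrite mxE expr2.
by rewrite (bigD1 i) //= lerDl sumr_ge0 // => l _; rewrite sqr_ge0.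
Qed.

(* The field is clamped outside a box which the Lyapunov bound prevents solutions from leaving. *)
Lemma exists_solution (Q : 'M[R]_3) (v : 'cV[R]_3) (z : 'cV[R]_n) : SO3 Q ->
  exists Re w x, [/\ global_solution Re w x, Re 0 = Q, w 0 = v & x 0 = z].
Proof.
have p0 := p11_gt0; have lam0 := lam_gt0.
move=> SQ; pose y0 (c : coord) : R :=
  match c with inl p => Q p.1 p.2 | inr (inl i) => v i 0 | inr (inr i) => z i 0 end.
pose V0 := lyap (fun=> Q) (fun=> v) (fun=> z) 0.
(* While V <= V0 the rotation entries are at most 1 and the squares of the other coordinates at most
   V0 / lam, so B - 1 bounds them all, with a margin of 1. *)
pose B := 2 + V0 / lam.
have V00 : 0 <= V0 / lam by rewrite divr_ge0 ?lyap_ge0 // ltW.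
have B0 : 0 <= B by rewrite /B; lra.
have [M [K [M0 K0 fM fK]]] :=
  @blip_uniform R coord (fun u => field (fun i => clamp B (u i))) (fun c => blip_field c B0).
have [y [yi yd]] := @picard_lindelof R coord _ M K y0 M0 K0 fM fK.
pose Re t := att (y t); pose w t := vel (y t); pose x t := aux (y t).
have Re0 : Re 0 = Q by apply/matrixP => i j; rewrite mxE yi.
have w0 : w 0 = v by apply/matrixP => i j; rewrite mxE yi (ord1 j).
have x0 : x 0 = z by apply/matrixP => i j; rewrite mxE yi (ord1 j).
have solves t : 0 <= t -> (forall c, `|y t c| <= B) -> solves_at Re w x t.
  move=> t0 yB; have cy : (fun i => clamp B (y t i)) = y t.
    by apply/funext => i; rewrite clamp_id.
  have := yd t t0; rewrite cy => D; split=> i j; rewrite ?(ord1 j).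
  - by apply: (is_derive_ext _ _ (D (inl (i, j)))) => // s; rewrite mxE.
  - by apply: (is_derive_ext _ _ (D (inr (inl i)))) => // s; rewrite mxE.
  - by apply: (is_derive_ext _ _ (D (inr (inr i)))) => // s; rewrite mxE.
have bound t : 0 <= t -> SO3 (Re t) -> lyap Re w x t <= V0 -> forall c, `|y t c| <= B - 1.
  move=> t0 SR Vt; have := lyap_ge Re w x t.
  have : 0 <= p11 * (1 - cosR (Re t)) ^+ 2 by rewrite mulr_ge0 ?sqr_ge0 ?(ltW p11_gt0).
  move=> h1 h2; have : sq (state Re w x t) <= V0 / lam by rewrite ler_pdivlMr // mulrC; lra.
  rewrite sq_stack => h3; have s1 := sq_ge0 (eR (Re t)).
  have s2 := sq_ge0 (w t); have s3 := sq_ge0 (x t).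
  have le1 (a : R) : a ^+ 2 <= V0 / lam -> `|a| <= B - 1.
    by move=> ha; rewrite ler_norml /B; apply/andP; split; nra.
  case=> [[i j]|[i|i]].
  - apply: (@le_trans _ _ 1); last by rewrite /B; lra.
    by have := SO3_entry_le1 i j SR; rewrite mxE.
  - by apply: le1; have := sq_entry (w t) i 0; rewrite mxE; lra.
  - by apply: le1; have := sq_entry (x t) i 0; rewrite mxE; lra.
have ylip (s t : R) c : 0 <= s -> s <= t -> `|y t c - y s c| <= M * (t - s).
  move=> s0 st; have [|r _ ->] := @der_mvt R (fun r => y r c)
    (fun r => field (fun i => clamp B (y r i)) c) s t st.
    by move=> r /andP[sr _]; exact: yd (le_trans s0 sr) c.
  by rewrite normrM (@ger0_norm _ (t - s)) ?subr_ge0 // ler_wpM2r ?fM // subr_ge0.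
have Veq : lyap Re w x 0 = V0 by rewrite /V0 /lyap /state Re0 w0 x0.
have SR0 : SO3 (Re 0) by rewrite Re0.
(* The speed is at most [M], so within time [d] a coordinate moves by at most 1 and the clamp stays
   inactive; the Lyapunov bound then restores the radius B - 1 for the next step. *)
pose d := (M + 1)^-1; have d0 : 0 < d by rewrite invr_gt0; lra.
have Md : M * d <= 1 by rewrite ler_pdivrMr; lra.
have stay (m : nat) t : 0 <= t -> t <= m%:R * d -> forall c, `|y t c| <= B - 1.
  elim: m t => [|m IH] t t0.
    rewrite mul0r => t0'; have -> : t = 0 by lra.
    by apply: bound => //; rewrite Veq.
  move=> tm; have inB s : 0 <= s <= t -> solves_at Re w x s.
    move=> /andP[s0 st]; apply: solves => // c.
    have [sm|ms] := leP s (m%:R * d); first by apply: le_trans (IH s s0 sm c) _; lra.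
    have r0 : 0 <= m%:R * d by rewrite mulr_ge0 // ltW.
    have h1 := IH _ r0 (lexx _) c; have h2 := ylip _ _ c r0 (ltW ms).
    have h3 : M * (s - m%:R * d) <= M * d.
      by rewrite ler_wpM2l //; move: tm; rewrite -[m.+1%:R]natr1; lra.
    by have := ler_normD (y s c - y (m%:R * d) c) (y (m%:R * d) c); rewrite subrK; lra.
  apply: bound => //; first exact: solves_SO3 t0 inB SR0.
  by rewrite -Veq; exact: lyap_noninc.
exists Re, w, x; split=> //; split=> // t t0; apply: solves => // c.
apply: (@le_trans _ _ (B - 1)); last by lra.
apply: (stay (Num.truncn (t / d)).+1) => //.
by rewrite -ler_pdivrMr // ltW // truncnS_gt.
Qed.

Hypothesis Pee : forall e : 'cV[R]_3,
  dot (stack e 0 (0 : 'cV[R]_n)) (P *m stack e 0 0) = p11 * sq e.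

(** A rotation at rest about the same axis, at an angle near pi, has V = 2 p11 (1 - c) < 4 p11, so
    its solution tends to the identity. Stability would keep it within 1 of the pi-rotation, whose
    squared distance to the identity is 8 > 2 + 2. *)
Lemma pi_rotation_unstable (a : 'cV[R]_3) :
  sq a = 1 ->
  ~ (forall eps : R, 0 < eps -> exists del : R, 0 < del /\
    forall Re w x, global_solution Re w x ->
      sdist (Re 0) (w 0) (x 0) (expso3 pi a) 0 0 < del ->
      forall t, 0 <= t -> sdist (Re t) (w t) (x t) (expso3 pi a) 0 0 < eps).
Proof.
have p0 := p11_gt0; have lam0 := lam_gt0.
move=> a1 H; have [del [d0 {}H]] := H 1 ltr01.
rewrite expso3_rodr // cospi sinpi in H.
(* The rational parametrisation of the circle avoids trigonometry. The squared distance to the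
   pi-rotation is at most 8 m^2, below (del / 3)^2 = 16 m^2. *)
pose m := del / 12; have m0 : 0 < m by rewrite divr_gt0.
have n0 : 0 < 1 + m ^+ 2 by rewrite addr_gt0 ?exprn_gt0.
have n1 : 1 + m ^+ 2 != 0 by rewrite gt_eqF.
pose c := - (1 - m ^+ 2) / (1 + m ^+ 2); pose s := 2 * m / (1 + m ^+ 2).
have cs : c ^+ 2 + s ^+ 2 = 1 by rewrite /c /s; field.
have c1 : 1 + c = 2 * m ^+ 2 / (1 + m ^+ 2) by rewrite /c; field.
have c1_gt0 : 0 < 1 + c by rewrite c1 divr_gt0 // mulr_gt0 ?exprn_gt0.
have [Re [w [x [G R0 w0 x0]]]] := exists_solution 0 0 (SO3_rodr a1 cs).
have [_ S] := G.
have close t : 0 <= t -> sdist (Re t) (w t) (x t) (rodr a (-1) 0) 0 0 < 1.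
  apply: (H _ _ _ G); rewrite R0 w0 x0; apply: sq_lt_sdist => //; last 2 first.
  - by rewrite subrr sq0 exprn_gt0 // divr_gt0.
  - by rewrite subrr sq0 exprn_gt0 // divr_gt0.
  rewrite sq_sub_rodr // c1; apply: (@le_lt_trans _ _ (8 * m ^+ 2)).
    rewrite mulrA ler_pdivrMr //; have := sqr_ge0 m; nra.
  rewrite (_ : (del / 3) ^+ 2 = 16 * m ^+ 2); last by rewrite /m; field.
  by rewrite ltr_pM2r ?exprn_gt0 //; lra.
have V0 : lyap Re w x 0 < 4 * p11.
  rewrite /lyap /state R0 w0 x0 eR_rodr Pee rodr_cosR // sqZ a1.
  have -> : p11 * (s ^+ 2 * 1) + p11 * (1 - c) ^+ 2 = p11 * (2 * (1 - c)).
    by ring: (circleE cs).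
  by rewrite mulrC ltr_pM2r //; lra.
have [T T0 HT] := converges_of_lyap_lt G (lexx 0) V0 ltr01.
have [h1 _ _] := sdist_lt_sq ltr01 (HT T (lexx T)).
have [h2 _ _] := sdist_lt_sq ltr01 (close T T0).
have : sq (rodr a (-1) 0 - 1) = 8.
  have cs' : (-1) ^+ 2 + 0 ^+ 2 = 1 :> R by ring.
  by rewrite sq_sub1 ?rodr_cosR //; [ring|exact: SO3_rodr].
have -> : rodr a (-1) 0 - 1 = (Re T - 1) + - (Re T - rodr a (-1) 0).
  by apply/matrixP => i j; rewrite !mxBE; ring.
have := sqD_le (Re T - 1) (- (Re T - rodr a (-1) 0)); rewrite sqN.
by move: h1 h2; rewrite expr1n; lra.
Qed.

End ClosedLoop.

(** * Pairs of trapped trajectories *)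

Section Trapped.
Variables (R : realType) (n : nat) (J : 'M[R]_3) (AK : 'M[R]_n)
  (Bth Bom : 'M[R]_(n, 3)) (CK : 'M[R]_(3, n)) (Dth Dom : 'M[R]_3).
Implicit Types (Re : R -> 'M[R]_3) (w : R -> 'cV[R]_3) (x : R -> 'cV[R]_n) (t : R).

Local Notation wdot := (wdot J CK Dth Dom).
Local Notation xdot := (xdot AK Bth Bom).
Local Notation solves_at := (solves_at J AK Bth Bom CK Dth Dom).
Local Notation state_dot := (state_dot J AK Bth Bom CK Dth Dom).
Local Notation global_solution := (global_solution J AK Bth Bom CK Dth Dom).
Local Notation rateK := (rateK J AK Bth Bom CK Dth Dom).

Variables (P : 'M[R]_(3 + (3 + n))) (p11 lam k : R).
Hypotheses (Psym : P^T = P) (p11_gt0 : 0 < p11)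
  (lam_gt0 : 0 < lam) (k_gt0 : 0 < k)
  (Pcoer : forall h, lam * sq h <= dot h (P *m h))
  (rate : forall (e w de : 'cV[R]_3) (x : 'cV[R]_n), sq de <= sq w ->
    2 * dot (stack e w x) (P *m stack de (wdot e w x) (xdot e w x))
      - 2 * p11 * dot e de + 2 * p11 * dot e w <= - k * sq (stack e w x))
  (Pee : forall e : 'cV[R]_3,
    dot (stack e 0 (0 : 'cV[R]_n)) (P *m stack e 0 0) = p11 * sq e).

Definition near_pi (eps : R) Re w x t : Prop :=
  sq (state Re w x t) <= eps /\ 1 + cosR (Re t) <= eps.

(** The e-block of [P] is p11 times the identity and Young's inequality adds p11 / 2 for the cross
    terms. A coefficient below 2 p11 is what matters: [cone] subtracts 2 p11 |e|^2. *)
Lemma quad_upper : exists2 C, 0 <= C & forall (e v : 'cV[R]_3) (z : 'cV[R]_n),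
  dot (stack e v z) (P *m stack e v z) <= 3 / 2 * p11 * sq e + C * (sq v + sq z).
Proof.
have p0 := p11_gt0; have sP := sq_ge0 P.
pose eta := p11 / (2 * (1 + sq P)).
have eta0 : 0 < eta by rewrite divr_gt0 // mulr_gt0 //; lra.
exists (eta^-1 + (1 + sq P)); first by rewrite addr_ge0 ?invr_ge0 ?(ltW eta0) //; lra.
move=> e v z; have -> : stack e v z = stack e 0 0 + stack 0 v z.
  by rewrite /stack !add_col_mx addr0 !add0r.
set h1 := stack e 0 0; set h2 := stack 0 v z.
rewrite mulmxDr dotDl !dotDr Pee (dot_mulr P h1 h2) Psym (dotC h2 (P *m h1)).
have y := dot_young (P *m h1) h2 eta0.
have m := sq_mulmx P h1; have b := dot_mul_le P h2.
have s1 : sq h1 = sq e by rewrite sq_stack !sq0 !addr0.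
have s2 : sq h2 = sq v + sq z by rewrite sq_stack sq0 add0r.
rewrite s1 in m; rewrite s2 in y b.
have E : eta * sq P * sq e <= p11 / 2 * sq e.
  rewrite ler_wpM2r ?sq_ge0 // /eta mulrAC ler_pdivrMr; last by rewrite mulr_gt0 //; lra.
  have : p11 * sq P <= p11 * (1 + sq P) by rewrite ler_pM2l //; lra.
  lra.
have : eta * sq (P *m h1) <= eta * (sq P * sq e) by rewrite ler_pM2l.
lra.
Qed.

Section Pair.
Variables (Q1 Q2 : R -> 'M[R]_3) (w1 w2 : R -> 'cV[R]_3) (x1 x2 : R -> 'cV[R]_n).

Definition gap t := state Q1 w1 x1 t - state Q2 w2 x2 t.
Definition gap_dot t := state_dot Q1 w1 x1 t - state_dot Q2 w2 x2 t.

(* For [mu = 0], the second variation of [lyap] at the pi-rotations, where 2 p11 Psi is to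
   second order 4 p11 - p11 |e_R|^2, evaluated at the difference of two trajectories. *)
Definition cone (mu : R) t : R :=
  dot (gap t) (P *m gap t) - 2 * p11 * sq (eR (Q1 t) - eR (Q2 t)) + mu * sq (Q1 t - Q2 t).

Definition cone_dot (mu : R) t : R :=
  2 * dot (gap t) (P *m gap_dot t)
  - 4 * p11 * dot (eR (Q1 t) - eR (Q2 t)) (Emx (Q1 t) *m w1 t - Emx (Q2 t) *m w2 t)
  + mu * (2 * \tr ((Q1 t - Q2 t)^T *m (Q1 t *m skew (w1 t) - Q2 t *m skew (w2 t)))).

Lemma gapE t : gap t = stack (eR (Q1 t) - eR (Q2 t)) (w1 t - w2 t) (x1 t - x2 t).
Proof. exact: stackB. Qed.

Lemma der_cone mu t : solves_at Q1 w1 x1 t -> solves_at Q2 w2 x2 t ->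
  is_derive t (1 : R) (cone mu) (cone_dot mu t).
Proof.
move=> S1 S2; have [R1 _ _] := S1; have [R2 _ _] := S2.
have hd := mderB (der_state S1) (der_state S2).
have ed := mderB (der_eR R1) (der_eR R2).
have H := derD (derB (der_quad Psym hd) (derZ (2 * p11) (der_dot ed ed)))
  (derZ mu (der_sq (mderB R1 R2))).
apply: (is_derive_ext _ _ H) => [s|]; first by rewrite /cone sq_dot.
rewrite !eR_skew (dotC (_ - _ *m _)) /cone_dot /gap /gap_dot; lra.
Qed.

(** The first summand has the form to which [rate] applies; the second, due to the change of
    Jacobian, is of order |Q1 - Q2| |w2|. *)
Lemma gap_dotE t : gap_dot t =
  stack (Emx (Q1 t) *m (w1 t - w2 t))
    (wdot (eR (Q1 t) - eR (Q2 t)) (w1 t - w2 t) (x1 t - x2 t))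
    (xdot (eR (Q1 t) - eR (Q2 t)) (w1 t - w2 t) (x1 t - x2 t))
  + stack ((Emx (Q1 t) - Emx (Q2 t)) *m w2 t) 0 0.
Proof.
rewrite /gap_dot stackB wdotB xdotB /stack !add_col_mx !addr0; congr (col_mx _ _).
by rewrite mulmxBr mulmxBl addrA subrK.
Qed.

Lemma cone_dot_le mu th eta eps t : 0 < mu -> 0 < th -> 0 < eta -> eps <= 1 ->
  SO3 (Q1 t) -> SO3 (Q2 t) -> near_pi eps Q1 w1 x1 t -> near_pi eps Q2 w2 x2 t ->
  cone_dot mu t <= (- k + 3 * th + 2 * mu / eta) * sq (gap t)
    + (mu * eta + eps * (18 * p11 ^+ 2 + 5 * (sq P + 4 * p11 ^+ 2)) / th) * sq (Q1 t - Q2 t).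
Proof.
move=> mu0 th0 eta0 e1 S1 S2 [n1 c1] [n2 c2]; have p0 := p11_gt0.
have gP : dot (gap t) (P *m gap_dot t) =
    dot (gap t) (P *m stack (Emx (Q1 t) *m (w1 t - w2 t))
      (wdot (eR (Q1 t) - eR (Q2 t)) (w1 t - w2 t) (x1 t - x2 t))
      (xdot (eR (Q1 t) - eR (Q2 t)) (w1 t - w2 t) (x1 t - x2 t)))
    + dot (gap t) (P *m stack ((Emx (Q1 t) - Emx (Q2 t)) *m w2 t) 0 0).
  by rewrite gap_dotE mulmxDr dotDr.
rewrite /cone_dot gP.
set de := eR (Q1 t) - eR (Q2 t); set dw := w1 t - w2 t; set dx := x1 t - x2 t.
set de0 := Emx (Q1 t) *m dw; set a := (Emx (Q1 t) - Emx (Q2 t)) *m w2 t.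
have -> : Emx (Q1 t) *m w1 t - Emx (Q2 t) *m w2 t = de0 + a.
  by rewrite /de0 /a mulmxBr mulmxBl addrA subrK.
have h1 := rate de dx (sq_Emx dw S1).
rewrite -/de0 -gapE in h1.
have s_e1 : sq (eR (Q1 t)) <= eps.
  by move: n1; rewrite sq_stack; have := sq_ge0 (w1 t); have := sq_ge0 (x1 t); lra.
have [s_e2 s_w2] : sq (eR (Q2 t)) <= eps /\ sq (w2 t) <= eps.
  move: n2; rewrite sq_stack; have := sq_ge0 (eR (Q2 t)).
  by have := sq_ge0 (w2 t); have := sq_ge0 (x2 t); split; lra.
(* After [rate] the remainder is -2 p11 (de . de0 + de . dw) = -2 p11 b . dw, up to the terms in [a]
   and [mu], and [b] is small near the pi-rotations. *)
pose b := (Emx (Q1 t))^T *m de + de.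
have hb : sq b <= 18 * eps * sq (Q1 t - Q2 t) by exact: Emx_add1_diff.
have Eb : dot de de0 + dot de dw = dot b dw.
  have eb m (A : 'M[R]_m) u v : dot u (A *m v) + dot u v = dot (A^T *m u + u) v.
    by rewrite dotDl dot_mulr.
  exact: eb.
have ha : sq a <= 5 * eps * sq (Q1 t - Q2 t).
  apply: le_trans (sq_mulmx _ _) _; rewrite EmxB mulrAC.
  by apply: ler_pM; rewrite ?sq_ge0 // sq_Emx_le.
have sg : sq (gap t) = sq de + sq dw + sq dx by rewrite gapE sq_stack.
have g0 := sq_ge0 de; have g1 := sq_ge0 dw; have g2 := sq_ge0 dx.
have sa : sq (stack a 0 (0 : 'cV[R]_n)) = sq a by rewrite sq_stack !sq0 !addr0.
have y1 : - (2 * p11 * dot b dw) <= th * sq dw + p11 ^+ 2 / th * sq b.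
  have := dot_young dw (- p11 *: b) th0; rewrite dotZr sqZ sqrrN (dotC dw); lra.
have y2 : 2 * dot (gap t) (P *m stack a 0 0) <= th * sq (gap t) + sq P / th * sq a.
  apply: le_trans (dot_young _ _ th0) _; rewrite lerD2l mulrAC mulrC.
  rewrite ler_pM2r ?invr_gt0 //; have := sq_mulmx P (stack a 0 (0 : 'cV[R]_n)).
  by rewrite sa.
have y3 : - (4 * p11 * dot de a) <= th * sq de + 4 * p11 ^+ 2 / th * sq a.
  have := dot_young de (- (2 * p11) *: a) th0; rewrite dotZr sqZ sqrrN exprMn; lra.
have y4 : mu * (2 * \tr ((Q1 t - Q2 t)^T *m (Q1 t *m skew (w1 t) - Q2 t *m skew (w2 t))))
    <= mu * eta * sq (Q1 t - Q2 t) + 2 * mu / eta * sq (gap t).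
  have := rotation_diff_rate (Q2 t) (w1 t) (w2 t) S1 eta0; rewrite ler_norml => /andP[_ h].
  have := ler_wpM2l (ltW mu0) h.
  have : mu * (eta^-1 * sq dw) <= mu * (eta^-1 * sq (gap t)).
    by rewrite !ler_pM2l ?invr_gt0 // sg; lra.
  by rewrite -/dw; lra.
have ka : (sq P + 4 * p11 ^+ 2) / th * sq a
    <= (sq P + 4 * p11 ^+ 2) / th * (5 * eps * sq (Q1 t - Q2 t)).
  by rewrite ler_wpM2l // divr_ge0 ?(ltW th0) // addr_ge0 ?sq_ge0 // mulr_ge0 ?sqr_ge0.
have kb : p11 ^+ 2 / th * sq b <= p11 ^+ 2 / th * (18 * eps * sq (Q1 t - Q2 t)).
  by rewrite ler_wpM2l // divr_ge0 ?(ltW th0) // sqr_ge0.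
have t1 : th * sq dw <= th * sq (gap t) by rewrite ler_pM2l // sg; lra.
have t2 : th * sq de <= th * sq (gap t) by rewrite ler_pM2l // sg; lra.
have := congr1 ( *%R p11) Eb; rewrite (dotDr de de0 a); lra.
Qed.

End Pair.

(* A pair with negative [cone] would separate exponentially, but [cone] is bounded below. *)
Lemma cone_nonneg (mu0 : R) : 0 < mu0 -> exists mu eps,
  [/\ 0 < mu, mu <= mu0, 0 < eps, eps <= 2^-1 &
   forall Q1 w1 x1 Q2 w2 x2 t0, global_solution Q1 w1 x1 -> global_solution Q2 w2 x2 ->
     0 <= t0 -> (forall t, t0 <= t -> near_pi eps Q1 w1 x1 t) ->
     (forall t, t0 <= t -> near_pi eps Q2 w2 x2 t) ->
     0 <= cone Q1 Q2 w1 w2 x1 x2 mu t0].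
Proof.
move=> mu0_gt0; have p0 := p11_gt0; have kp := k_gt0; have lp := lam_gt0.
(* Half of the rate [k] survives, since 3 th = k / 4 and 2 mu / eta <= k / 4. In the coefficient of
   |Q1 - Q2|^2, [mu * eta] is half of [kap * mu] and [eps] keeps the rest within the other half. As
   2 p11 kap = k / 2, the lower bound [Flow] then gives F' <= kap F. *)
pose kap := k / (4 * p11); have kap0 : 0 < kap by rewrite divr_gt0 // mulr_gt0.
have kapE : kap * (2 * p11) = k / 2 by rewrite /kap; field; lra.
pose th := k / 12; have th0 : 0 < th by rewrite divr_gt0.
pose eta := kap / 2; have eta0 : 0 < eta by rewrite divr_gt0.
pose mu := Num.min mu0 (k * eta / 8).
have mu_gt0 : 0 < mu by rewrite lt_min mu0_gt0 divr_gt0 // mulr_gt0.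
have mu_le : 2 * mu / eta <= k / 4.
  have : mu <= k * eta / 8 by rewrite ge_min lexx orbT.
  by rewrite ler_pdivrMr //; lra.
pose C := 18 * p11 ^+ 2 + 5 * (sq P + 4 * p11 ^+ 2).
have C0 : 0 < C.
  by have := sq_ge0 P; have : 0 < p11 ^+ 2 by [rewrite exprn_gt0|]; rewrite /C; lra.
pose eps := Num.min 2^-1 (mu * eta * th / C).
have eps0 : 0 < eps.
  by rewrite lt_min invr_gt0 ltr0n /=; apply: divr_gt0 => //; do 2 apply: mulr_gt0 => //.
have eps_h : eps <= 2^-1 by rewrite ge_min lexx.
have eps_C : eps * C / th <= mu * eta.
  by rewrite ler_pdivrMr // -ler_pdivlMr // ge_min lexx orbT.
exists mu, eps; split=> //; first by rewrite ge_min lexx.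
move=> Q1 w1 x1 Q2 w2 x2 t0 G1 G2 t00 N1 N2.
have [R1 S1] := G1; have [R2 S2] := G2.
pose F := cone Q1 Q2 w1 w2 x1 x2 mu.
have Flow t : - (2 * p11) * sq (eR (Q1 t) - eR (Q2 t)) + mu * sq (Q1 t - Q2 t) <= F t.
  have := Pcoer (gap Q1 Q2 w1 w2 x1 x2 t).
  have := mulr_ge0 (ltW lp) (sq_ge0 (gap Q1 Q2 w1 w2 x1 x2 t)).
  by rewrite /F /cone; lra.
have Fexp t : t0 <= t -> F t <= F t0 * expR (kap * (t - t0)).
  move=> tt; apply: (gronwall tt (dg := cone_dot Q1 Q2 w1 w2 x1 x2 mu)) => s /andP[ts _].
    by apply: der_cone; [apply: S1|apply: S2]; exact: le_trans ts.
  have s0 := le_trans t00 ts.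
  have := cone_dot_le mu_gt0 th0 eta0 (_ : eps <= 1) (global_SO3 G1 s0) (global_SO3 G2 s0)
    (N1 s ts) (N2 s ts).
  have e1 : eps <= 1 by lra.
  rewrite -/C => /(_ e1) h.
  have q0 := sq_ge0 (Q1 s - Q2 s); have g0 := sq_ge0 (gap Q1 Q2 w1 w2 x1 x2 s).
  have ge : sq (eR (Q1 s) - eR (Q2 s)) <= sq (gap Q1 Q2 w1 w2 x1 x2 s).
    rewrite gapE sq_stack; have := sq_ge0 (w1 s - w2 s); have := sq_ge0 (x1 s - x2 s); lra.
  have h1 : (- k + 3 * th + 2 * mu / eta) * sq (gap Q1 Q2 w1 w2 x1 x2 s)
      <= - (k / 2) * sq (gap Q1 Q2 w1 w2 x1 x2 s).
    by rewrite ler_wpM2r // /th; lra.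
  have h2 : (mu * eta + eps * C / th) * sq (Q1 s - Q2 s) <= kap * mu * sq (Q1 s - Q2 s).
    by rewrite ler_wpM2r //; move: eps_C; rewrite /eta; lra.
  have h3 := ler_wpM2l (ltW kap0) (Flow s).
  have h4 : k / 2 * sq (eR (Q1 s) - eR (Q2 s)) <= k / 2 * sq (gap Q1 Q2 w1 w2 x1 x2 s).
    by rewrite ler_pM2l // divr_gt0.
  rewrite -kapE in h1 h4; move: h3; rewrite -/(F s) => h3; lra.
rewrite leNgt; apply/negP => F0.
have Fn0 : 0 < - F t0 by rewrite oppr_gt0.
(* F >= -8 p11 since each |e_R| <= 1. After this time, expR x >= 1 + x already puts F below that
   bound. *)
have s0 : 0 <= 8 * p11 / (- F t0 * kap).
  by apply: divr_ge0; [lra|apply: mulr_ge0; exact: ltW].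
have sF : - (8 * p11) <= F (t0 + 8 * p11 / (- F t0 * kap)) .
  set t := t0 + _; have t_ge : 0 <= t by exact: addr_ge0.
  have := Flow t; have := sqD_le (eR (Q1 t)) (- eR (Q2 t)); rewrite sqN.
  have := mulr_ge0 (ltW mu_gt0) (sq_ge0 (Q1 t - Q2 t)).
  have := sq_eR (global_SO3 G1 t_ge); have := sq_eR (global_SO3 G2 t_ge).
  have := sqr_ge0 (cosR (Q1 t)); have := sqr_ge0 (cosR (Q2 t)) => a1 a2 a3 a4 a5 a6 a7.
  have : 2 * p11 * sq (eR (Q1 t) - eR (Q2 t)) <= 2 * p11 * 4 by rewrite ler_pM2l ?mulr_gt0 //; lra.
  lra.
have := Fexp (t0 + 8 * p11 / (- F t0 * kap)) (_ : t0 <= _).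
rewrite lerDl => /(_ s0); rewrite addrAC subrr add0r => h.
have e1 := expR_ge1Dx (kap * (8 * p11 / (- F t0 * kap))).
have E : - F t0 * (kap * (8 * p11 / (- F t0 * kap))) = 8 * p11.
  have n1 : F t0 != 0 by rewrite lt_eqF.
  have n2 : kap != 0 by rewrite gt_eqF.
  by field; rewrite n1 n2.
have : - F t0 * (1 + kap * (8 * p11 / (- F t0 * kap))) <=
   - F t0 * expR (kap * (8 * p11 / (- F t0 * kap))) by rewrite ler_pM2l.
rewrite mulrDr E; lra.
Qed.

(* So one coordinate of a trapped state is a Lipschitz function of the others. *)
Lemma trapped_pair_close : exists eps L, [/\ 0 < eps, 0 <= L &
  forall Q1 w1 x1 Q2 w2 x2 t0, global_solution Q1 w1 x1 -> global_solution Q2 w2 x2 ->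
    0 <= t0 -> (forall t, t0 <= t -> near_pi eps Q1 w1 x1 t) ->
    (forall t, t0 <= t -> near_pi eps Q2 w2 x2 t) ->
  forall (j : 'I_3) (a1 a2 : 'cV[R]_3) c1 s1 c2 s2,
    Q1 t0 = rodr a1 c1 s1 -> Q2 t0 = rodr a2 c2 s2 -> sq a1 = 1 -> sq a2 = 1 ->
    c1 ^+ 2 + s1 ^+ 2 = 1 -> c2 ^+ 2 + s2 ^+ 2 = 1 -> dominant j a1 -> dominant j a2 ->
    sq (Q1 t0 - Q2 t0) + sq (w1 t0 - w2 t0) + sq (x1 t0 - x2 t0) <=
    L * (sq (others j a1 - others j a2) + sq (w1 t0 - w2 t0) + sq (x1 t0 - x2 t0))].
Proof.
have p0 := p11_gt0; have [C C0 HC] := quad_upper.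
have [K K0 HK] := rodr_close R.
have [|mu [eps [mu0 mu_le eps0 eps_h H]]] := @cone_nonneg (p11 / (4 * K)).
  by rewrite divr_gt0 // mulr_gt0.
have Cp : 0 <= K * C / p11 by rewrite divr_ge0 ?(ltW p0) // mulr_ge0 // ltW.
exists eps, (1 + 2 * K + 4 * (K * C / p11)); split; first by [].
  by lra.
move=> Q1 w1 x1 Q2 w2 x2 t0 G1 G2 t00 N1 N2 j a1 a2 c1 s1 c2 s2 E1 E2 A1 A2 cs1 cs2 d1 d2.
have := H _ _ _ _ _ _ _ G1 G2 t00 N1 N2; rewrite /cone gapE => h.
have := HC (eR (Q1 t0) - eR (Q2 t0)) (w1 t0 - w2 t0) (x1 t0 - x2 t0) => h'.
have [_ n1] := N1 t0 (lexx _); have [_ n2] := N2 t0 (lexx _).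
rewrite E1 rodr_cosR // in n1; rewrite E2 rodr_cosR // in n2.
have := HK j a1 a2 c1 s1 c2 s2 A1 A2 cs1 cs2.
rewrite -{1}E1 -{1}E2 => /(_ _ _ d1 d2)/wrap[]; [lra|lra|].
have -> : s1 *: a1 - s2 *: a2 = eR (Q1 t0) - eR (Q2 t0) by rewrite E1 E2 !eR_rodr.
move: h h'; set e := sq (eR _ - _); set q := sq (Q1 t0 - _); set S := sq (others j a1 - _).
set y := sq (w1 t0 - _); set z := sq (x1 t0 - _) => h h' hq.
have q0 : 0 <= q by exact: sq_ge0.
have S0 : 0 <= S by exact: sq_ge0.
have y0 : 0 <= y by exact: sq_ge0.
have z0 : 0 <= z by exact: sq_ge0.
have mq : mu * q <= p11 / (4 * K) * q by rewrite ler_wpM2r.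
(* Nonnegativity of [cone] and [quad_upper] leave p11 e / 2 <= C (y + z) + mu q. The choice mu <=
   p11 / (4 K) makes the multiple of [q] equal to 1/2, which is absorbed into the left side of
   [hq]. *)
have Ke : K * e <= q / 2 + 2 * (K * C / p11) * (y + z).
  have KP : 0 < K / p11 by rewrite divr_gt0.
  have : K / p11 * (p11 * e) <= K / p11 * (p11 / (2 * K) * q + 2 * C * (y + z)).
    rewrite ler_pM2l // (_ : p11 / (2 * K) = 2 * (p11 / (4 * K))); first by lra.
    by field; lra.
  rewrite (_ : K / p11 * (p11 * e) = K * e); last by field; lra.
  rewrite (_ : K / p11 * _ = q / 2 + 2 * (K * C / p11) * (y + z)) //.
  by field; rewrite !gt_eqF.
have CS : 0 <= K * C / p11 * S by rewrite mulr_ge0.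
have KS : 0 <= K * S by rewrite mulr_ge0 // ltW.
have Ky : 0 <= K * (y + z) by rewrite mulr_ge0 ?addr_ge0 // ltW.
lra.
Qed.

Lemma backward_close Q1 w1 x1 Q2 w2 x2 T : global_solution Q1 w1 x1 ->
  global_solution Q2 w2 x2 -> 0 <= T ->
  sq (Q1 0 - Q2 0) + sq (w1 0 - w2 0) + sq (x1 0 - x2 0) <=
  (sq (Q1 T - Q2 T) + sq (w1 T - w2 T) + sq (x1 T - x2 T)) * expR ((4 + rateK) * T).
Proof.
move=> G1 G2 T0; have [R1 S1] := G1; have [R2 S2] := G2.
(* The [stack] merely packs the differences of [w] and [x] into one vector; its middle slot is
   padding. *)
have D t : 0 <= t <= T -> is_derive t (1 : R)
    (fun s => sq (Q1 s - Q2 s) + sq (stack (w1 s - w2 s) 0 (x1 s - x2 s)))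
    (2 * \tr ((Q1 t - Q2 t)^T *m (Q1 t *m skew (w1 t) - Q2 t *m skew (w2 t)))
     + 2 * \tr ((stack (w1 t - w2 t) 0 (x1 t - x2 t))^T *m
        stack (wdot (eR (Q1 t) - eR (Q2 t)) (w1 t - w2 t) (x1 t - x2 t)) 0
              (xdot (eR (Q1 t) - eR (Q2 t)) (w1 t - w2 t) (x1 t - x2 t)))).
  move=> /andP[t0 _]; have [r1 v1 y1] := S1 t t0; have [r2 v2 y2] := S2 t t0.
  apply: derD; first exact: der_sq (mderB r1 r2).
  apply: der_sq; apply: mder_stack; [|exact: mder_cst|].
    by rewrite -wdotB; exact: mderB.
  by rewrite -xdotB; exact: mderB.
have := gronwall_lower (k := 4 + rateK) T0 D => /(_ _)/wrap[].
  move=> t /andP[t0 _].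
  have /= h1 := rotation_diff_rate (Q2 t) (w1 t) (w2 t) (global_SO3 G1 t0) ltr01.
  have h2 := trmx_mul_le (- stack (w1 t - w2 t) 0 (x1 t - x2 t))
    (stack (wdot (eR (Q1 t) - eR (Q2 t)) (w1 t - w2 t) (x1 t - x2 t)) 0
           (xdot (eR (Q1 t) - eR (Q2 t)) (w1 t - w2 t) (x1 t - x2 t))) ltr01.
  rewrite sqN linearN /= mulNmx linearN /= in h2.
  rewrite !sq_stack !sq0 in h2 *.
  have h3 := sq_wdot_xdot J AK Bth Bom CK Dth Dom (eR (Q1 t) - eR (Q2 t)) (w1 t - w2 t) (x1 t - x2 t).
  have h4 := sq_eR_le (Q1 t - Q2 t); rewrite eR_sub in h4.
  have h5 := rateK_ge0 J AK Bth Bom CK Dth Dom.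
  have h6 : rateK * sq (eR (Q1 t) - eR (Q2 t)) <= rateK * sq (Q1 t - Q2 t) by rewrite ler_wpM2l.
  move: h1; rewrite ler_norml => /andP[h1 _].
  have := sq_ge0 (Q1 t - Q2 t); have := sq_ge0 (w1 t - w2 t); have := sq_ge0 (x1 t - x2 t).
  rewrite invr1 in h1 h2; lra.
by rewrite !sq_stack !sq0 !addr0 !addrA subr0.
Qed.

End Trapped.

(** * Null sets *)

Section NullSets.
Variable R : realType.

Definition volume m (a b : 'cV[R]_m) : R := \prod_(i < m) (b i 0 - a i 0).

Definition in_box m (a b z : 'cV[R]_m) : Prop := forall i, a i 0 <= z i 0 <= b i 0.

Lemma volume_ge0 m (a b : 'cV[R]_m) : (forall i, a i 0 <= b i 0) -> 0 <= volume a b.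
Proof. by move=> ab; apply: prodr_ge0 => i _; rewrite subr_ge0. Qed.

Lemma ler_sum_subset (I : eqType) (s s' : seq I) (F : I -> R) : (forall i, 0 <= F i) ->
  uniq s -> {subset s <= s'} -> \sum_(i <- s) F i <= \sum_(i <- s') F i.
Proof.
move=> F0; elim: s s' => [|x s IH] s' /=; first by rewrite big_nil sumr_ge0.
move=> /andP[xs us] ss'.
have xs' : x \in s' by apply: ss'; rewrite mem_head.
rewrite big_cons (perm_big _ (perm_to_rem xs')) big_cons lerD2l IH // => y ys.
have := ss' y; rewrite inE ys orbT => /(_ isT).
rewrite (perm_mem (perm_to_rem xs')) inE => /orP[/eqP yx|//].
by rewrite -yx ys in xs.
Qed.

(** Numbers that encode no index get the degenerate box at 0, whose volume is 0 because the
    dimension is positive. *)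
Lemma null_of_countable_cover m (S : set 'cV[R]_m.+1) :
  (forall eps : R, 0 < eps -> exists (I : countType) (a b : I -> 'cV[R]_m.+1),
    [/\ forall k i, a k i 0 <= b k i 0, forall z, S z -> exists k, in_box (a k) (b k) z
     & forall s : seq I, uniq s -> \sum_(k <- s) volume (a k) (b k) <= eps]) ->
  lebesgue_null S.
Proof.
move=> H eps e0; have [I [a [b [ab cov vol]]]] := H eps e0.
pose ext (f : I -> 'cV[R]_m.+1) k := oapp f 0 (pickle_inv k : option I).
exists (ext a), (ext b); split; first by move=> k i; rewrite /ext; case: pickle_inv => [c|] /=.
split=> [z /cov[k Hk]|N]; first by exists (pickle k); rewrite /ext pickleK_inv.
apply: le_trans (vol (pmap pickle_inv (iota 0 N)) _).
  rewrite big_pmap -[leLHS](big_mkord xpredT (fun k => volume (ext a k) (ext b k))).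
  rewrite /index_iota subn0 le_eqVlt; apply/orP; left; apply/eqP; apply: eq_bigr => k _.
  by rewrite /ext; case: pickle_inv => [c|] //=; rewrite /volume big_ord_recl mxE subrr mul0r.
by apply: (pmap_uniq (@pickle_invK I)); exact: iota_uniq.
Qed.

Lemma null_subset m (S S' : set 'cV[R]_m) : (S `<=` S')%classic ->
  lebesgue_null S' -> lebesgue_null S.
Proof.
move=> SS' H eps /H[a [b [ab [cov vol]]]].
by exists a, b; split=> //; split=> // z /SS'; exact: cov.
Qed.

Lemma sum_half_pow (N : nat) : \sum_(i < N) (2^-1 : R) ^+ i.+1 <= 1.
Proof.
suff -> : \sum_(i < N) (2^-1 : R) ^+ i.+1 = 1 - 2^-1 ^+ N.
  by rewrite gerBl exprn_ge0 // invr_ge0.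
elim: N => [|N IH]; first by rewrite big_ord0 expr0 subrr.
by rewrite big_ord_recr /= IH !exprS; field.
Qed.

Lemma null_bigcup m (S : nat -> set 'cV[R]_m.+1) :
  (forall k, lebesgue_null (S k)) -> lebesgue_null [set z | exists k, S k z]%classic.
Proof.
move=> H; apply: null_of_countable_cover => eps e0.
have H' k : exists ab : (nat -> 'cV[R]_m.+1) * (nat -> 'cV[R]_m.+1),
    [/\ forall j i, ab.1 j i 0 <= ab.2 j i 0,
      forall z, S k z -> exists j, in_box (ab.1 j) (ab.2 j) z
     & forall N, \sum_(j < N) volume (ab.1 j) (ab.2 j) <= eps * 2^-1 ^+ k.+1].
  have [|a [b [ab [cov vol]]]] := H k (eps * 2^-1 ^+ k.+1).
    by rewrite mulr_gt0 // exprn_gt0 // invr_gt0.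
  by exists (a, b).
have [ab Hab] := choice H'.
exists (nat * nat)%type, (fun p => (ab p.1).1 p.2), (fun p => (ab p.1).2 p.2).
have v0 p : 0 <= volume ((ab p.1).1 p.2) ((ab p.1).2 p.2).
  by apply: volume_ge0 => i; case: (Hab p.1).
split.
- by move=> p i; case: (Hab p.1).
- by move=> z [k Sk]; case: (Hab k) => _ /(_ z Sk)[j Hj] _; exists (k, j).
(* A finite list of index pairs lies in a square of side [N], where the row sums are bounded by a
   geometric series. *)
move=> s us; pose N := (\sum_(p <- s) (p.1 + p.2)).+1.
have sN : {subset s <= [seq (i, j) | i <- iota 0 N, j <- iota 0 N]}.
  move=> [i j] ps; have : (i + j < N)%N by rewrite ltnS (big_rem _ ps) /= leq_addr.
  move=> ijN; apply/allpairsP; exists (i, j); rewrite !mem_iota /= !add0n; split=> //.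
    exact: leq_ltn_trans (leq_addr _ _) ijN.
  exact: leq_ltn_trans (leq_addl _ _) ijN.
apply: le_trans (ler_sum_subset v0 us sN) _; rewrite big_allpairs.
apply: (@le_trans _ _ (\sum_(i <- iota 0 N) eps * 2^-1 ^+ i.+1)).
  apply: ler_sum => i _; case: (Hab i) => _ _ /(_ N); apply: le_trans.
  by rewrite -(big_mkord xpredT (fun j => volume ((ab i).1 j) ((ab i).2 j))) /index_iota subn0.
rewrite -mulr_sumr -[iota 0 N]/(index_iota 0 N) big_mkord.
by rewrite ler_piMr ?(ltW e0) // sum_half_pow.
Qed.

Lemma null_bigcup_count (I : countType) m (S : I -> set 'cV[R]_m.+1) :
  (forall k, lebesgue_null (S k)) -> lebesgue_null [set z | exists k, S k z]%classic.
Proof.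
move=> H; apply: (@null_subset _ _ [set z | exists k : nat,
    oapp S set0 (unpickle k) z]%classic).
  by move=> z [k Sk]; exists (pickle k); rewrite pickleK.
apply: null_bigcup => k; case: unpickle => //=.
move=> eps e0; exists (fun=> 0), (fun=> 0); split=> //; split=> // N.
rewrite big1 ?ltW // => j _; by rewrite big_ord_recl mxE subrr mul0r.
Qed.

(* [f] loses one dimension, so [S] is covered by about [N ^ m] boxes of side [1 / N]. *)
Lemma null_of_inverse_lipschitz m (S : set 'cV[R]_m.+1) (f : 'cV[R]_m.+1 -> 'cV[R]_m)
    (B : nat) (L : R) : 0 <= L -> (forall z, S z -> forall i, `|f z i 0| <= B%:R) ->
  (forall z z', S z -> S z' -> sq (z - z') <= L * sq (f z - f z')) -> lebesgue_null S.
Proof.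
move=> L0 fB fL; apply: null_of_countable_cover => eps e0.
(* Points of one cell differ in square by at most L m / N^2 <= (r / N)^2. The boxes have side 2 r /
   N, and their total volume is at most C / N. *)
pose r := L * m%:R + 1; have r0 : 0 < r by rewrite ltr_wpDl // mulr_ge0.
pose C := (2 * B%:R + 1) ^+ m * (2 * r) ^+ m.+1.
have C0 : 0 < C by rewrite mulr_gt0 // exprn_gt0 // ?mulr_gt0 // ltr_wpDl // mulr_ge0.
pose N := (Num.truncn (C / eps)).+1.
have N0 : 0 < N%:R :> R by rewrite ltr0n.
have CN : C / N%:R <= eps.
  by rewrite ler_pdivrMr // mulrC -ler_pdivrMr // ltW // truncnS_gt.
pose K := (2 * B * N)%N.
(* The value B of a coordinate of [f] gives the index 2 B N itself, hence [K.+1] indices. An empty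
   cell gets the centre 0, which only costs volume. *)
pose cell (z : 'cV[R]_m.+1) : {ffun 'I_m -> 'I_K.+1} :=
  [ffun i => inord (Num.truncn ((f z i 0 + B%:R) * N%:R))].
pose pt (c : {ffun 'I_m -> 'I_K.+1}) := xget 0 [set z | S z /\ cell z = c]%classic.
exists {ffun 'I_m -> 'I_K.+1}, (fun c => \col_i (pt c i 0 - r / N%:R)),
  (fun c => \col_i (pt c i 0 + r / N%:R)).
have rN : 0 < r / N%:R by rewrite divr_gt0.
split.
- by move=> c i; rewrite !mxE; lra.
- move=> z Sz; exists (cell z).
  have [Sp pc] : S (pt (cell z)) /\ cell (pt (cell z)) = cell z.
    by rewrite /pt; case: xgetP => [z' _ []|/(_ z)] //; case.
  have close i : (f z i 0 - f (pt (cell z)) i 0) ^+ 2 <= (N%:R ^-1) ^+ 2.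
    have tr z' : S z' -> 0 <= (f z' i 0 + B%:R) * N%:R /\
        nat_of_ord (cell z' i) = Num.truncn ((f z' i 0 + B%:R) * N%:R).
      move=> Sz'; have /andP[h1 h2] : - B%:R <= f z' i 0 <= B%:R by rewrite -ler_norml fB.
      have t0 : 0 <= (f z' i 0 + B%:R) * N%:R by rewrite mulr_ge0 //; lra.
      split=> //; rewrite ffunE inordK // truncn_lt_nat //.
      apply: (@le_lt_trans _ _ K%:R); last by rewrite ltr_nat.
      by rewrite /K !natrM ler_pM2r //; lra.
    have [t0 c1] := tr z Sz; have [t0' c2] := tr _ Sp.
    rewrite pc c1 in c2.
    have /andP[a1 a2] := truncn_itv t0; have /andP[b1 b2] := truncn_itv t0'.
    rewrite -c2 in b1 b2; rewrite -[_.+1%:R]natr1 in a2 b2.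
    rewrite -[leLHS]real_normK ?num_real // ler_pXn2r ?nnegrE ?invr_ge0 ?ler0n //.
    rewrite -[leRHS]mul1r ler_pdivlMr // -[X in _ * X]ger0_norm ?(ltW N0) // -normrM ler_norml.
    by apply/andP; split; lra.
  have sqf : sq (f z - f (pt (cell z))) <= m%:R * (N%:R ^-1) ^+ 2.
    rewrite mulr_natl -[X in _ *+ X]card_ord -sumr_const; apply: ler_sum => i _.
    by rewrite big_ord1 !mxE.
  move=> i; rewrite !mxE; have := sq_entry (z - pt (cell z)) i 0; rewrite !mxE => h.
  have {h} : (z i 0 - pt (cell z) i 0) ^+ 2 <= (r / N%:R) ^+ 2.
    apply: le_trans h _; apply: le_trans (fL _ _ Sz Sp) _.
    apply: le_trans (ler_wpM2l L0 sqf) _; rewrite mulrA exprMn ler_wpM2r ?sqr_ge0 //.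
    have : 0 <= L * m%:R by rewrite mulr_ge0.
    by rewrite /r; nra.
  rewrite -[leLHS]real_normK ?num_real // ler_pXn2r ?nnegrE // ?(ltW rN) // ler_norml.
  by move=> /andP[h1 h2]; apply/andP; split; lra.
move=> s us; rewrite (eq_bigr (fun=> (2 * r / N%:R) ^+ m.+1)); last first.
  move=> c _; rewrite /volume -[m.+1 in RHS]card_ord -prodr_const; apply: eq_bigr => i _.
  by rewrite !mxE; lra.
apply: le_trans CN; rewrite big_const_seq count_predT iter_addr_0 -[leLHS]mulr_natl.
have sz : (size s)%:R <= ((2 * B%:R + 1) * N%:R) ^+ m :> R.
  apply: (@le_trans _ _ (#|{ffun 'I_m -> 'I_K.+1}|%:R)).
    by rewrite ler_nat -(card_uniqP us) max_card.
  rewrite card_ffun !card_ord natrX.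
  have KN : K.+1%:R <= (2 * B%:R + 1) * N%:R :> R.
    have : 1 <= N%:R :> R by rewrite ler1n.
    by rewrite -[K.+1%:R]natr1 /K !natrM; lra.
  by apply: lerXn2r => //; rewrite nnegrE ?ler0n //; exact: le_trans KN.
apply: (@le_trans _ _ (((2 * B%:R + 1) * N%:R) ^+ m * (2 * r / N%:R) ^+ m.+1)).
  rewrite ler_wpM2r // exprn_ge0 // divr_ge0 ?ler0n // mulr_ge0 //; exact: ltW.
have n0 : N%:R != 0 :> R by rewrite gt_eqF.
rewrite le_eqVlt; apply/orP; left; apply/eqP.
rewrite /C exprMn (expr_div_n (2 * r)) !exprS.
by field; rewrite n0 expf_neq0.
Qed.

End NullSets.

(** * The exponential chart *)

Section Chart.
Variable R : realType.
Implicit Types (u v : 'cV[R]_3).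

Lemma sin_lipschitz (a b : R) : `|sin b - sin a| <= `|b - a|.
Proof.
wlog ab : a b / a <= b.
  by move=> H; case: (leP a b) => [/H//|/ltW/H]; rewrite distrC (distrC a).
have [c _ ->] := der_mvt ab (fun t _ => is_derive_sin t).
rewrite normrM -[leRHS]mul1r ler_wpM2r // ler_norml cos_le1 andbT.
exact: cos_geN1.
Qed.

Lemma sin_zero_unique (a b : R) : `|b - a| <= 2^-1 -> sin a = 0 -> sin b = 0 -> a = b.
Proof.
wlog ab : a b / a <= b.
  move=> H; case: (leP a b) => [/H//|/ltW/H {}H]; rewrite distrC => h sa sb.
  by apply/esym; exact: H.
move=> h sa sb; have [c /andP[ac cb]] := der_mvt ab (fun t _ => is_derive_sin t).
rewrite sa sb subrr => /esym/eqP; rewrite mulf_eq0 subr_eq0 => /orP[/eqP c0|/eqP //].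
have := sin_lipschitz a c; have := cos2Dsin2 c; rewrite c0 sa subr0 expr0n add0r.
move=> s1 s2; have : `|sin c| <= 2^-1.
  apply: le_trans s2 _; apply: le_trans h.
  by rewrite !ger0_norm ?subr_ge0 // ?lerD2r.
rewrite ler_norml => /andP[h1 h2]; nra.
Qed.

Lemma expv_rodr v : sin (mnorm v) != 0 ->
  [/\ 0 < mnorm v, sq ((mnorm v)^-1 *: v) = 1 &
   expv v = rodr ((mnorm v)^-1 *: v) (cos (mnorm v)) (sin (mnorm v))].
Proof.
move=> s0; have v0 : 0 < mnorm v.
  rewrite lt_neqAle mnorm_ge0 andbT eq_sym; apply: contra s0 => /eqP ->.
  by rewrite sin0.
have a1 : sq ((mnorm v)^-1 *: v) = 1.
  by rewrite sqZ -mnorm_sqr -exprMn mulVf ?gt_eqF // expr1n.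
split=> //; rewrite /expv; case: eqVneq => [v0'|_]; last exact: expso3_rodr.
by move: v0; rewrite mnormE v0' sq0 sqrtr0 ltxx.
Qed.

Definition sin_bounded_on (lo hi d : R) : Prop :=
  forall t, lo <= t <= hi -> d <= `|sin t|.

(** On such a shell the trace gives |v|, because the cosine has derivative at least [d] in modulus;
    then e_R = sin |v| v / |v| gives the direction. *)
Lemma expv_inverse_lipschitz (lo hi d : R) : 0 < d -> sin_bounded_on lo hi d ->
  exists2 K, 0 <= K & forall v v', lo <= mnorm v <= hi -> lo <= mnorm v' <= hi ->
    sq (v - v') <= K * sq (expv v - expv v').
Proof.
move=> d0 sd; exists ((4 * hi ^+ 2 + (4 + 2 * hi ^+ 2) / d ^+ 2) / d ^+ 2).
  have h2 := sqr_ge0 hi; have d2 := sqr_ge0 d.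
  apply: divr_ge0 => //; apply: addr_ge0; first by lra.
  by apply: divr_ge0 => //; lra.
move=> v v' tv tv'; set t := mnorm v in tv *; set t' := mnorm v' in tv' *.
have nz r : lo <= r <= hi -> sin r != 0.
  by move=> /sd; apply: contraTneq => ->; rewrite normr0 -ltNge.
have [t0 a1 E] := expv_rodr (nz _ tv); have [t0' a1' E'] := expv_rodr (nz _ tv').
have d2 : 0 < d ^+ 2 by rewrite exprn_gt0.
set D := sq (expv v - expv v').
have ed : sq (eR (expv v) - eR (expv v')) <= D by rewrite -eR_sub; exact: sq_eR_le.
have cd : (cos t - cos t') ^+ 2 <= D.
  by have := cosR_diff (expv v) (expv v'); rewrite {1}E {1}E' !rodr_cosR.
have td : d ^+ 2 * (t - t') ^+ 2 <= D.
  apply: le_trans cd; rewrite -exprMn.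
  wlog tt : t t' tv tv' {t0 t0' a1 a1' E E' D ed} / t <= t'.
    move=> H; case: (leP t t') => [/(H t t' tv tv')//|/ltW/(H t' t tv' tv)].
    by rewrite !exprMn -(sqrrN (t' - t)) opprB -(sqrrN (cos t' - cos t)) opprB.
  have [c tc Ec] := der_mvt tt (fun r _ => is_derive_cos r).
  have -> : (cos t - cos t') ^+ 2 = (sin c) ^+ 2 * (t - t') ^+ 2.
    by rewrite -(sqrrN (cos t - cos t')) opprB Ec exprMn sqrrN -(sqrrN (t' - t)) opprB.
  rewrite exprMn ler_wpM2r ?sqr_ge0 // -[leRHS]real_normK ?num_real //.
  have sc : d <= `|sin c|.
    apply: sd; case/andP: tv => h1 _; case/andP: tv' => _ h2; case/andP: tc => h3 h4.
    by rewrite (le_trans h1) // (le_trans h4).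
  by apply: lerXn2r => //; rewrite nnegrE ?(ltW d0).
have sd2 : (sin t - sin t') ^+ 2 <= (t - t') ^+ 2.
  rewrite -[leLHS]real_normK ?num_real // -[leRHS]real_normK ?num_real //.
  by apply: lerXn2r; rewrite ?nnegrE // sin_lipschitz.
have ev r (u : 'cV[R]_3) : 0 < r -> r *: (sin r *: (r^-1 *: u)) = sin r *: u.
  by move=> r0; rewrite !scalerA; congr (_ *: _); field; rewrite gt_eqF.
have k1 : t *: eR (expv v) = sin t *: v by rewrite E eR_rodr ev.
have k2 : t' *: eR (expv v') = sin t' *: v' by rewrite E' eR_rodr ev.
have key : sin t *: (v - v') = t *: (eR (expv v) - eR (expv v'))
   + (t - t') *: eR (expv v') + - ((sin t - sin t') *: v').
  rewrite [t *: (_ - _)]scalerBr [(t - t') *: _]scalerBl addrA subrK k1 k2.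
  by rewrite scalerBr [(sin t - _) *: _]scalerBl opprB addrA subrK.
have : sq (sin t *: (v - v')) <= (4 * hi ^+ 2 + (4 + 2 * hi ^+ 2) / d ^+ 2) * D.
  rewrite key; apply: le_trans (sqD_le _ _) _; rewrite sqN.
  have := sqD_le (t *: (eR (expv v) - eR (expv v'))) ((t - t') *: eR (expv v')).
  rewrite (sqZ t) (sqZ (t - t')) (sqZ (sin t - sin t')).
  have e1 : sq (eR (expv v')) <= 1.
    by rewrite E' eR_rodr sqZ a1' mulr1 -/t'; have := cos2Dsin2 t'; have := sqr_ge0 (cos t'); lra.
  have v2 : sq v' <= hi ^+ 2.
    by rewrite -mnorm_sqr; apply: lerXn2r; rewrite ?nnegrE ?mnorm_ge0 //;
      case/andP: tv' => // _; apply: le_trans; exact: mnorm_ge0.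
  have t2 : t ^+ 2 <= hi ^+ 2.
    by apply: lerXn2r; rewrite ?nnegrE ?(ltW t0) //;
      case/andP: tv => // _; apply: le_trans; exact: ltW.
  have D0 : 0 <= D by exact: sq_ge0.
  have td' : (t - t') ^+ 2 <= D / d ^+ 2 by rewrite ler_pdivlMr // mulrC.
  have q1 : t ^+ 2 * sq (eR (expv v) - eR (expv v')) <= hi ^+ 2 * D.
    by apply: ler_pM => //; [exact: sqr_ge0|exact: sq_ge0].
  have q2 : (t - t') ^+ 2 * sq (eR (expv v')) <= D / d ^+ 2 * 1.
    by apply: ler_pM => //; [exact: sqr_ge0|exact: sq_ge0].
  have q3 : (sin t - sin t') ^+ 2 * sq v' <= D / d ^+ 2 * hi ^+ 2.
    by apply: ler_pM => //; [exact: sqr_ge0|exact: sq_ge0|exact: le_trans td'].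
  lra.
rewrite sqZ => h.
have s2 : d ^+ 2 * sq (v - v') <= sin t ^+ 2 * sq (v - v').
  rewrite ler_wpM2r ?sq_ge0 // -[leRHS]real_normK ?num_real //.
  by apply: lerXn2r; rewrite ?nnegrE ?(ltW d0) // sd.
rewrite mulrAC ler_pdivlMr // mulrC; exact: le_trans h.
Qed.

(** With 2 / (q + 1) <= |sin t|, the sine loses at most half of this over a length 1 / (q + 1). The
    rational endpoints keep the shells countable. *)
Lemma sin_bounded_piece (t : R) : 0 <= t -> sin t != 0 -> exists p q : nat,
  p%:R / q.+1%:R <= t <= p.+1%:R / q.+1%:R /\
  sin_bounded_on (p%:R / q.+1%:R) (p.+1%:R / q.+1%:R) q.+1%:R^-1.
Proof.
move=> t0 s0; have n0 : 0 < `|sin t| by rewrite normr_gt0.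
pose q := Num.truncn (2 / `|sin t|); exists (Num.truncn (t * q.+1%:R)), q.
have q0 : 0 < q.+1%:R :> R by rewrite ltr0n.
have hq : 2 / q.+1%:R <= `|sin t|.
  by rewrite ler_pdivrMr // mulrC -ler_pdivrMr // ltW // truncnS_gt.
have tq : 0 <= t * q.+1%:R by rewrite mulr_ge0.
have /andP[h1 h2] := truncn_itv tq.
have tp : (Num.truncn (t * q.+1%:R))%:R / q.+1%:R <= t <=
    (Num.truncn (t * q.+1%:R)).+1%:R / q.+1%:R.
  by rewrite ler_pdivrMr // h1 ler_pdivlMr // ltW.
split=> // r /andP[r1 r2]; case/andP: tp => p1 p2.
have len : (Num.truncn (t * q.+1%:R)).+1%:R / q.+1%:R
    = (Num.truncn (t * q.+1%:R))%:R / q.+1%:R + q.+1%:R^-1 :> R.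
  by move: (Num.truncn (t * _)) => T; rewrite -[T.+1%:R]natr1 mulrDl mul1r.
rewrite len in p2 r2; move: p1 p2 r1 r2 {len}; move: (_ / q.+1%:R) => A p1 p2 r1 r2.
have close (x y a d : R) : a <= x -> x <= a + d -> a <= y -> y <= a + d -> `|x - y| <= d.
  by move=> *; rewrite ler_norml; apply/andP; split; lra.
have tri (x y z d : R) : 2 * d <= x -> x <= z + y -> z <= d -> d <= y by lra.
apply: (tri `|sin t| _ `|sin t - sin r|) => //.
  by have := ler_distD (sin r) (sin t) 0; rewrite !subr0.
by apply: le_trans (sin_lipschitz _ _) _; exact: close p1 p2 r1 r2.
Qed.

(** A shell of width 1/2 contains at most one zero radius of the sine, so |v| is constant on each
    piece and a dominant coordinate is a Lipschitz function of the others. *)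
Lemma null_sphere_cylinders n :
  lebesgue_null [set z : 'cV[R]_(3 + (3 + n)) | sin (mnorm (usubmx z)) = 0]%classic.
Proof.
pose S (i : nat * 'I_3 * bool * nat) := [set z : 'cV[R]_(3 + (3 + n)) |
  [/\ sin (mnorm (usubmx z)) = 0, i.1.1.1%:R / 2 <= mnorm (usubmx z) <= i.1.1.1.+1%:R / 2,
   dominant i.1.1.2 ((-1) ^+ nat_of_bool i.1.2 *: usubmx z) & sq z <= i.2%:R ^+ 2]]%classic.
apply: (@null_subset _ _ _ [set z | exists i, S i z]%classic).
  move=> z /= sz; have [j [b dj]] := dominant_exists (usubmx z).
  pose p := Num.truncn (mnorm (usubmx z) * 2).
  have /andP[h1 h2] : p%:R <= mnorm (usubmx z) * 2 < p.+1%:R.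
    by apply: truncn_itv; rewrite mulr_ge0 ?mnorm_ge0.
  exists (p, j, b, (Num.truncn (mnorm z)).+1); split=> //=.
    by rewrite ler_pdivrMr // h1 ler_pdivlMr // ltW.
  by rewrite -mnorm_sqr; apply: lerXn2r; rewrite ?nnegrE ?mnorm_ge0 ?ler0n // ltW // truncnS_gt.
apply: (@null_bigcup_count _ _ (2 + (3 + n)) S) => -[[[p j] b] B].
pose f (z : 'cV[R]_(3 + (3 + n))) : 'cV[R]_(2 + (3 + n)) :=
  col_mx (others j ((-1) ^+ nat_of_bool b *: usubmx z)) (dsubmx z).
have sqz (z : 'cV[R]_(3 + (3 + n))) : sq z = sq (usubmx z) + sq (dsubmx z).
  by rewrite -{1}(vsubmxK z) sq_col_mx.
have sgn (u : 'cV[R]_3) : sq ((-1) ^+ nat_of_bool b *: u) = sq u.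
  by rewrite sqZ -exprM mulnC exprM sqrrN !expr1n mul1r.
have lip (z z' : 'cV[R]_(3 + (3 + n))) : S (p, j, b, B) z -> S (p, j, b, B) z' ->
    sq (z - z') <= 3 * sq (f z - f z').
  move=> [/= sz zp dz _] [/= sz' zp' dz' _].
  have E : mnorm (usubmx z) = mnorm (usubmx z').
    apply: sin_zero_unique => //.
    rewrite ler_norml; case/andP: zp => h1 h2; case/andP: zp' => h3 h4.
    by rewrite -natr1 in h2 h4; apply/andP; split; lra.
  have E2 : sq (usubmx z) = sq (usubmx z') by rewrite -!mnorm_sqr E.
  have := dominant_sq_diff _ dz dz'; rewrite !sgn => /(_ E2).
  rewrite -scalerBr sgn /f opp_col_mx add_col_mx sq_col_mx (sqz (z - z')) !linearB /=.
  have := sq_ge0 (dsubmx z - dsubmx z'); lra.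
have bnd (z : 'cV[R]_(3 + (3 + n))) : S (p, j, b, B) z -> forall i, `|f z i 0| <= B%:R.
  move=> [_ _ _ /= zB] i; rewrite -(@ler_pXn2r _ 2) ?nnegrE ?ler0n ?normr_ge0 //.
  rewrite real_normK ?num_real //.
  apply: le_trans zB; apply: le_trans (sq_entry (f z) i 0) _.
  by rewrite sqz sq_col_mx lerD2r -[leRHS]sgn (sq_others j) lerDr sqr_ge0.
have L0 : (0 : R) <= 3 by lra.
exact: (@null_of_inverse_lipschitz R (2 + (3 + n)) (S (p, j, b, B)) f B 3 L0 bnd lip).
Qed.

End Chart.

(** * Nullity of the trapped initial states *)

Section TrappedNull.
Variables (R : realType) (n : nat) (J : 'M[R]_3) (AK : 'M[R]_n)
  (Bth Bom : 'M[R]_(n, 3)) (CK : 'M[R]_(3, n)) (Dth Dom : 'M[R]_3).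

Local Notation global_solution := (global_solution J AK Bth Bom CK Dth Dom).
Local Notation rateK := (rateK J AK Bth Bom CK Dth Dom).

Variables (eps L : R).
Hypotheses (L_ge0 : 0 <= L)
  (close : forall Q1 w1 x1 Q2 w2 x2 t0, global_solution Q1 w1 x1 -> global_solution Q2 w2 x2 ->
    0 <= t0 -> (forall t, t0 <= t -> near_pi eps Q1 w1 x1 t) ->
    (forall t, t0 <= t -> near_pi eps Q2 w2 x2 t) ->
  forall (j : 'I_3) (a1 a2 : 'cV[R]_3) c1 s1 c2 s2,
    Q1 t0 = rodr a1 c1 s1 -> Q2 t0 = rodr a2 c2 s2 -> sq a1 = 1 -> sq a2 = 1 ->
    c1 ^+ 2 + s1 ^+ 2 = 1 -> c2 ^+ 2 + s2 ^+ 2 = 1 -> dominant j a1 -> dominant j a2 ->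
    sq (Q1 t0 - Q2 t0) + sq (w1 t0 - w2 t0) + sq (x1 t0 - x2 t0) <=
    L * (sq (others j a1 - others j a2) + sq (w1 t0 - w2 t0) + sq (x1 t0 - x2 t0))).

Definition trapped_init (T : nat) (Re : R -> 'M[R]_3) w x (Q : 'M[R]_3) v (y : 'cV[R]_n) :=
  [/\ global_solution Re w x, Re 0 = Q, w 0 = v, x 0 = y &
    forall t, T%:R <= t -> near_pi eps Re w x t].

Let data := ((R -> 'M[R]_3) * (R -> 'cV[R]_3) * (R -> 'cV[R]_n) * 'cV[R]_3 * R * R)%type.

Let good (T : nat) (j : 'I_3) (z : 'cV[R]_(3 + (3 + n))) (d : data) : Prop :=
  let: (Re, w, x, a, c, s) := d in
  trapped_init T Re w x (expv (usubmx z)) (usubmx (dsubmx z)) (dsubmx (dsubmx z)) /\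
  [/\ Re T%:R = rodr a c s, sq a = 1, c ^+ 2 + s ^+ 2 = 1 & dominant j a].

(** Countably many pieces: [T] is a time from which the solution is trapped, [j] the chart of axes,
    and [p], [q] the shell on which the exponential is inverted. *)
Let piece (i : nat * 'I_3 * nat * nat) : set 'cV[R]_(3 + (3 + n)) :=
  let: (T, j, p, q) := i in
  [set z | [/\ sin_bounded_on (p%:R / q.+1%:R) (p.+1%:R / q.+1%:R) (q.+1%:R^-1 : R),
    p%:R / q.+1%:R <= mnorm (usubmx z) <= p.+1%:R / q.+1%:R & exists d, good T j z d]]%classic.

Let null_piece i : @lebesgue_null R (2 + (3 + n)).+1 (piece i).
Proof.
case: i => [[[T j] p] q].
(* Without the bound on the sine the piece is empty. *)
have [sd|nsd] := pselect (sin_bounded_on (p%:R / q.+1%:R) (p.+1%:R / q.+1%:R) (q.+1%:R^-1 : R));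
  last first.
  have sub : (piece (T, j, p, q) `<=` [set z | sin (mnorm (usubmx z)) = 0])%classic.
    by move=> z [/nsd].
  exact: null_subset sub (@null_sphere_cylinders R n).
have d0 : 0 < q.+1%:R^-1 :> R by rewrite invr_gt0.
have [K K0 HK] := expv_inverse_lipschitz d0 sd.
(* One trapped solution is chosen for each initial state; the estimates on pairs hold for any
   choice. Off the piece the data are arbitrary. *)
have /choice[D HD] : forall z : 'cV[R]_(3 + (3 + n)), exists d : data,
    piece (T, j, p, q) z -> good T j z d.
  move=> z; have [[_ _ [d Hd]]|nz] := pselect (piece (T, j, p, q) z); first by exists d.
  by exists (fun=> 0, fun=> 0, fun=> 0, 0, 0, 0).
pose f (z : 'cV[R]_(3 + (3 + n))) : 'cV[R]_(2 + (3 + n)) :=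
  let: (Re, w, x, a, c, s) := D z in col_mx (others j a) (col_mx (w T%:R) (x T%:R)).
pose B := (Num.truncn (1 + eps)).+1.
have bnd (z : 'cV[R]_(3 + (3 + n))) : piece (T, j, p, q) z -> forall i, `|f z i 0| <= B%:R.
  move=> Sz i; rewrite -(@ler_pXn2r _ 2) ?nnegrE ?ler0n ?normr_ge0 // real_normK ?num_real //.
  apply: le_trans (sq_entry (f z) i 0) _.
  have := HD z Sz; rewrite /f; case: (D z) => [[[[[Re w] x] a] c] s] [[_ _ _ _ N] [_ a1 _ _]].
  have [h _] := N T%:R (lexx _); rewrite sq_stack in h.
  rewrite !sq_col_mx; rewrite (sq_others j) in a1.
  have := sqr_ge0 (a j 0); have := sq_ge0 (eR (Re T%:R)).
  have : 1 + eps < B%:R := truncnS_gt _.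
  have : 1 <= B%:R :> R by rewrite ler1n.
  by nra.
(* From right to left: the Lipschitz bound at time [T], the way back to time 0, and the chart, with
   [K] for its rotation part and 1 for the other components. *)
pose LL := (K + 1) * (expR ((4 + rateK) * T%:R) * L).
have LL0 : 0 <= LL by rewrite !mulr_ge0 ?expR_ge0 // addr_ge0.
have lip (z z' : 'cV[R]_(3 + (3 + n))) : piece (T, j, p, q) z -> piece (T, j, p, q) z' ->
    sq (z - z') <= LL * sq (f z - f z').
  move=> Sz Sz'; have [_ tz _] := Sz; have [_ tz' _] := Sz'.
  have hK := HK _ _ tz tz'.
  have zE : sq (z - z') = sq (usubmx z - usubmx z')
      + sq (usubmx (dsubmx z) - usubmx (dsubmx z')) + sq (dsubmx (dsubmx z) - dsubmx (dsubmx z')).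
    by rewrite -{1}(vsubmxK (z - z')) sq_col_mx -(vsubmxK (dsubmx (z - z'))) sq_col_mx !linearB addrA.
  have := HD z Sz; have := HD z' Sz'; rewrite /f.
  case: (D z) => [[[[[Q1 w1] x1] a1] c1] s1]; case: (D z') => [[[[[Q2 w2] x2] a2] c2] s2].
  move=> [[G2 Q20 w20 x20 N2] [Q2T A2 cs2 dm2]] [[G1 Q10 w10 x10 N1] [Q1T A1 cs1 dm1]].
  have T0 : 0 <= T%:R :> R by rewrite ler0n.
  have h := close G1 G2 T0 N1 N2 Q1T Q2T A1 A2 cs1 cs2 dm1 dm2.
  have b := backward_close G1 G2 T0.
  rewrite Q10 Q20 w10 w20 x10 x20 in b.
  rewrite !opp_col_mx !add_col_mx !sq_col_mx zE addrA.
  set X := sq (others j a1 - _) + _ + _ in h *.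
  have E0 := expR_ge0 ((4 + rateK) * T%:R).
  have hb : sq (expv (usubmx z) - expv (usubmx z')) + sq (usubmx (dsubmx z) - usubmx (dsubmx z'))
      + sq (dsubmx (dsubmx z) - dsubmx (dsubmx z')) <= expR ((4 + rateK) * T%:R) * L * X.
    by apply: le_trans b _; rewrite mulrC -mulrA ler_wpM2l.
  apply: (@le_trans _ _ ((K + 1) * (sq (expv (usubmx z) - expv (usubmx z'))
      + sq (usubmx (dsubmx z) - usubmx (dsubmx z')) + sq (dsubmx (dsubmx z) - dsubmx (dsubmx z'))))).
    have := sq_ge0 (expv (usubmx z) - expv (usubmx z')).
    have : 0 <= K * (sq (usubmx (dsubmx z) - usubmx (dsubmx z'))
       + sq (dsubmx (dsubmx z) - dsubmx (dsubmx z'))) by rewrite mulr_ge0 ?addr_ge0 ?sq_ge0.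
    by move: hK; lra.
  by rewrite /LL -(mulrA (K + 1)) ler_wpM2l // addr_ge0.
exact: (@null_of_inverse_lipschitz R (2 + (3 + n)) (piece (T, j, p, q)) f B LL LL0 bnd lip).
Qed.

Lemma trapped_null : state_null
  [set z | exists T Re w x, trapped_init T Re w x z.1.1 z.1.2 z.2]%classic.
Proof.
pose S (o : option (nat * 'I_3 * nat * nat)) : set 'cV[R]_(3 + (3 + n)) :=
  oapp piece [set z | sin (mnorm (usubmx z)) = 0]%classic o.
have Snull : @lebesgue_null R (2 + (3 + n)).+1 [set z | exists o, S o z]%classic.
  apply: null_bigcup_count => -[i|]; first exact: null_piece.
  exact: (@null_sphere_cylinders R n).
apply: (@null_subset R (3 + (3 + n)) _ _ _ Snull) => z [T [Re [w [x H]]]].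
have [s0|s0] := eqVneq (sin (mnorm (usubmx z))) 0; first by exists None.
have [p [q [tz sd]]] := sin_bounded_piece (mnorm_ge0 _) s0.
have [G _ _ _ _] := H; have SR := global_SO3 G (ler0n R T).
have [a [c [s [a1 cs RE]]]] := rodrigues SR.
have [j [b dj]] := dominant_exists a.
have bb : (-1) ^+ nat_of_bool b * (-1) ^+ nat_of_bool b = 1 :> R.
  by rewrite -expr2 -exprM mulnC exprM sqrrN !expr1n.
exists (Some (T, j, p, q)); split=> //.
(* Changing the sign of both axis and sine leaves the rotation unchanged. *)
exists (Re, w, x, (-1) ^+ nat_of_bool b *: a, c, (-1) ^+ nat_of_bool b * s); split=> //.
split=> //.
- rewrite RE; apply/matrixP => i l; rewrite !rodrE skewZ [((-1) ^+ _ *: skew a) i l]mxE !mxE.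
  set sg := (-1) ^+ _ in bb *.
  have -> : sg * a i 0 * (sg * a l 0) = a i 0 * a l 0 by rewrite mulrACA bb mul1r.
  by rewrite [sg * s]mulrC -mulrA (mulrA sg sg) bb mul1r.
- by rewrite sqZ expr2 bb a1 mul1r.
- by rewrite exprMn (expr2 ((-1) ^+ _)) bb mul1r.
Qed.

End TrappedNull.

Theorem theorem1 (R : realType) (n : nat) (J : 'M[R]_3)
  (AK : 'M[R]_n) (Bth Bom : 'M[R]_(n, 3)) (CK : 'M[R]_(3, n)) (Dth Dom : 'M[R]_3)
  (p11 : R) (P21 P22 : 'M[R]_3) (P31 P32 : 'M[R]_(n, 3)) (P33 : 'M[R]_n) :
  posdef J ->
  minimal_realization AK (row_mx Bth Bom) CK (row_mx Dth Dom) ->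
  P22^T = P22 -> P33^T = P33 -> P22 *m J = J *m P22 ->
  posdef (Pmat J p11 P21 P22 P31 P32 P33) ->
  (exists tau1 tau2 : R, 0 < tau1 /\ 0 < tau2 /\
     negdef (M1mat J AK Bth Bom CK Dth Dom p11 P21 P22 P31 P32 P33 tau1 tau2)) ->
  (* (1) stability of the zero error equilibrium (I, 0, 0) *)
  stable_eq J AK Bth Bom CK Dth Dom 1
  /\
  (* (2) convergence of every solution *)
  (forall Re w x, is_solution J AK Bth Bom CK Dth Dom Re w x ->
     to0 (fun t => mnorm (eR (Re t))) /\
     to0 (fun t => mnorm (w t)) /\ to0 (fun t => mnorm (x t)) /\
     (forall eps : R, 0 < eps -> exists T : R, forall t, T <= t ->
        exists Q, (Q = 1 \/ exists a, S2 a /\ Q = expso3 pi a) /\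
                  mnorm (Re t - Q) < eps))
  /\
  (* (3) the undesired equilibria are unstable *)
  (forall a, S2 a -> ~ stable_eq J AK Bth Bom CK Dth Dom (expso3 pi a))
  /\
  (* (4) almost global asymptotic stability of (I, 0, 0) *)
  AGAS_identity J AK Bth Bom CK Dth Dom.
Proof.
move=> Jp _ P22s P33s _ Pp [tau1 [tau2 [t1 [t2 M1n]]]].
have Ju := posdef_unitmx Jp; have [Js _] := Jp; have [Ps _] := Pp.
have [lam lam0 Pc] := posdef_coercive Pp; have [k k0 Mc] := posdef_coercive M1n.
set P := Pmat J p11 P21 P22 P31 P32 P33 in Ps Pc.
have Pee (e : 'cV[R]_3) : dot (stack e 0 (0 : 'cV[R]_n)) (P *m stack e 0 0) = p11 * sq e.
  rewrite /P /Pmat block3_stack dot_stack !mulmx0 !addr0 mul_scalar_mx dotZr -sq_dot.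
  by rewrite /dot !big1 ?addr0 // => i _; rewrite mxE mul0r.
have p0 : 0 < p11.
  pose e : 'cV[R]_3 := const_mx 1.
  have e0 : 0 < sq e.
    by rewrite sq_dot /dot sum3 !mxE; lra.
  have := Pc (stack e 0 0); rewrite Pee sq_stack !sq0 !addr0 ler_pM2r //; lra.
have rate (e w de : 'cV[R]_3) (x : 'cV[R]_n) : sq de <= sq w ->
    2 * dot (stack e w x) (P *m stack de (wdot J CK Dth Dom e w x) (xdot AK Bth Bom e w x))
      - 2 * p11 * dot e de + 2 * p11 * dot e w <= - k * sq (stack e w x).
  move=> dew; have dwE : J *m wdot J CK Dth Dom e w x = CK *m x + Dth *m e + Dom *m w.
    by rewrite /wdot mulKVmx.
  apply: le_trans (lyap_rate_le AK Bth Bom p11 P21 P31 P32 Js P22s P33s t1 t2 dew dwE) _.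
  by have := Mc (stack e w x); rewrite mulNmx dotNr; lra.
have toG Re w x : is_solution J AK Bth Bom CK Dth Dom Re w x ->
    global_solution J AK Bth Bom CK Dth Dom Re w x by exact: solution_solves_at.
have ofG Re w x : global_solution J AK Bth Bom CK Dth Dom Re w x ->
    is_solution J AK Bth Bom CK Dth Dom Re w x.
  move=> [R0 S]; split=> // t /S[Rd wd xd]; split=> //; split; last by move=> i; exact: xd.
  exists (wdot J CK Dth Dom (eR (Re t)) (w t) (x t)); split; first by move=> i; exact: wd.
  by rewrite /wdot mulKVmx.
have st : stable_eq J AK Bth Bom CK Dth Dom 1.
  move=> eps e0; have [del d0 H] := lyapunov_stable Ps p0 lam0 k0 Pc rate e0.
  by exists del; split=> // Re w x /toG G; exact: H.
split=> //; split; last split; last split=> //.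
- move=> Re w x /toG G; have van := state_vanishes Ps p0 lam0 k0 Pc rate G.
  have tail m (g : R -> 'cV[R]_m) : (forall t, sq (g t) <= sq (state Re w x t)) ->
      to0 (fun t => mnorm (g t)).
    move=> gs eps e0; have [|T _ HT] := van (eps ^+ 2); first by rewrite exprn_gt0.
    exists T => t Tt; rewrite ger0_norm ?mnorm_ge0 // mnorm_lt //.
    exact: le_lt_trans (gs t) (HT t Tt).
  have parts t : sq (state Re w x t) = sq (eR (Re t)) + sq (w t) + sq (x t) by exact: sq_stack.
  split; last split; last split.
  + by apply: tail => t; rewrite parts; have := sq_ge0 (w t); have := sq_ge0 (x t); lra.
  + by apply: tail => t; rewrite parts; have := sq_ge0 (eR (Re t)); have := sq_ge0 (x t); lra.
  + by apply: tail => t; rewrite parts; have := sq_ge0 (eR (Re t)); have := sq_ge0 (w t); lra.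
  + by move=> eps e0; have [T _ HT] := attitude_limit Ps p0 lam0 k0 Pc rate G e0; exists T.
- move=> a Sa H; have a1 : sq a = 1.
    by rewrite -[RHS]Sa sq_dot; apply: eq_bigr => i _; rewrite expr2.
  have nS := pi_rotation_unstable Ps p0 lam0 k0 Pc rate Pee a1; apply: nS => eps e0.
  have [del [d0 Hd]] := H eps e0; exists del; split=> // Re w x /ofG; exact: Hd.
- have [eps [L [e0 L0 close]]] := trapped_pair_close Ps p0 lam0 k0 Pc rate Pee.
  exists [set z | exists T Re w x,
    trapped_init J AK Bth Bom CK Dth Dom eps T Re w x z.1.1 z.1.2 z.2]%classic.
  split; first exact: trapped_null L0 close.
  move=> Re w x /toG G nN.
  have [t0 t00 Vt] : exists2 t0, 0 <= t0 & lyap P p11 Re w x t0 < 4 * p11.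
    apply: contrapT => HV; apply: nN.
    have HV' t : 0 <= t -> 4 * p11 <= lyap P p11 Re w x t.
      by move=> t_ge; rewrite leNgt; apply/negP => lt; apply: HV; exists t.
    have [T T0 HT] := near_pi_of_lyap_ge Ps p0 lam0 k0 Pc rate G HV' e0.
    (* The trapping time is rounded up to a natural number, which keeps the exceptional set a
       countable union. *)
    exists (Num.truncn T).+1, Re, w, x; split=> // t Tt; apply: HT.
    by apply: le_trans Tt; rewrite ltW // truncnS_gt.
  move=> r r0; have [T _ HT] := converges_of_lyap_lt Ps p0 lam0 k0 Pc rate G t00 Vt r0.
  exists T => t Tt; rewrite ger0_norm; first exact: HT.
  by rewrite /sdist !addr_ge0 // mnorm_ge0.
Qed.
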